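(* Let $(\mathfrak{g},\mathcal{Q})$ be a quadratic Lie algebra and let $c\in\mathrm{O}(\mathfrak{g})$ be an automorphism of the Lie algebra $\mathfrak{g}$. Let $\mathfrak{k}\subset\mathfrak{g}$ be a quadratic subalgebra (a Lie subalgebra on which $\mathcal{Q}$ restricts to a non-degenerate form) contained in the fixed point set of $c$, and let $\mathfrak{p}$ be its orthogonal complement, so that $\mathfrak{g}=\mathfrak{k}\oplus\mathfrak{p}$. Suppose that for $\mu$ in an open dense subset of $\mathfrak{k}$ the operator $c\exp(\mathrm{ad}_\mu)-I$ is invertible on $\mathfrak{p}$. Define meromorphic functions $\mathfrak{r}^{\mathfrak{k}}:\mathfrak{k}\to\wedge^2\mathfrak{k}$ and $\mathfrak{r}^{\mathfrak{p}}_c:\mathfrak{k}\to\wedge^2\mathfrak{p}$ by $$\mathfrak{r}^{\mathfrak{k}}(\mu)=\lambda\big(f(\mathrm{ad}_\mu|_{\mathfrak{k}})\big),\qquad \mathfrak{r}^{\mathfrak{p}}_c(\mu)=\frac12\lambda\Big(\frac{c\exp(\mathrm{ad}_\mu)+I}{c\exp(\mathrm{ad}_\mu)-I}\Big|_{\mathfrak{p}}\Big),$$ where $f(z)=\frac12\coth(z/2)-\frac1z$. Then $\mathfrak{r}=\mathfrak{r}^{\mathfrak{k}}+\mathfrak{r}^{\mathfrak{p}}_c$ solves the classical dynamical Yang-Baxter equation for $\mathfrak{k}\subset\mathfrak{g}$ with coupling constant $\epsilon=\frac14$: $$\sum_i\frac{\partial\mathfrak{r}}{\partial\mu_i}\wedge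 e_i+\frac12[\mathfrak{r},\mathfrak{r}]^{\mathfrak{g}}=\frac14\,\Theta .$$
   Context: A quadratic Lie algebra is a finite-dimensional real Lie algebra $\mathfrak{g}$ with Lie bracket $[\cdot,\cdot]^{\mathfrak{g}}$ and an invariant non-degenerate quadratic form $\mathcal{Q}$, with associated bilinear form $B(\mu,\mu')=\frac12(\mathcal{Q}(\mu+\mu')-\mathcal{Q}(\mu)-\mathcal{Q}(\mu'))$; invariance means that each $\mathrm{ad}_\mu$ is skew-adjoint for $B$. $\mathrm{O}(\mathfrak{g})$ is the orthogonal group of $(\mathfrak{g},\mathcal{Q})$. For a subspace $V\subset\mathfrak{g}$ on which $B$ is non-degenerate, with basis $e_a$ and $B$-dual basis $e^a\in V$, and $A\in\mathfrak{o}(V)$ (skew-adjoint endomorphism of $V$), $\lambda(A)=\frac12\sum_aA(e_a)\wedge e^a\in\wedge^2V$; this is applied with $V=\mathfrak{k}$ and $V=\mathfrak{p}$. Functions of operators are defined by functional calculus ($f$ is extended holomorphically to $z=0$); $\frac{X}{Y}$ for commuting operators means $XY^{-1}$. $\mathfrak{k}^*$ is identified with $\mathfrak{k}$ via $B|_{\mathfrak{k}}$. In the equation, $e_i$ is a basis of $\mathfrak{k}$, $e^i\in\mathfrak{k}$ the $B$-dual basis, and $\mu_i$ are the coordinates $\mu=\sum_i\mu_ie^i$; the equation is an identity of meromorphic functions on $\mathfrak{k}$ with values in $\wedge^3\mathfrak{g}$. $[\cdot,\cdot]^{\mathfrak{g}}$ on $\wedge\mathfrak{g}$ is the Schouten bracket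 extending the Lie bracket; for a basis $e_a$ of $\mathfrak{g}$ and $\mathfrak{r}=\frac12\sum_{ab}\mathfrak{r}^{ab}e_a\wedge e_b$, $[\mathfrak{r},\mathfrak{r}]^{\mathfrak{g}}=\sum_{abckl}\mathfrak{r}^{ak}f_{kl}^b\mathfrak{r}^{lc}\,e_a\wedge e_b\wedge e_c$, where $[e_k,e_l]^{\mathfrak{g}}=\sum_bf_{kl}^be_b$. $\Theta\in\wedge^3\mathfrak{g}$ is the cubic element $\Theta=-\frac16\sum_{abc}B(e^a,[e^b,e^c]^{\mathfrak{g}})\,e_a\wedge e_b\wedge e_c$ (with $e_a$ a basis of $\mathfrak{g}$, $e^a$ its $B$-dual basis). *)

(* Defs.v *)
From mathcomp Require Import all_boot all_order all_algebra.
From mathcomp Require Import complex.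
From mathcomp Require Import all_classical all_reals all_analysis.

Set Implicit Arguments.
Unset Strict Implicit.
Unset Printing Implicit Defensive.

Import Order.TTheory GRing.Theory Num.Theory.
Import numFieldNormedType.Exports.
Local Open Scope classical_set_scope.
Local Open Scope ring_scope.

Section FunctionalCalculus.
Context {R : realType} {V : vectType R}.
Implicit Types (A T : 'End(V)) (p q : {poly R}) (f : R[i] -> R[i]).

Definition lfun_horner p A : 'End(V) :=
  \sum_(i < size p) p`_i *: iter i (fun T => (A \o T)%VF) \1%VF.

Definition cpoly p : {poly R[i]} := map_poly (real_complex R) p.

(* [T = f(A)]: [T = p(A)] for a real polynomial [p] that agrees with [f]
   modulo an annihilating polynomial [q] of [A], as germs at the complex roots
   of [q]. For [f] holomorphic near the spectrum and commuting with complex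
   conjugation this is the holomorphic functional calculus. Only punctured
   neighbourhoods are inspected, so removable singularities of [f] are filled
   in; no [T] exists if [f] has a pole at an eigenvalue of [A]. *)
Definition is_fun_of f A T : Prop :=
  exists p q,
    [/\ q != 0, lfun_horner q A = 0, T = lfun_horner p A &
        forall w : R[i], root (cpoly q) w ->
          exists C d : R[i], 0 < d /\
            forall z : R[i], z != w -> `|z - w| < d ->
              `|f z - (cpoly p).[z]| <= C * `|(cpoly q).[z]| ].

Definition fun_of_defined f A : Prop := exists T, is_fun_of f A T.

Definition fun_of f A : 'End(V) := xget 0 [set T | is_fun_of f A T].

End FunctionalCalculus.

Section ComplexFunctions.
Context {R : realType}.
Implicit Type z : R[i].

Definition cexp z : R[i] :=
  let: (x +i* y)%C := z in (expR x * cos y +i* (expR x * sin y))%C.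

Definition ccoth z : R[i] :=
  ((cexp z + cexp (- z)) / 2) / ((cexp z - cexp (- z)) / 2).

Definition f_cdybe z : R[i] := 2^-1 * ccoth (z / 2) - z^-1.

End ComplexFunctions.

Section Topology.
Context {R : realType} {V : vectType R}.

(* The topology of a finite-dimensional real vector space is transported from
   row vectors; it does not depend on the basis. *)
Definition of_coords (x : 'rV[R]_(\dim {:V})) : V :=
  \sum_i x 0 i *: (vbasis {:V})`_i.

Definition vopen (U : set V) : Prop := open (of_coords @^-1` U).

Definition vdense (U : set V) : Prop := dense (of_coords @^-1` U).

End Topology.

Section QuadraticLie.
Context {R : realType} {g : vectType R}.
Implicit Types (br : g -> g -> g) (Q : g -> R) (k : {vspace g}) (c : 'End(g)).

Definition polar Q (x y : g) : R := 2^-1 * (Q (x + y) - Q x - Q y).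

Record is_lie_bracket br : Prop := IsLieBracket {
  lie_linearr : forall x, linear (br x);
  lie_linearl : forall y, linear (br^~ y);
  lie_alternating : forall x, br x x = 0;
  lie_jacobi : forall x y z, br x (br y z) + br y (br z x) + br z (br x y) = 0
}.

Record is_quadratic_form Q : Prop := IsQuadraticForm {
  quad_homogeneous : forall (a : R) x, Q (a *: x) = a ^+ 2 * Q x;
  quad_polar_linearr : forall x, scalar (polar Q x);
  quad_polar_linearl : forall y, scalar ((polar Q)^~ y)
}.

Definition nondegenerate_on Q k : Prop :=
  forall x, x \in k -> (forall y, y \in k -> polar Q x y = 0) -> x = 0.

Record is_quadratic_lie br Q : Prop := IsQuadraticLie {
  qlie_bracket : is_lie_bracket br;
  qlie_form : is_quadratic_form Q;
  qlie_nondegenerate : nondegenerate_on Q {:g};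
  qlie_invariant : forall m x y, polar Q (br m x) y = - polar Q x (br m y)
}.

Record is_quadratic_subalgebra br Q k : Prop := IsQuadraticSubalgebra {
  subalg_bracket : forall x y, x \in k -> y \in k -> br x y \in k;
  subalg_nondegenerate : nondegenerate_on Q k
}.

Record is_orthogonal_automorphism br Q c : Prop := IsOrthogonalAutomorphism {
  orth_inj : lker c == 0%VS;
  orth_form : forall x, Q (c x) = Q x;
  auto_bracket : forall x y, c (br x y) = br (c x) (c y)
}.

Definition is_orthogonal_complement Q (k p : {vspace g}) : Prop :=
  forall x, (x \in p) <-> (forall y, y \in k -> polar Q x y = 0).

Definition dual_bases Q k d (e e' : d.-tuple g) : Prop :=
  [/\ basis_of k e, forall i : 'I_d, e'`_i \in k &
      forall i j : 'I_d, polar Q e`_i e'`_j = (i == j)%:R].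

Definition ad br (m : g) : 'End(g) := linfun (br m).

(* The restriction of [A] to [k], meaningful when [k] is stable under [A]. *)
Definition restr k (A : 'End(g)) : 'End(subvs_of k) :=
  linfun (fun v : subvs_of k => vsproj k (A (vsval v))).

End QuadraticLie.

Section Exterior.
Context {R : realType} {g : vectType R}.
Implicit Types (Q : g -> R) (br : g -> g -> g).

(* [\wedge^m g] is realized as alternating [m]-linear functions on the dual
   space, normalized so that x_1 /\ ... /\ x_m evaluates at (a_1, ..., a_m) to
   the determinant of the matrix a_j(x_i). *)
Definition dual : Type := 'Hom(g, R^o).
Definition bivector : Type := dual -> dual -> R.
Definition trivector : Type := dual -> dual -> dual -> R.

Definition wedge (x y : g) : bivector :=
  fun a b => a x * b y - a y * b x.

Definition wedge21 (w : bivector) (z : g) : trivector :=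
  fun a b c => w a b * c z + w b c * a z + w c a * b z.

Definition wedge3 (x y z : g) : trivector := wedge21 (wedge x y) z.

Definition lambda (V : {vspace g}) d (e e' : d.-tuple g)
    (A : 'End(subvs_of V)) : bivector :=
  fun a b => 2^-1 * \sum_(i < d) wedge (vsval (A (vsproj V e`_i))) e'`_i a b.

Definition dual_basis n (E : n.-tuple g) (i : 'I_n) : dual :=
  linfun (coord E i : g -> R^o).

(* [w_ab] with w = 1/2 \sum_ab w_ab E_a /\ E_b *)
Definition bicoord n (E : n.-tuple g) (w : bivector) (i j : 'I_n) : R :=
  w (dual_basis E i) (dual_basis E j).

Definition structure_constant br n (E : n.-tuple g) (k l b : 'I_n) : R :=
  coord E b (br E`_k E`_l).

(* the Schouten bracket [w, w], computed in the basis [E] *)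
Definition schouten_sq br n (E : n.-tuple g) (w : bivector) : trivector :=
  fun x y z =>
    \sum_(a < n) \sum_(b < n) \sum_(c < n) \sum_(k < n) \sum_(l < n)
      bicoord E w a k * structure_constant br E k l b * bicoord E w l c *
      wedge3 E`_a E`_b E`_c x y z.

Definition Theta br Q n (E E' : n.-tuple g) : trivector :=
  fun x y z =>
    - 6^-1 * \sum_(a < n) \sum_(b < n) \sum_(c < n)
      polar Q E'`_a (br E'`_b E'`_c) * wedge3 E`_a E`_b E`_c x y z.

End Exterior.

Arguments dual {R} g.
Arguments bivector {R} g.
Arguments trivector {R} g.

Section DynamicalRMatrix.
Context {R : realType} {g : vectType R}.
Variables (br : g -> g -> g) (Q : g -> R) (c : 'End(g)) (k p : {vspace g}).
Implicit Type mu : subvs_of k.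

Definition ad_k mu : 'End(subvs_of k) := restr k (ad br (vsval mu)).

Definition c_exp_p mu : 'End(subvs_of p) :=
  restr p (c \o fun_of cexp (ad br (vsval mu)))%VF.

Definition c_exp_sub1_invertible mu : Prop :=
  bijective (c_exp_p mu - \1)%VF.

Definition r_k d (e e' : d.-tuple g) mu : bivector g :=
  lambda e e' (fun_of f_cdybe (ad_k mu)).

Definition r_p d (u u' : d.-tuple g) mu : bivector g :=
  fun a b => 2^-1 *
    lambda u u' ((c_exp_p mu + \1) \o (c_exp_p mu - \1)^-1)%VF a b.

(* The set where both [r_k] and [r_p] are defined. *)
Definition regular_set : set (subvs_of k) :=
  [set mu | fun_of_defined f_cdybe (ad_k mu) /\ c_exp_sub1_invertible mu].

End DynamicalRMatrix.

Section Derivatives.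
Context {R : realType} {g : vectType R} {k : {vspace g}}.
Implicit Types (r : subvs_of k -> bivector g) (mu v : subvs_of k).

Definition along r mu v (a b : dual g) (t : R) : R := r (mu + t *: v) a b.

Definition dir_derivable r mu v : Prop :=
  forall a b, derivable (along r mu v a b) 0 1.

Definition dir_derive r mu v : bivector g :=
  fun a b => derive1 (along r mu v a b) 0.

(* \sum_i (\partial r / \partial mu_i) /\ e_i, where the mu_i are the
   coordinates of mu with respect to the dual basis [e'] *)
Definition wedge_differential d (e e' : d.-tuple g) r mu : trivector g :=
  fun x y z =>
    \sum_(i < d) wedge21 (dir_derive r mu (vsproj k e'`_i)) e`_i x y z.

End Derivatives.

(* Main.v *)
From HB Require Import structures.
Require Import Defs.
From mathcomp Require Import all_boot all_order all_algebra.
From mathcomp Require Import complex.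
From mathcomp Require Import all_classical all_reals all_analysis.
From mathcomp Require Import ring lra.

(** The form [B] identifies the dual of [g] with [g]. Under this
    identification [r^k] and [r^p_c] become [- f(A)] on [k] and
    [- (C + 1) (C - 1)^-1 / 2] on [p], where [A = ad mu] and [C = c exp A]
    ([lambda_polar], [rmatE]); the Schouten square becomes a cyclic sum of
    [B([r x, r y], z)] ([schouten_sqE]) and [Theta] becomes [- B([x, y], z)]
    ([ThetaE]). The equation then says that one trilinear form in [x], [y],
    [z], [cdybe_sum], vanishes. It is invariant under cyclic permutations, so
    it suffices to evaluate it on arguments taken from [k] or [p]
    ([cyclic_trilinear_eq0]), and only four cases remain. Two arguments in [k]
    and one in [p] give zero because [[k, k]] lies in [k] and [[k, p]] in [p].

    Three arguments in [p] involve no derivative. They can be written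
    [C x - x], and the statement is the modified Yang-Baxter equation of the
    Cayley transform of an isometric automorphism: it expands into multiples
    of [B([C x, C y], C z) - B([x, y], z)] ([cybe4_cayley]).

    For two arguments in [p] and one in [k], the derivative of [C] in the
    direction [z] is [C ad(phi_1(-A) z)], where [phi_m(A)] is the sum of
    [A^n / (n + m)!] ([dphi_exp]). It enters the derivative of half the Cayley
    transform as [- (C - 1)^-1 dC (C - 1)^-1], whose matrix elements between
    vectors [C x - x] contain no inverse ([cayley_derivative]); the quadratic
    terms give the opposite expression, because [C] is [exp A] on [k]
    ([cybe4_mixed]).

    For three arguments in [k], write [f = 1/2 - phi_2 / phi_1] and every
    argument as [phi_1(A) x], which removes the inverse. If moreover [x] could
    be written as [A x'], all functions of [A] would be expressed by [exp A]
    and [phi_1(A)], and the identity would follow from the invariance of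
    [B([x, y], z)] under [exp A] and under the derivation [A] ([cdybe_image]).
    But [A] is not invertible, since [A mu = 0]. However, the derivation
    identity survives scalar shifts with sum zero: [A] may be replaced by
    [A + al], [A + be], [A + ga] in the three slots as soon as
    [al + be + ga = 0]. These operators are invertible for almost all small
    shifts, and the shifts can be sent to zero ([cdybe_unshifted]).

    The analysis rests on one device: [phi_m] of the block operator
    [(X, B; 0, Y)] has an off-diagonal block [dphi m X Y B] that is both a
    divided difference and, for [X = Y], the derivative of [phi_m] at [X] in
    the direction [B]. Bounds on [phi_m] thus give continuity, continuity of
    [dphi] gives differentiability, and all identities come from operators
    that intertwine. The functional calculus is matched with [phi_m] by
    polynomial interpolation at the eigenvalues ([phi_interpolation]); [f(A)]
    exists exactly when [phi_1(A)] is injective ([fun_of_f_cdybe_defined]).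
    Injectivity is an open condition ([injective_near]), and [phi_1(A)] is
    singular only if [exp w = 1] for some nonzero eigenvalue [w] of [A], a
    coincidence that disappears when [A] is replaced by [(1 + t) A]: hence the
    regular points are dense ([phi1_injective_near], [vdense_radial]). *)

Set Implicit Arguments.
Unset Strict Implicit.
Unset Printing Implicit Defensive.

Import Order.TTheory GRing.Theory Num.Theory.
Import numFieldNormedType.Exports.
Local Open Scope classical_set_scope.
Local Open Scope ring_scope.

(** * Norms on a finite-dimensional space *)

Section CoordinateNorm.
Context {R : realType}.

Lemma scalar_sum (V : lmodType R) (f : V -> R) (I : Type) (s : seq I)
    (a : I -> R) (v : I -> V) : scalar f ->
  f (\sum_(i <- s) a i *: v i) = \sum_(i <- s) a i * f (v i).
Proof.
move=> fL; have f0 : f 0 = 0.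
  by have := fL (-1) 0 0; rewrite scaler0 addr0 mulN1r addNr.
elim: s => [|i s IH]; first by rewrite !big_nil.
by rewrite !big_cons fL IH.
Qed.

Lemma scalar_coord (V : vectType R) (f : V -> R) x : scalar f ->
  f x = \sum_i coord (vbasis {:V}) i x * f (vbasis {:V})`_i.
Proof. by move=> fL; rewrite {1}(coord_vbasis (memvf x)) scalar_sum. Qed.

Lemma lfun_coord (V W : vectType R) (A : 'Hom(V, W)) x :
  A x = \sum_i coord (vbasis {:V}) i x *: A (vbasis {:V})`_i.
Proof.
by rewrite {1}(coord_vbasis (memvf x)) linear_sum; apply: eq_bigr => i _;
   rewrite linearZ.
Qed.

Definition vnorm {V : vectType R} (x : V) : R :=
  \sum_i `|coord (vbasis {:V}) i x|.

Section Vnorm.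
Context {V : vectType R}.
Implicit Types x y : V.

Lemma vnorm_ge0 x : 0 <= vnorm x.
Proof. exact: sumr_ge0. Qed.

Lemma vnorm0 : vnorm (0 : V) = 0.
Proof. by rewrite /vnorm big1 // => i _; rewrite linear0 normr0. Qed.

Lemma vnormD x y : vnorm (x + y) <= vnorm x + vnorm y.
Proof.
rewrite -big_split; apply: ler_sum => i _ /=.
by rewrite linearD ler_normD.
Qed.

Lemma vnormZ (a : R) x : vnorm (a *: x) = `|a| * vnorm x.
Proof.
rewrite mulr_sumr; apply: eq_bigr => i _.
by rewrite linearZ normrM.
Qed.

Lemma vnormN x : vnorm (- x) = vnorm x.
Proof. by rewrite -scaleN1r vnormZ normrN1 mul1r. Qed.

Lemma vnormB x y : vnorm (x - y) <= vnorm x + vnorm y.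
Proof. by rewrite -(vnormN y) vnormD. Qed.

Lemma vnorm_sum (I : Type) (s : seq I) (v : I -> V) :
  vnorm (\sum_(i <- s) v i) <= \sum_(i <- s) vnorm (v i).
Proof.
elim: s => [|i s IH]; first by rewrite !big_nil vnorm0.
by rewrite !big_cons (le_trans (vnormD _ _)) // lerD2l.
Qed.

Lemma vnorm_eq0 x : vnorm x = 0 -> x = 0.
Proof.
move=> x0; rewrite (coord_vbasis (memvf x)) big1 // => i _.
have := psumr_eq0P (fun i _ => normr_ge0 (coord (vbasis {:V}) i x)) x0.
by move=> /(_ i isT) /normr0_eq0 ->; rewrite scale0r.
Qed.

Lemma norm_coord_vnorm (i : 'I_(\dim {:V})) x : `|coord (vbasis {:V}) i x| <= vnorm x.
Proof. by rewrite /vnorm (bigD1 i) //= lerDl sumr_ge0. Qed.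

Lemma vnorm_vbasis (i : 'I_(\dim {:V})) : vnorm (vbasis {:V})`_i <= 1.
Proof.
have fr : free (vbasis {:V}) by exact: basis_free (vbasisP _).
rewrite /vnorm (bigD1 i) //= big1 => [|j ji].
  by rewrite coord_free // eqxx normr1 addr0.
by rewrite coord_free // eq_sym (negPf ji) normr0.
Qed.

Lemma scalar_bounded (f : V -> R) : scalar f ->
  exists2 M, 0 <= M & forall x, `|f x| <= M * vnorm x.
Proof.
move=> fL; exists (\sum_(i < \dim {:V}) `|f (vbasis {:V})`_i|); first exact: sumr_ge0.
move=> x; rewrite (scalar_coord _ fL) (le_trans (ler_norm_sum _ _ _)) //.
rewrite mulr_suml; apply: ler_sum => i _; rewrite normrM mulrC.
by rewrite ler_wpM2l // norm_coord_vnorm.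
Qed.

End Vnorm.

Section Opnorm.

(** An upper bound for the operator norm, convenient because it is a finite
    sum that is submultiplicative and tends to zero with the values of [A]. *)
Definition opnorm {V W : vectType R} (A : 'Hom(V, W)) : R :=
  \sum_(i < \dim {:V}) vnorm (A (vbasis {:V})`_i).

Context {V W : vectType R}.
Implicit Types A B : 'Hom(V, W).

Lemma opnorm_ge0 A : 0 <= opnorm A.
Proof. by apply: sumr_ge0 => i _; exact: vnorm_ge0. Qed.

Lemma opnormP A x : vnorm (A x) <= opnorm A * vnorm x.
Proof.
rewrite lfun_coord (le_trans (vnorm_sum _ _)) // mulr_suml.
apply: ler_sum => i _; rewrite vnormZ mulrC ler_wpM2l ?vnorm_ge0 //.
exact: norm_coord_vnorm.
Qed.

Lemma opnormD A B : opnorm (A + B) <= opnorm A + opnorm B.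
Proof.
by rewrite -big_split; apply: ler_sum => i _ /=; rewrite add_lfunE vnormD.
Qed.

Lemma opnormZ (a : R) A : opnorm (a *: A) = `|a| * opnorm A.
Proof.
by rewrite mulr_sumr; apply: eq_bigr => i _; rewrite scale_lfunE vnormZ.
Qed.

End Opnorm.

Lemma opnorm_comp (U V W : vectType R) (A : 'Hom(V, W)) (B : 'Hom(U, V)) :
  opnorm (A \o B)%VF <= opnorm A * opnorm B.
Proof.
rewrite mulr_sumr; apply: ler_sum => i _.
by rewrite comp_lfunE opnormP.
Qed.

End CoordinateNorm.

(** * Convergence of vectors *)

Section VectorConvergence.
Context {R : realType}.

Lemma cvg_sum_fin (T : Type) (F : set_system T) {FF : Filter F} (I : Type)
    (s : seq I) (u : I -> T -> R) (l : I -> R) :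
  (forall i, u i t @[t --> F] --> l i) ->
  (\sum_(i <- s) u i t) @[t --> F] --> \sum_(i <- s) l i.
Proof.
move=> ul; elim: s => [|i s IH].
  rewrite big_nil (_ : (fun t => _) = cst 0); first exact: cvg_cst.
  by apply/funext => t; rewrite big_nil.
rewrite big_cons (_ : (fun t => _) =
  (fun t => u i t + \sum_(j <- s) u j t)); first exact: cvgD.
by apply/funext => t; rewrite big_cons.
Qed.

(** Tested on linear forms, convergence of vectors needs no topology on [V]:
    only limits of real functions occur. *)
Definition vcvg (V : vectType R) (T : Type) (F : set_system T)
    (x : T -> V) (l : V) : Prop :=
  forall f : V -> R, scalar f -> f (x t) @[t --> F] --> f l.

Section Basic.
Context {T : Type} {F : set_system T} {FF : Filter F}.
Implicit Types V W : vectType R.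

Lemma coord_scalar (V : vectType R) n (X : n.-tuple V) i :
  scalar (coord X i).
Proof. by move=> a u v; rewrite linearP. Qed.

Lemma vcvg_coord V (x : T -> V) (l : V) :
  (forall i, coord (vbasis {:V}) i (x t) @[t --> F] -->
     coord (vbasis {:V}) i l) ->
  vcvg F x l.
Proof.
move=> xl f fL; rewrite (scalar_coord l fL).
rewrite (_ : (fun t => f (x t)) = (fun t =>
  \sum_i coord (vbasis {:V}) i (x t) * f (vbasis {:V})`_i)).
  by apply: cvg_sum_fin => i; apply: cvgMr_tmp; exact: xl.
by apply/funext => t; rewrite (scalar_coord (x t) fL).
Qed.

Lemma vcvg_cst V (l : V) : vcvg F (fun _ => l) l.
Proof. by move=> f fL; exact: cvg_cst. Qed.

Lemma scalar_funD V (f : V -> R) : scalar f -> {morph f : x y / x + y}.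
Proof. by move=> fL x y; rewrite -[x]scale1r fL mul1r scale1r. Qed.

Lemma scalar_fun0 V (f : V -> R) : scalar f -> f 0 = 0.
Proof. by move=> fL; have := fL (-1) 0 0; rewrite scaler0 addr0 mulN1r addNr. Qed.

Lemma scalar_funZ V (f : V -> R) : scalar f -> forall a x, f (a *: x) = a * f x.
Proof. by move=> fL a x; rewrite -[a *: x]addr0 fL (scalar_fun0 fL) addr0. Qed.

Lemma scalar_funN V (f : V -> R) : scalar f -> {morph f : x / - x}.
Proof. by move=> fL x; rewrite -scaleN1r (scalar_funZ fL) mulN1r. Qed.

Lemma scalar_funB V (f : V -> R) : scalar f -> {morph f : x y / x - y}.
Proof. by move=> fL x y; rewrite (scalar_funD fL) (scalar_funN fL). Qed.

Lemma scalar_comp V W (f : W -> R) (A : 'Hom(V, W)) :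
  scalar f -> scalar (f \o A).
Proof. by move=> fL a u v; rewrite /= linearP fL. Qed.

Lemma vcvgD V (x y : T -> V) (l m : V) :
  vcvg F x l -> vcvg F y m -> vcvg F (fun t => x t + y t) (l + m).
Proof.
move=> xl ym f fL; rewrite (scalar_funD fL).
rewrite (_ : (fun t => _) = (fun t => f (x t) + f (y t))).
  by apply: cvgD; [exact: xl|exact: ym].
by apply/funext => t; rewrite (scalar_funD fL).
Qed.

Lemma vcvgZ V (a : T -> R) (x : T -> V) (b : R) (l : V) :
  a t @[t --> F] --> b -> vcvg F x l ->
  vcvg F (fun t => a t *: x t) (b *: l).
Proof.
move=> ab xl f fL; rewrite (scalar_funZ fL).
rewrite (_ : (fun t => _) = (fun t => a t * f (x t))).
  by apply: cvgM => //; exact: xl.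
by apply/funext => t; rewrite (scalar_funZ fL).
Qed.

Lemma vcvg_lfun V W (A : 'Hom(V, W)) (x : T -> V) (l : V) :
  vcvg F x l -> vcvg F (fun t => A (x t)) (A l).
Proof. by move=> xl f fL; exact: (xl (f \o A) (scalar_comp A fL)). Qed.

Lemma vcvgN V (x : T -> V) (l : V) :
  vcvg F x l -> vcvg F (fun t => - x t) (- l).
Proof.
move=> xl f fL; rewrite (scalar_funN fL).
rewrite (_ : (fun t => _) = (fun t => - f (x t))).
  by apply: cvgN; exact: xl.
by apply/funext => t; rewrite (scalar_funN fL).
Qed.

Lemma vcvgB V (x y : T -> V) (l m : V) :
  vcvg F x l -> vcvg F y m -> vcvg F (fun t => x t - y t) (l - m).
Proof. by move=> xl ym; apply: vcvgD => //; exact: vcvgN. Qed.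

Lemma cvg_bilinear V W (b : V -> W -> R) (x : T -> V) (y : T -> W) l m :
  (forall v, scalar (b v)) -> (forall w, scalar (b^~ w)) ->
  vcvg F x l -> vcvg F y m -> b (x t) (y t) @[t --> F] --> b l m.
Proof.
move=> br bl xl ym; rewrite (scalar_coord l (bl m)).
rewrite (_ : (fun t => _) = (fun t => \sum_i
  coord (vbasis {:V}) i (x t) * b (vbasis {:V})`_i (y t))).
  apply: cvg_sum_fin => i; apply: cvgM.
    by apply: xl; exact: coord_scalar.
  exact: ym.
by apply/funext => t; rewrite (scalar_coord (x t) (bl (y t))).
Qed.

Lemma vcvg_app V W (A : T -> 'Hom(V, W)) (L : 'Hom(V, W)) (x : T -> V) l :
  (forall v, vcvg F (fun t => A t v) (L v)) -> vcvg F x l ->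
  vcvg F (fun t => A t (x t)) (L l).
Proof.
move=> AL xl f fL; have /= -> := scalar_coord l (scalar_comp L fL).
rewrite (_ : (fun t => _) = (fun t => \sum_i
  coord (vbasis {:V}) i (x t) * f (A t (vbasis {:V})`_i))).
  apply: cvg_sum_fin => i; apply: cvgM.
    by apply: xl; exact: coord_scalar.
  exact: AL.
by apply/funext => t; have /= -> := scalar_coord (x t) (scalar_comp (A t) fL).
Qed.

Lemma vcvg_vnorm V (x : T -> V) (l : V) :
  vcvg F x l -> vnorm (x t) @[t --> F] --> vnorm l.
Proof.
move=> xl; apply: cvg_sum_fin => i; apply: cvg_norm.
by apply: xl; exact: coord_scalar.
Qed.

Lemma vcvg_squeeze V (x : T -> V) (l : V) (a : T -> R) :
  (\forall t \near F, vnorm (x t - l) <= a t) -> a t @[t --> F] --> 0 ->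
  vcvg F x l.
Proof.
move=> xa a0; apply: vcvg_coord => i.
apply/cvgrPdist_lt => e e0.
have /cvgrPdist_lt/(_ e e0) := a0.
apply: filterS2 xa => t xa; rewrite sub0r normrN => /(le_lt_trans (ler_norm _)).
apply: le_lt_trans; rewrite distrC -linearB.
exact: le_trans (norm_coord_vnorm _ _) xa.
Qed.

Lemma vcvg_ext V (x y : T -> V) (l : V) :
  (\forall t \near F, x t = y t) -> vcvg F x l -> vcvg F y l.
Proof.
move=> xy xl f fL; apply: cvg_trans (xl f fL).
by apply: near_eq_cvg; apply: filterS xy => t ->.
Qed.

End Basic.

Lemma vec_ext (V : vectType R) (x y : V) :
  (forall f : V -> R, scalar f -> f x = f y) -> x = y.
Proof.
move=> xy; rewrite (coord_vbasis (memvf x)) (coord_vbasis (memvf y)).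
by apply: eq_bigr => i _; rewrite (xy _ (coord_scalar _ i)).
Qed.

Lemma vcvg_unique (V : vectType R) (T : Type) (F : set_system T)
    {FF : ProperFilter F} (x : T -> V) (l m : V) :
  vcvg F x l -> vcvg F x m -> l = m.
Proof.
move=> xl xm; apply: vec_ext => f fL.
exact: (cvg_unique _ (xl f fL) (xm f fL)).
Qed.

End VectorConvergence.
Arguments vcvg_ext {R T F FF V x y l} _ _ [f].
Arguments vcvg_lfun {R T F V W} A {x l} _ [f].
Arguments vcvg_cst {R T F FF V} l [f].

(** * The functions [phi_m(A) = \sum_n A^n / (n + m)!] of an operator *)

Section PhiFunctions.
Context {R : realType}.

Definition phi_psum (V : vectType R) m (A : 'End(V)) (x : V) (n : nat) : V :=
  \sum_(0 <= k < n) ((k + m)`!%:R)^-1 *: iter k A x.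

Lemma iter_vnorm (V : vectType R) (A : 'End(V)) K x n :
  0 <= K -> (forall y, vnorm (A y) <= K * vnorm y) ->
  vnorm (iter n A x) <= K ^+ n * vnorm x.
Proof.
move=> K0 AK; elim: n => [|n IH]; first by rewrite expr0 mul1r.
by rewrite iterS (le_trans (AK _)) // exprS -mulrA ler_wpM2l.
Qed.

Lemma phi_coef_le m n : (((n + m)`!%:R)^-1 : R) <= (n`!%:R)^-1.
Proof.
rewrite lef_pV2 ?posrE ?ltr0n ?fact_gt0 // ler_nat.
by elim: m => [|m IH]; rewrite ?addn0 // addnS factS (leq_trans IH) // leq_pmull.
Qed.

Lemma phi_term_vnorm (V : vectType R) m (A : 'End(V)) K x n :
  0 <= K -> (forall y, vnorm (A y) <= K * vnorm y) ->
  vnorm (((n + m)`!%:R : R)^-1 *: iter n A x) <= exp_coeff K n * vnorm x.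
Proof.
move=> K0 AK; rewrite vnormZ ger0_norm ?invr_ge0 ?ler0n //.
rewrite (le_trans (ler_wpM2l _ (iter_vnorm _ _ K0 AK))) ?invr_ge0 ?ler0n //.
rewrite mulrA ler_wpM2r ?vnorm_ge0 // mulrC /exp_coeff /=.
by rewrite ler_wpM2l ?exprn_ge0 // phi_coef_le.
Qed.

Lemma is_cvg_phi_psum (V : vectType R) m (A : 'End(V)) x (f : V -> R) :
  scalar f -> cvgn (fun n => f (phi_psum m A x n)).
Proof.
move=> fL; have [M M0 fM] := scalar_bounded fL.
set u := fun k : nat => f (((k + m)`!%:R : R)^-1 *: iter k A x).
rewrite (_ : (fun n => _) = series u); last first.
  apply/funext => n; rewrite /series /= /phi_psum scalar_sum //.
  by apply: eq_bigr => k _; rewrite /u (scalar_funZ fL).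
apply: normed_cvg.
apply: (@series_le_cvg _ _ (fun k => M * vnorm x * exp_coeff (opnorm A) k)).
- move=> k; exact: normr_ge0.
- move=> k; apply: mulr_ge0; first by rewrite mulr_ge0 ?vnorm_ge0.
  by apply: exp_coeff_ge0; exact: opnorm_ge0.
- move=> k; rewrite /u (le_trans (fM _)) // -mulrA ler_wpM2l // mulrC.
  by apply: phi_term_vnorm; [exact: opnorm_ge0|exact: opnormP].
- by apply: (@is_cvg_seriesZ _ _ (M * vnorm x)); exact: is_cvg_series_exp_coeff.
Qed.

Definition phi_fun (V : vectType R) m (A : 'End(V)) (x : V) : V :=
  \sum_i limn (fun n => coord (vbasis {:V}) i (phi_psum m A x n))
    *: (vbasis {:V})`_i.

Lemma phi_fun_cvg (V : vectType R) m (A : 'End(V)) x :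
  vcvg \oo (phi_psum m A x) (phi_fun m A x).
Proof.
apply: vcvg_coord => i; rewrite /phi_fun coord_sum_free.
  by apply: is_cvg_phi_psum; exact: coord_scalar.
exact: basis_free (vbasisP _).
Qed.

Lemma iter_linear (V : vectType R) (A : 'End(V)) n : linear (fun x => iter n A x).
Proof. by elim: n => [|n IH] a u v //; rewrite !iterS IH linearP. Qed.

Lemma phi_psum_linear (V : vectType R) m (A : 'End(V)) n :
  linear (fun x => phi_psum m A x n).
Proof.
move=> a u v; rewrite /phi_psum scaler_sumr -big_split; apply: eq_bigr => k _.
by rewrite /= iter_linear scalerDr !scalerA mulrC.
Qed.

Fact phi_fun_linear (V : vectType R) m (A : 'End(V)) : linear (phi_fun m A).
Proof.
move=> a u v.
apply: (@vcvg_unique _ _ _ \oo _ (phi_psum m A (a *: u + v))).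
  exact: phi_fun_cvg.
rewrite (_ : phi_psum m A (a *: u + v) =
  (fun n => a *: phi_psum m A u n + phi_psum m A v n)).
  by apply: vcvgD; [apply: vcvgZ; [exact: cvg_cst|]|]; exact: phi_fun_cvg.
by apply/funext => n; exact: phi_psum_linear.
Qed.

HB.instance Definition _ (V : vectType R) m (A : 'End(V)) :=
  GRing.isLinear.Build R V V _ (phi_fun m A) (phi_fun_linear m A).

Fact phi_subproof (V : vectType R) m (A : 'End(V)) :
  {T : 'End(V) | forall x, vcvg \oo (phi_psum m A x) (T x)}.
Proof. by exists (linfun (phi_fun m A)) => x; rewrite lfunE; exact: phi_fun_cvg. Qed.

(** Only the limit that characterizes [phi m A] is ever used, so the operator
    is kept abstract. *)
Definition phi (V : vectType R) m (A : 'End(V)) : 'End(V) :=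
  sval (phi_subproof m A).

Section Phi.
Context {V : vectType R}.
Implicit Types (A : 'End(V)) (x : V).

Lemma phi_cvg m A x : vcvg \oo (phi_psum m A x) (phi m A x).
Proof. exact: (svalP (phi_subproof m A)). Qed.
Arguments phi_cvg m A x [f].

Lemma phi_vnorm m A K x :
  0 <= K -> (forall y, vnorm (A y) <= K * vnorm y) ->
  vnorm (phi m A x) <= expR K * vnorm x.
Proof.
move=> K0 AK.
apply: (@cvgr_to_le _ \oo _ _ (fun n => vnorm (phi_psum m A x n))).
  by apply: vcvg_vnorm; exact: phi_cvg.
apply: nearW => n; rewrite (le_trans (vnorm_sum _ _)) //.
apply: (@le_trans _ _ (series (exp_coeff K) n * vnorm x)).
  rewrite /series /= mulr_suml; apply: ler_sum => k _.
  exact: phi_term_vnorm.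
rewrite ler_wpM2r ?vnorm_ge0 //.
apply: nondecreasing_cvgn_le; last exact: is_cvg_series_exp_coeff.
by apply: nondecreasing_series => k _ _; exact: exp_coeff_ge0.
Qed.

(** Truncating the series and letting the truncation grow turns the evident
    relation between the partial sums into one between the functions. *)
Lemma phi_rec m A x : phi m A x = (m`!%:R)^-1 *: x + A (phi m.+1 A x).
Proof.
apply: (@vcvg_unique _ _ _ \oo _ (fun n => phi_psum m A x n.+1)).
  move=> f fL; have := phi_cvg m A x fL.
  by rewrite -(cvg_shiftS (fun n => f (phi_psum m A x n))).
rewrite (_ : (fun n => _) =
  (fun n => (m`!%:R)^-1 *: x + A (phi_psum m.+1 A x n))).
  by apply: vcvgD; [exact: vcvg_cst|apply: vcvg_lfun; exact: phi_cvg].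
apply/funext => n; rewrite /phi_psum big_nat_recl //=; congr (_ + _).
by rewrite linear_sum; apply: eq_bigr => k _; rewrite linearZ /= addSnnS.
Qed.

End Phi.
Arguments phi_cvg {V} m A x [f].

(** An intertwiner passes through every term of the series. Most identities
    between the functions [phi_m] below are instances, for a well-chosen
    [T]. *)
Lemma phi_intertwine (V W : vectType R) m (T : 'Hom(V, W)) (A : 'End(V))
    (B : 'End(W)) :
  (forall x, T (A x) = B (T x)) ->
  forall x, T (phi m A x) = phi m B (T x).
Proof.
move=> TA x; apply: (@vcvg_unique _ _ _ \oo _ (phi_psum m B (T x))).
  rewrite (_ : phi_psum _ _ _ = (fun n => T (phi_psum m A x n))).
    by apply: vcvg_lfun; exact: phi_cvg.
  apply/funext => n; rewrite /phi_psum linear_sum; apply: eq_bigr => k _.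
  rewrite linearZ /=; congr (_ *: _).
  by elim: k => // k IH; rewrite !iterS TA IH.
exact: phi_cvg.
Qed.

Lemma phi_adjoint (V W : vectType R) m (b : V -> W -> R) (A : 'End(V))
    (B : 'End(W)) :
  (forall v, scalar (b v)) -> (forall w, scalar (b^~ w)) ->
  (forall x y, b (A x) y = b x (B y)) ->
  forall x y, b (phi m A x) y = b x (phi m B y).
Proof.
move=> br bl AB x y.
have h1 := phi_cvg m A x (bl y); have h2 := phi_cvg m B y (br x).
apply: (cvg_unique _ h1); rewrite // (_ : (fun n => _) =
  (fun n => b x (phi_psum m B y n))) //.
apply/funext => n; rewrite /phi_psum (scalar_sum _ _ _ (br x)).
rewrite (scalar_sum _ _ _ (bl y)); apply: eq_bigr => k _.
by congr (_ * _); elim: k x {h1} y {h2} => // k IH x y; rewrite iterS AB IH -iterSr.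
Qed.

End PhiFunctions.
Arguments phi_cvg {R V} m A x [f].

(** * First-order variation of [phi_m] *)

Section Variation.
Context {R : realType}.
Implicit Types U V W : vectType R.

(** The block triangular operator [(X, B; 0, Y)]. *)
Definition block_fun V W (X : 'End(V)) (Y : 'End(W)) (B : 'Hom(W, V))
  (u : V * W) : V * W := (X u.1 + B u.2, Y u.2).

Fact block_fun_linear V W (X : 'End(V)) (Y : 'End(W)) (B : 'Hom(W, V)) :
  linear (block_fun X Y B).
Proof.
move=> a [v w] [v' w']; rewrite /block_fun /= !linearP; congr (_, _) => /=.
by rewrite scalerDr addrACA.
Qed.

HB.instance Definition _ V W (X : 'End(V)) (Y : 'End(W)) (B : 'Hom(W, V)) :=
  GRing.isLinear.Build R (V * W)%type (V * W)%type _ (block_fun X Y B)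
    (block_fun_linear X Y B).

Definition block V W (X : 'End(V)) (Y : 'End(W)) (B : 'Hom(W, V)) :
  'End((V * W)%type) := linfun (block_fun X Y B).

Lemma blockE V W (X : 'End(V)) (Y : 'End(W)) (B : 'Hom(W, V)) u :
  block X Y B u = (X u.1 + B u.2, Y u.2).
Proof. exact: lfunE. Qed.

Definition pair_fun U V W (A : 'Hom(U, V)) (B : 'Hom(U, W)) (u : U) : V * W :=
  (A u, B u).

Fact pair_fun_linear U V W (A : 'Hom(U, V)) (B : 'Hom(U, W)) :
  linear (pair_fun A B).
Proof. by move=> a u v; rewrite /pair_fun !linearP. Qed.

HB.instance Definition _ U V W (A : 'Hom(U, V)) (B : 'Hom(U, W)) :=
  GRing.isLinear.Build R U (V * W)%type _ (pair_fun A B)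
    (pair_fun_linear A B).

Definition pair_lfun U V W (A : 'Hom(U, V)) (B : 'Hom(U, W)) :
    'Hom(U, (V * W)%type) := linfun (pair_fun A B).

Lemma pair_lfunE U V W (A : 'Hom(U, V)) (B : 'Hom(U, W)) u :
  pair_lfun A B u = (A u, B u).
Proof. by rewrite lfunE. Qed.

Definition fst_lfun V W : 'Hom((V * W)%type, V) := linfun fst.
Definition snd_lfun V W : 'Hom((V * W)%type, W) := linfun snd.

Lemma fst_lfunE V W (u : V * W) : fst_lfun V W u = u.1.
Proof. by rewrite lfunE. Qed.

Lemma snd_lfunE V W (u : V * W) : snd_lfun V W u = u.2.
Proof. by rewrite lfunE. Qed.

Fact dphi_subproof V W m (X : 'End(V)) (Y : 'End(W)) (B : 'Hom(W, V)) :
  {T : 'Hom(W, V) | forall w, T w = (phi m (block X Y B) (0, w)).1}.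
Proof.
exists (fst_lfun V W \o phi m (block X Y B) \o pair_lfun 0 \1)%VF => w.
by rewrite !comp_lfunE fst_lfunE pair_lfunE zero_lfunE id_lfunE.
Qed.

(** The off-diagonal block of [phi_m] of [(X, B; 0, Y)]. For [X = Y] it is the
    derivative of [phi_m] at [X] in the direction [B]; working with a value of
    [phi] reduces its properties to those of [phi]. *)
Definition dphi V W m (X : 'End(V)) (Y : 'End(W)) (B : 'Hom(W, V)) :
    'Hom(W, V) :=
  sval (dphi_subproof m X Y B).

Lemma dphiE V W m (X : 'End(V)) (Y : 'End(W)) (B : 'Hom(W, V)) w :
  dphi m X Y B w = (phi m (block X Y B) (0, w)).1.
Proof. exact: (svalP (dphi_subproof m X Y B)). Qed.

Lemma phi_block_inl V W m (X : 'End(V)) (Y : 'End(W)) (B : 'Hom(W, V)) v :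
  phi m (block X Y B) (v, 0) = (phi m X v, 0).
Proof.
have := @phi_intertwine _ _ _ m (pair_lfun \1%VF 0) X (block X Y B).
move=> /(_ _ v); rewrite !pair_lfunE !id_lfunE !zero_lfunE => <- // x.
by rewrite blockE !pair_lfunE !id_lfunE !zero_lfunE /= !linear0 addr0.
Qed.

Lemma dphi_intertwine V W V' W' m (X : 'End(V)) (Y : 'End(W)) (B : 'Hom(W, V))
    (X' : 'End(V')) (Y' : 'End(W')) (B' : 'Hom(W', V'))
    (S : 'Hom(V, V')) (T : 'Hom(W, W')) :
  (forall x, S (X x) = X' (S x)) -> (forall x, T (Y x) = Y' (T x)) ->
  (forall x, S (B x) = B' (T x)) ->
  forall w, S (dphi m X Y B w) = dphi m X' Y' B' (T w).
Proof.
move=> SX TY SB w; rewrite !dphiE.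
pose ST := pair_lfun (S \o fst_lfun V W)%VF (T \o snd_lfun V W)%VF.
have STE u : ST u = (S u.1, T u.2).
  by rewrite /ST pair_lfunE !comp_lfunE fst_lfunE snd_lfunE.
have := @phi_intertwine _ _ _ m ST (block X Y B) (block X' Y' B').
move=> /(_ _ (0, w)); rewrite !STE /= linear0 => <- // u.
by rewrite !STE !blockE /= linearD /= SX SB TY.
Qed.

Lemma dphiZ V W m (X : 'End(V)) (Y : 'End(W)) (B : 'Hom(W, V)) a w :
  dphi m X Y (a *: B) w = a *: dphi m X Y B w.
Proof.
have := @dphi_intertwine V W V W m X Y B X Y (a *: B) (a *: \1%VF) \1%VF.
move=> /(_ _ _ _ w); rewrite scale_lfunE !id_lfunE => -> // x;
by rewrite ?scale_lfunE ?id_lfunE ?linearZ.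
Qed.

Lemma dphiD V W m (X : 'End(V)) (Y : 'End(W)) (B1 B2 : 'Hom(W, V)) w :
  dphi m X Y (B1 + B2) w = dphi m X Y B1 w + dphi m X Y B2 w.
Proof.
pose X2 := pair_lfun (X \o fst_lfun V V)%VF (X \o snd_lfun V V)%VF.
pose B := pair_lfun B1 B2; pose s := (fst_lfun V V + snd_lfun V V)%VF.
have X2E u : X2 u = (X u.1, X u.2).
  by rewrite pair_lfunE !comp_lfunE fst_lfunE snd_lfunE.
have sE u : s u = u.1 + u.2 by rewrite add_lfunE fst_lfunE snd_lfunE.
have e1 := @dphi_intertwine _ _ _ _ m X2 Y B X Y B1 (fst_lfun V V) \1%VF.
have e2 := @dphi_intertwine _ _ _ _ m X2 Y B X Y B2 (snd_lfun V V) \1%VF.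
have e3 := @dphi_intertwine _ _ _ _ m X2 Y B X Y (B1 + B2) s \1%VF.
rewrite -{1}[w](id_lfunE w) -e3; first last.
- by move=> x; rewrite sE pair_lfunE add_lfunE id_lfunE.
- by move=> x; rewrite !id_lfunE.
- by move=> x; rewrite !sE X2E linearD.
rewrite sE -fst_lfunE -snd_lfunE e1 ?e2 ?id_lfunE // => x;
by rewrite ?snd_lfunE ?fst_lfunE ?X2E ?pair_lfunE ?id_lfunE.
Qed.

(** The vectors [(- B w, w)] form an invariant subspace of the block operator,
    which acts on it as [Y]: the off-diagonal block of [phi_m] is the divided
    difference of [phi_m] between [X] and [Y]. *)
Lemma dphi_commutator V W m (X : 'End(V)) (Y : 'End(W)) (B C : 'Hom(W, V)) :
  (forall w, C w = X (B w) - B (Y w)) ->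
  forall w, dphi m X Y C w = phi m X (B w) - B (phi m Y w).
Proof.
move=> CE w; rewrite dphiE.
have := @phi_intertwine _ _ _ m (pair_lfun (- B) \1%VF) Y (block X Y C).
move=> /(_ _ w); rewrite !pair_lfunE !id_lfunE !opp_lfunE => JY.
have -> : (0, w) = (- B w, w) + (B w, 0) :> V * W.
  by congr (_, _); rewrite /= ?addNr ?addr0.
rewrite linearD /= -JY; last first.
  move=> y; rewrite !pair_lfunE !id_lfunE blockE /= !opp_lfunE CE linearN.
  by rewrite addrA addNr sub0r.
by rewrite phi_block_inl /= addrC.
Qed.

(** The case of the identity as intertwiner: an exact first-order formula,
    from which continuity follows. *)
Lemma phiB V m (X Y : 'End(V)) x :
  phi m X x - phi m Y x = dphi m X Y (X - Y) x.
Proof.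
rewrite (@dphi_commutator _ _ _ _ _ \1%VF) ?id_lfunE // => w.
by rewrite add_lfunE opp_lfunE !id_lfunE.
Qed.

(** Since [dphi] is homogeneous in [B], it may be assumed that [B] has norm at
    most 1; then the block operator is bounded in terms of [X] and [Y]
    alone. *)
Lemma dphi_bounded V W m : exists2 M, 0 <= M &
  forall (X : 'End(V)) (Y : 'End(W)) (B : 'Hom(W, V)) w,
    vnorm (dphi m X Y B w) <=
      M * expR (M * (opnorm X + opnorm Y + 1)) * opnorm B * vnorm w.
Proof.
pose i1 := pair_lfun (\1%VF : 'End(V)) (0 : 'Hom(V, W)).
pose i2 := pair_lfun (0 : 'Hom(W, V)) (\1%VF : 'End(W)).
pose p1 := fst_lfun V W; pose p2 := snd_lfun V W.
pose M := opnorm i1 * opnorm p1 + opnorm i2 * opnorm p2 +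
          opnorm i1 * opnorm p2 + opnorm p1 * opnorm i2.
have n0 := @opnorm_ge0 R.
have M0 : 0 <= M by rewrite !addr_ge0 // mulr_ge0.
have unit_case (X : 'End(V)) (Y : 'End(W)) (B : 'Hom(W, V)) w :
    opnorm B <= 1 ->
    vnorm (dphi m X Y B w) <= M * expR (M * (opnorm X + opnorm Y + 1)) * vnorm w.
  move=> B1; set K := M * (opnorm X + opnorm Y + 1).
  have K0 : 0 <= K by rewrite mulr_ge0 // !addr_ge0.
  have bK u : vnorm (block X Y B u) <= K * vnorm u.
    have -> : block X Y B = ((i1 \o (X \o p1)) + ((i1 \o (B \o p2)) +
        (i2 \o (Y \o p2))))%VF.
      apply/lfunP => -[v y]; rewrite blockE !add_lfunE !comp_lfunE /i1 /i2.
      rewrite !pair_lfunE !id_lfunE !zero_lfunE fst_lfunE snd_lfunE.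
      by congr (_, _); rewrite /= !(addr0, add0r).
    apply: le_trans (opnormP _ _) _; rewrite ler_wpM2r ?vnorm_ge0 //.
    have c3 (U1 U2 U3 U4 : vectType R) (A1 : 'Hom(U3, U4)) (A2 : 'Hom(U2, U3))
       (A3 : 'Hom(U1, U2)) k :
       opnorm A2 <= k -> opnorm (A1 \o (A2 \o A3))%VF <= opnorm A1 * opnorm A3 * k.
      move=> A2k; apply: le_trans (opnorm_comp _ _) _.
      rewrite -mulrA ler_wpM2l // (le_trans (opnorm_comp _ _)) // mulrC.
      by rewrite ler_wpM2l.
    apply: le_trans (opnormD _ _) _.
    apply: le_trans (lerD (c3 _ _ _ _ i1 X p1 _ (lexx _)) (opnormD _ _)) _.
    apply: le_trans (lerD (lexx _) (lerD (c3 _ _ _ _ i1 B p2 _ B1)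
      (c3 _ _ _ _ i2 Y p2 _ (lexx _)))) _.
    rewrite /K /M; move: (opnorm i1) (opnorm i2) (opnorm p1) (opnorm p2)
      (opnorm X) (opnorm Y) (n0 _ _ i1) (n0 _ _ i2) (n0 _ _ p1) (n0 _ _ p2)
      (n0 _ _ X) (n0 _ _ Y) => a b c d x y a0 b0 c0 d0 x0 y0.
    rewrite -subr_ge0 (_ : _ - _ = a * c * (y + 1) + b * d * (x + 1) +
      a * d * (x + y) + c * b * (x + y + 1)); last by ring.
    by rewrite !addr_ge0 ?mulr_ge0 ?addr_ge0.
  have -> : dphi m X Y B w = p1 (phi m (block X Y B) (i2 w)).
    by rewrite dphiE /p1 /i2 pair_lfunE fst_lfunE zero_lfunE id_lfunE.
  rewrite (le_trans (opnormP _ _)) //.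
  rewrite (le_trans (ler_wpM2l _ (phi_vnorm m _ K0 bK))) //.
  apply: (@le_trans _ _ (opnorm p1 * (expR K * (opnorm i2 * vnorm w)))).
    by rewrite !ler_wpM2l ?expR_ge0 ?opnormP.
  rewrite mulrCA !mulrA [expR K * _]mulrC ler_wpM2r ?vnorm_ge0 //.
  rewrite mulrAC ler_wpM2r ?expR_ge0 // /M.
  by rewrite lerDr !addr_ge0 ?mulr_ge0.
exists M => // X Y B w.
have [B0|B0] := eqVneq (opnorm B) 0.
  have -> : B = 0 *: B.
    rewrite scale0r; apply/lfunP => x; rewrite zero_lfunE; apply: vnorm_eq0.
    apply/eqP; rewrite eq_le vnorm_ge0 andbT.
    by rewrite (le_trans (opnormP _ _)) // B0 mul0r.
  by rewrite dphiZ scale0r vnorm0 opnormZ normr0 mul0r mulr0 mul0r.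
have -> : dphi m X Y B w = opnorm B *: dphi m X Y ((opnorm B)^-1 *: B) w.
  have BE : B = opnorm B *: ((opnorm B)^-1 *: B).
    by rewrite scalerA mulfV // scale1r.
  by rewrite {1}BE; exact: dphiZ.
rewrite vnormZ ger0_norm // [_ * opnorm B]mulrC -mulrA ler_wpM2l //.
by rewrite unit_case // opnormZ ger0_norm ?invr_ge0 // mulVf.
Qed.

Section Limits.
Context {T : Type} {F : set_system T} {FF : Filter F}.

Lemma opnorm_cvg V W (A : T -> 'Hom(V, W)) (L : 'Hom(V, W)) :
  (forall v, vcvg F (fun t => A t v) (L v)) ->
  opnorm (A t - L) @[t --> F] --> 0.
Proof.
move=> AL; rewrite /opnorm.
have := @cvg_sum_fin R T F FF _ (index_enum 'I_(\dim {:V}))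
  (fun i t => vnorm ((A t - L) (vbasis {:V})`_i)) (fun=> 0).
rewrite big1 //; apply => i.
have h : vcvg F (fun t => (A t - L) (vbasis {:V})`_i) 0.
  rewrite -(subrr (L (vbasis {:V})`_i)) (_ : (fun t => _) =
    (fun t => A t (vbasis {:V})`_i - L (vbasis {:V})`_i)).
    by apply: vcvgB => //; exact: vcvg_cst.
  by apply/funext => t; rewrite add_lfunE opp_lfunE.
by have := vcvg_vnorm h; rewrite vnorm0; apply.
Qed.

Lemma phi_vcvg V m (A : T -> 'End(V)) (L : 'End(V)) :
  (forall v, vcvg F (fun t => A t v) (L v)) ->
  forall x, vcvg F (fun t => phi m (A t) x) (phi m L x).
Proof.
move=> AL x; have [M M0 dM] := dphi_bounded V V m.
have A0 := opnorm_cvg AL.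
pose K := M * expR (M * ((opnorm L + 1) + opnorm L + 1)) * vnorm x.
apply: (@vcvg_squeeze _ _ _ _ _ _ _ (fun t => K * opnorm (A t - L))).
  have A1 : \forall t \near F, opnorm (A t - L) < 1.
    exact: cvgr_lt A0 1 ltr01.
  apply: filterS A1 => t At.
  rewrite phiB (le_trans (dM _ _ _ _)) // mulrAC ler_wpM2r ?opnorm_ge0 //.
  rewrite /K ler_wpM2r ?vnorm_ge0 // ler_wpM2l // ler_expR ler_wpM2l // !lerD2r.
  have := opnormD (A t - L) L; rewrite subrK => /le_trans; apply.
  by rewrite addrC lerD2l ltW.
by rewrite -(mulr0 K); apply: cvgMl_tmp.
Qed.

Lemma dphi_vcvg V W m (X : T -> 'End(V)) (Y : T -> 'End(W))
    (B : T -> 'Hom(W, V)) (X0 : 'End(V)) (Y0 : 'End(W)) (B0 : 'Hom(W, V)) :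
  (forall v, vcvg F (fun t => X t v) (X0 v)) ->
  (forall w, vcvg F (fun t => Y t w) (Y0 w)) ->
  (forall w, vcvg F (fun t => B t w) (B0 w)) ->
  forall w, vcvg F (fun t => dphi m (X t) (Y t) (B t) w) (dphi m X0 Y0 B0 w).
Proof.
move=> XX YY BB w; rewrite (dphiE m X0 Y0 B0 w).
have h : forall u, vcvg F (fun t => block (X t) (Y t) (B t) u)
    (block X0 Y0 B0 u).
  move=> [v y].
  pose i1 := pair_lfun (\1%VF : 'End(V)) (0 : 'Hom(V, W)).
  pose i2 := pair_lfun (0 : 'Hom(W, V)) (\1%VF : 'End(W)).
  have bE (X' : 'End(V)) (Y' : 'End(W)) (B' : 'Hom(W, V)) :
      block X' Y' B' (v, y) = i1 (X' v + B' y) + i2 (Y' y).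
    rewrite blockE !pair_lfunE !id_lfunE !zero_lfunE.
    by congr (_, _); rewrite /= ?addr0 ?add0r.
  rewrite bE (_ : (fun t => _) = (fun t => i1 (X t v + B t y) + i2 (Y t y))).
    apply: vcvgD; apply: vcvg_lfun => //.
    exact: vcvgD.
  by apply/funext => t; rewrite bE.
rewrite -fst_lfunE (_ : (fun t => _) = (fun t =>
  fst_lfun V W (phi m (block (X t) (Y t) (B t)) (0, w)))).
  by apply: vcvg_lfun; exact: phi_vcvg.
by apply/funext => t; rewrite fst_lfunE dphiE.
Qed.

End Limits.
Arguments phi_vcvg {T F FF V} m {A L} _ x [f].
Arguments dphi_vcvg {T F FF V W} m {X Y B X0 Y0 B0} _ _ _ w [f].

(** The difference quotient of [phi_m] is itself a value of [dphi], so that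
    differentiability amounts to continuity. *)
Lemma phi_difference_quotient V m (A B : R -> 'End(V)) (L dL : 'End(V)) :
  (\forall t \near (0 : R)^', A t = L + t *: B t) ->
  (forall v, vcvg (0 : R)^' (fun t => A t v) (L v)) ->
  (forall v, vcvg (0 : R)^' (fun t => B t v) (dL v)) ->
  forall x, vcvg (0 : R)^' (fun t => t^-1 *: (phi m (A t) x - phi m L x))
    (dphi m L L dL x).
Proof.
move=> AE AL BL x.
have Lc w : vcvg (0 : R)^' (fun=> L w) (L w) by exact: vcvg_cst.
apply: vcvg_ext (dphi_vcvg m AL Lc BL x).
have : \forall t \near (0 : R)^', t != 0 by exact: nbhs_dnbhs_neq.
apply: filterS2 AE => t AE t0.
have AL' : A t - L = t *: B t by rewrite AE addrC addKr.
have E := phiB m (A t) L x; rewrite AL' in E.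
apply: (scalerI t0); rewrite scalerA (mulfV t0) scale1r E.
exact/esym/dphiZ.
Qed.

(** The [n]-th power of the block operator [(Y, B; 0, Y)] has off-diagonal
    block [n Y^(n-1) B], and [n / n! = 1 / (n-1)!]. *)
Lemma dphi0_commuting V (Y B : 'End(V)) : (forall x, B (Y x) = Y (B x)) ->
  forall x, dphi 0 Y Y B x = B (phi 0 Y x).
Proof.
move=> BY x; rewrite dphiE -fst_lfunE.
apply: (@vcvg_unique _ _ _ \oo _
  (fun n => fst_lfun V V (phi_psum 0 (block Y Y B) (0, x) n.+1))).
  apply: vcvg_lfun => f fL; have := phi_cvg 0 (block Y Y B) (0, x) fL.
  by rewrite -(cvg_shiftS (fun n => f (phi_psum 0 (block Y Y B) (0, x) n))).
rewrite (_ : (fun n => _) = (fun n => B (phi_psum 0 Y x n))).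
  by apply: vcvg_lfun; exact: phi_cvg.
have BYn k : B (iter k Y x) = iter k Y (B x).
  by elim: k => // k IH; rewrite !iterS BY IH.
have it k : iter k.+1 (block Y Y B) (0, x) =
    (k.+1%:R *: iter k Y (B x), iter k.+1 Y x).
  elim: k => [|k IH]; first by rewrite /= blockE /= linear0 add0r scale1r.
  rewrite iterS IH blockE [X in X + _]linearZ BYn.
  congr (_, _).
  by rewrite -(natr1 k.+1) scalerDl scale1r.
apply/funext => n; rewrite /phi_psum big_nat_recl // linearD linearZ /=.
rewrite fst_lfunE /= scaler0 add0r !linear_sum; apply: eq_bigr => k _.
rewrite !linearZ /= -iterS it fst_lfunE /= BYn scalerA !addn0 factS natrM.
by rewrite invfM mulrAC mulVf ?mul1r // pnatr_eq0.
Qed.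

End Variation.

(** * Polynomials in an operator *)

Section OperatorPolynomials.
Context {R : realType}.
Implicit Types (V W : vectType R) (p q : {poly R}).

Lemma lfun_horner_wide V p (A : 'End(V)) n x : (size p <= n)%N ->
  lfun_horner p A x = \sum_(i < n) p`_i *: iter i A x.
Proof.
move=> pn; rewrite /lfun_horner sum_lfunE.
rewrite (big_ord_widen n (fun i => (p`_i *: iter i (fun T => A \o T)%VF \1%VF) x)) //.
rewrite [RHS](bigID (fun i : 'I_n => (i < size p)%N)) /=.
rewrite [X in _ + X]big1 ?addr0 => [|i]; last first.
  by rewrite -leqNgt => ip; rewrite nth_default // scale0r.
apply: eq_bigr => i _; rewrite scale_lfunE; congr (_ *: _).
by elim: (i : nat) => [|j IH]; rewrite ?id_lfunE // !iterS comp_lfunE IH.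
Qed.

Lemma lfun_hornerD V p q (A : 'End(V)) x :
  lfun_horner (p + q) A x = lfun_horner p A x + lfun_horner q A x.
Proof.
pose n := maxn (size p) (size q).
rewrite !(@lfun_horner_wide _ _ _ n) ?leq_maxl ?leq_maxr ?size_polyD //.
by rewrite -big_split; apply: eq_bigr => i _; rewrite coefD scalerDl.
Qed.

Lemma lfun_hornerZ V a p (A : 'End(V)) x :
  lfun_horner (a *: p) A x = a *: lfun_horner p A x.
Proof.
rewrite !(@lfun_horner_wide _ _ _ (size p)) ?size_scale_leq // scaler_sumr.
by apply: eq_bigr => i _; rewrite coefZ scalerA.
Qed.

Lemma lfun_hornerMX V p (A : 'End(V)) x :
  lfun_horner (p * 'X) A x = A (lfun_horner p A x).
Proof.
rewrite (@lfun_horner_wide _ _ _ (size p).+1); last first.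
  by rewrite (leq_trans (size_polyMleq _ _)) // size_polyX addn2.
rewrite (@lfun_horner_wide _ _ _ (size p)) // big_ord_recl coefMX scale0r add0r.
rewrite linear_sum; apply: eq_bigr => i _; rewrite linearZ /=.
by rewrite coefMX /= -iterS.
Qed.

Lemma lfun_hornerC V a (A : 'End(V)) x : lfun_horner a%:P A x = a *: x.
Proof. by rewrite (@lfun_horner_wide _ _ _ 1) ?size_polyC_leq1 // big_ord1 coefC. Qed.

Lemma lfun_hornerM V p q (A : 'End(V)) x :
  lfun_horner (p * q) A x = lfun_horner p A (lfun_horner q A x).
Proof.
elim/poly_ind: p => [|p a IH].
  by rewrite mul0r -polyC0 !lfun_hornerC !scale0r.
rewrite mulrDl -mulrA ['X * _]mulrC mulrA !lfun_hornerD !lfun_hornerMX IH.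
by rewrite mul_polyC lfun_hornerZ lfun_hornerC.
Qed.

Lemma lfun_hornerB V p q (A : 'End(V)) x :
  lfun_horner (p - q) A x = lfun_horner p A x - lfun_horner q A x.
Proof. by rewrite -scaleN1r lfun_hornerD lfun_hornerZ scaleN1r. Qed.

Lemma lfun_horner_eigen V (A : 'End(V)) p (a : R) x :
  A x = a *: x -> lfun_horner p A x = p.[a] *: x.
Proof.
move=> Ax; rewrite (@lfun_horner_wide _ _ _ (size p)) // horner_coef scaler_suml.
apply: eq_bigr => i _; rewrite -scalerA; congr (_ *: _).
elim: (i : nat) => [|k IH]; first by rewrite scale1r.
by rewrite iterS IH linearZ /= Ax scalerA -exprSr.
Qed.

(** More powers of [A] than the dimension of the space of operators are
    linearly dependent. *)
Lemma annihilator_exists V (A : 'End(V)) :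
  exists q, q != 0 /\ lfun_horner q A = 0.
Proof.
pose n := \dim {:'End(V)}.
pose X := [tuple iter i (fun T => A \o T)%VF \1%VF | i < n.+1].
have : ~~ free X.
  apply/negP => fr; have := dimvS (subvf <<X>>%VS).
  by rewrite (eqP fr) size_tuple ltnn.
move=> /negP nfr.
have [k [kX [i ki]]] : exists k : 'I_n.+1 -> R,
    \sum_(i < n.+1) k i *: X`_i = 0 /\ exists i, k i != 0.
  apply: contrapT => H; apply: nfr; apply/freeP => k kX i; apply/eqP; apply: contrapT => ki.
  by apply: H; exists k; split => //; exists i; apply/negP.
exists (\poly_(i < n.+1) k (inord i)); split.
  apply/eqP => /polyP/(_ i); rewrite coef_poly ltn_ord inord_val coef0.
  by move/eqP; apply/negP.
apply/lfunP => x; rewrite (@lfun_horner_wide _ _ _ n.+1) ?size_poly //.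
rewrite -kX sum_lfunE; apply: eq_bigr => j _.
rewrite coef_poly ltn_ord inord_val scale_lfunE; congr (_ *: _).
rewrite -tnth_nth tnth_mktuple.
by elim: (j : nat) => [|m IH]; rewrite ?id_lfunE // !iterS comp_lfunE IH.
Qed.

Lemma poly_neq0_near0 p : p != 0 -> \forall t \near (0 : R)^', p.[t] != 0.
Proof.
move=> p0; have [m [r r0 ->]] := multiplicity_XsubC p 0.
have r00 : r.[0] != 0 by move: r0; rewrite p0.
have rc : r.[t] @[t --> (0 : R)^'] --> r.[0].
  by apply: cvg_within_filter; exact: continuous_horner.
have rn : \forall t \near (0 : R)^', r.[t] != 0.
  exact: cvgr_neq0 rc r00.
have tn : \forall t \near (0 : R)^', t != 0 by exact: nbhs_dnbhs_neq.
apply: filterS2 rn tn => t rt t0.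
by rewrite hornerM horner_exp hornerXsubC subr0 mulf_neq0 // expf_neq0.
Qed.

(** All but finitely many scalar shifts of an operator are injective.
    Identities whose natural proof divides by an operator are reached in this
    way: they hold for almost all shifts and survive in the limit. *)
Lemma shift_injective V (A : 'End(V)) (a : R) : a != 0 ->
  \forall t \near (0 : R)^', forall x, A x + (a * t) *: x = 0 -> x = 0.
Proof.
move=> a0; have [q [q0 qA]] := annihilator_exists A.
have q'0 : q \Po ((- a) *: 'X) != 0.
  rewrite -size_poly_eq0 size_comp_poly2 ?size_poly_eq0 //.
  by rewrite size_scale ?oppr_eq0 // size_polyX.
apply: filterS (poly_neq0_near0 q'0) => t qt x Ax.
have : lfun_horner q A x = 0 by rewrite qA zero_lfunE.
rewrite (@lfun_horner_eigen _ _ _ (- a * t)); last first.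
  by apply/eqP; rewrite -subr_eq0 mulNr scaleNr opprK Ax.
rewrite horner_comp hornerZ hornerX in qt.
by move/eqP; rewrite scaler_eq0 (negPf qt) /= => /eqP.
Qed.

End OperatorPolynomials.

(** * The exponential [phi_0] as a flow *)

Section Flow.
Context {R : realType}.
Implicit Types U V W : vectType R.

Definition vderive V (u : R -> V) (t : R) (d : V) : Prop :=
  vcvg (0 : R)^' (fun h => h^-1 *: (u (h + t) - u t)) d.

Lemma cvg_id0 : (fun h : R => h) @ (0 : R)^' --> (0 : R).
Proof. by apply: cvg_within_filter; exact: cvg_id. Qed.

Lemma vderive_cvg V (u : R -> V) t d : vderive u t d ->
  vcvg (0 : R)^' (fun h => u (h + t)) (u t).
Proof.
move=> ud.
have -> : u t = u t + 0 *: d by rewrite scale0r addr0.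
apply: vcvg_ext (vcvgD (vcvg_cst (u t)) (vcvgZ cvg_id0 ud)).
have : \forall t \near (0 : R)^', t != 0 by exact: nbhs_dnbhs_neq.
by apply: filterS => h h0; rewrite scalerA mulfV // scale1r addrC subrK.
Qed.

Lemma vderive_is_derive V (u : R -> V) t d (f : V -> R) : scalar f ->
  vderive u t d -> is_derive t (1 : R) (fun s => f (u s)) (f d).
Proof.
move=> fL ud; have := ud f fL => fd.
have fd' : h^-1 *: (((fun s => f (u s)) \o shift t) (h *: (1 : R)) - f (u t))
   @[h --> (0 : R)^'] --> f d.
  rewrite (_ : (fun h => _) = (fun h => f (h^-1 *: (u (h + t) - u t)))) //.
  apply/funext => h; rewrite (scalar_funZ fL) (scalar_funB fL) /=.
  by rewrite /GRing.scale /= mulr1.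
apply: DeriveDef; first by apply/cvg_ex; exists (f d).
exact: cvg_lim fd'.
Qed.

Lemma vderive_app V W (A : R -> 'Hom(V, W)) (u : R -> V) t (A' : 'Hom(V, W)) d :
  (forall x, vderive (fun s => A s x) t (A' x)) -> vderive u t d ->
  vderive (fun s => A s (u s)) t (A t d + A' (u t)).
Proof.
move=> AA' ud.
have Ac x : vcvg (0 : R)^' (fun h => A (h + t) x) (A t x).
  exact: vderive_cvg (AA' x).
have c1 : vcvg (0 : R)^'
    (fun h => A (h + t) (h^-1 *: (u (h + t) - u t))) (A t d).
  by apply: vcvg_app => //; exact: Ac.
apply: vcvg_ext (vcvgD c1 (AA' (u t))).
apply: nearW => h; rewrite /= linearZ /= linearB /= -scalerDr; congr (_ *: _).
by rewrite addrA subrK.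
Qed.

Lemma vderive_bilinear U V (m : U -> V -> R) (x : R -> U) (y : R -> V) t dx dy :
  (forall u, scalar (m u)) -> (forall v, scalar (m^~ v)) ->
  vderive x t dx -> vderive y t dy ->
  h^-1 * (m (x (h + t)) (y (h + t)) - m (x t) (y t)) @[h --> (0 : R)^'] -->
    m dx (y t) + m (x t) dy.
Proof.
move=> mr ml xd yd.
rewrite (_ : (fun h => _) = (fun h =>
   m (h^-1 *: (x (h + t) - x t)) (y (h + t)) +
   m (x t) (h^-1 *: (y (h + t) - y t)))).
  apply: cvgD.
    by apply: cvg_bilinear => //; exact: vderive_cvg yd.
  by apply: yd; exact: mr.
apply/funext => h; rewrite (scalar_funZ (ml _)) (scalar_funB (ml _)).
by rewrite (scalar_funZ (mr _)) (scalar_funB (mr _)) -mulrDr addrA subrK.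
Qed.

Lemma phi_commute V m (A B : 'End(V)) : (forall x, B (A x) = A (B x)) ->
  forall x, B (phi m A x) = phi m A (B x).
Proof. by move=> BA; apply: phi_intertwine. Qed.

Lemma phi0_flow V (A : 'End(V)) (a b : R) x t :
  vderive (fun s => phi 0 ((a * s + b) *: A) x) t
    (a *: A (phi 0 ((a * t + b) *: A) x)).
Proof.
pose L := (a * t + b) *: A.
have AL y : (a *: A) (L y) = L ((a *: A) y).
  by rewrite /L !scale_lfunE !linearZ /= !linearZ /= !scalerA mulrC.
have /(_ x) <- : forall y, dphi 0 L L (a *: A) y = a *: A (phi 0 L y).
  by move=> y; rewrite dphi0_commuting // scale_lfunE.
apply: (@phi_difference_quotient _ _ _ (fun h => (a * (h + t) + b) *: A)
  (fun=> a *: A)).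
- apply: nearW => h; rewrite /L scalerA -scalerDl; congr (_ *: _).
  by ring.
- move=> v; rewrite /L scale_lfunE.
  rewrite (_ : (fun h => _) = (fun h => (a * h) *: A v + (a * t + b) *: A v)).
    rewrite -[X in vcvg _ _ X]add0r; apply: vcvgD; last exact: vcvg_cst.
    have a0 : a * h @[h --> (0 : R)^'] --> a * 0.
      by apply: cvgMl_tmp; exact: cvg_id0.
    rewrite mulr0 in a0.
    by have := vcvgZ a0 (vcvg_cst (A v)); rewrite scale0r; apply.
  by apply/funext => h; rewrite scale_lfunE -scalerDl mulrDr addrA.
- by move=> v; exact: vcvg_cst.
Qed.

Lemma phi_zero V m (x : V) : phi m (0 : 'End(V)) x = (m`!%:R)^-1 *: x.
Proof. by rewrite phi_rec zero_lfunE addr0. Qed.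

Lemma phi0_zero V (x : V) : phi 0 (0 : 'End(V)) x = x.
Proof. by rewrite phi_zero fact0 invr1 scale1r. Qed.

(** The curve [s |-> exp ((1 - s) A) (u s)] has zero derivative. *)
Lemma flow_unique V (A : 'End(V)) (u : R -> V) :
  (forall t, vderive u t (A (u t))) -> u 1 = phi 0 A (u 0).
Proof.
move=> uA; pose w s := phi 0 ((-1 * s + 1) *: A) (u s).
suff : w 1 = w 0.
  by rewrite /w mulr1 addNr scale0r phi0_zero mulr0 add0r scale1r.
have wd t : vderive w t 0.
  pose P s := phi 0 ((-1 * s + 1) *: A).
  have := @vderive_app _ _ P u t (- (A \o P t)%VF) (A (u t)).
  rewrite opp_lfunE comp_lfunE /P -phi_commute ?subrr; last first.
    by move=> x; rewrite !scale_lfunE linearZ.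
  apply=> // x; rewrite opp_lfunE comp_lfunE -[X in vderive _ _ X]scaleN1r.
  exact: phi0_flow.
apply: vec_ext => f fL.
apply: (@is_derive_0_is_cst _ (fun s => f (w s))) => t.
by rewrite -(scalar_fun0 fL); exact: vderive_is_derive.
Qed.

(** Along [s X], [s Y], the right-hand side solves the flow equation of [Z],
    with initial value [m x y]. *)
Lemma phi0_derivation U V W (m : U -> V -> W) (X : 'End(U)) (Y : 'End(V))
    (Z : 'End(W)) :
  (forall u, linear (m u)) -> (forall v, linear (m^~ v)) ->
  (forall x y, Z (m x y) = m (X x) y + m x (Y y)) ->
  forall x y, phi 0 Z (m x y) = m (phi 0 X x) (phi 0 Y y).
Proof.
move=> mr ml Zm x y.
pose u s := m (phi 0 ((1 * s + 0) *: X) x) (phi 0 ((1 * s + 0) *: Y) y).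
have ud t : vderive u t (Z (u t)).
  have -> : Z (u t) = m (1 *: X (phi 0 ((1 * t + 0) *: X) x))
        (phi 0 ((1 * t + 0) *: Y) y)
      + m (phi 0 ((1 * t + 0) *: X) x) (1 *: Y (phi 0 ((1 * t + 0) *: Y) y)).
    by rewrite /u Zm !scale1r.
  move=> f fL; have scalar_r v : scalar (fun w => f (m v w)).
    by move=> a b c; rewrite mr fL.
  have scalar_l w : scalar (fun v => f (m v w)).
    by move=> a b c; rewrite ml fL.
  rewrite (scalar_funD fL) (_ : (fun h => _) =
    (fun h => h^-1 * (f (u (h + t)) - f (u t)))); last first.
    by apply/funext => h; rewrite (scalar_funZ fL) (scalar_funB fL).
  exact: (@vderive_bilinear _ _ (fun v w => f (m v w)) _ _ t _ _ scalar_r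
    scalar_l (@phi0_flow _ X 1 0 x t) (@phi0_flow _ Y 1 0 y t)).
have := flow_unique ud; rewrite /u mulr1 mulr0 !addr0 !scale1r !scale0r.
by rewrite !phi0_zero.
Qed.

(** The curve [s |-> exp (s A) (exp (s B) x)] solves the flow equation of
    [A + B]. *)
Lemma phi0_add V (A B C : 'End(V)) : (forall x, B (A x) = A (B x)) ->
  (forall x, C x = A x + B x) ->
  forall x, phi 0 C x = phi 0 A (phi 0 B x).
Proof.
move=> BA CE x; pose u s := phi 0 ((1 * s + 0) *: A) (phi 0 ((1 * s + 0) *: B) x).
have ud t : vderive u t (C (u t)).
  pose P s := phi 0 ((1 * s + 0) *: A).
  have := @vderive_app _ _ P (fun s => phi 0 ((1 * s + 0) *: B) x) t
    (A \o P t)%VF (B (phi 0 ((1 * t + 0) *: B) x)).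
  have comm y : P t (B y) = B (P t y).
    by rewrite /P [RHS]phi_commute // => z; rewrite !scale_lfunE linearZ /= BA.
  rewrite comp_lfunE comm CE [A _ + B _]addrC; apply => [y|].
    by rewrite comp_lfunE -[A _]scale1r; exact: phi0_flow.
  by rewrite -[B _]scale1r; exact: phi0_flow.
have := flow_unique ud; rewrite /u mulr1 mulr0 !addr0 !scale1r !scale0r.
by rewrite !phi0_zero.
Qed.

Lemma phi0N V (A : 'End(V)) x : phi 0 A (phi 0 (- A) x) = x.
Proof.
rewrite -(@phi0_add _ A (- A) 0) ?phi0_zero // => y.
  by rewrite !opp_lfunE linearN.
by rewrite zero_lfunE opp_lfunE subrr.
Qed.

Lemma phi0NK V (A : 'End(V)) x : phi 0 (- A) (phi 0 A x) = x.
Proof. by rewrite -{2}[A]opprK phi0N. Qed.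

End Flow.

(** * Scalar shifts of an operator *)

Section Shifts.
Context {R : realType}.
Implicit Types U V W : vectType R.

Lemma linfunE V W (f : V -> W) : linear f -> forall x, linfun f x = f x.
Proof.
move=> fL x; pose f' : {linear V -> W} :=
  HB.pack f (GRing.isLinear.Build R V W _ f fL).
exact: (lfunE f' x).
Qed.

Lemma vcvg_bilinear U V W (m : U -> V -> W) (x : R -> U) (y : R -> V) l l' :
  (forall u, linear (m u)) -> (forall v, linear (m^~ v)) ->
  vcvg (0 : R)^' x l -> vcvg (0 : R)^' y l' ->
  vcvg (0 : R)^' (fun t => m (x t) (y t)) (m l l').
Proof.
move=> mr ml xl yl f fL.
apply: (@cvg_bilinear _ _ _ _ _ _ (fun u v => f (m u v))) => // u a v w.
  by rewrite mr fL.
by rewrite ml fL.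
Qed.

Lemma lfun_morphB V W (A : 'Hom(V, W)) : {morph A : x y / x - y}.
Proof. exact: linearB. Qed.

Lemma lfun_morphD V W (A : 'Hom(V, W)) : {morph A : x y / x + y}.
Proof. exact: linearD. Qed.

Lemma lfun_morphZ V W (A : 'Hom(V, W)) a : {morph A : x / a *: x}.
Proof. exact: linearZ. Qed.

Definition shift_lfun V (A : 'End(V)) (a : R) : 'End(V) := A + a *: \1%VF.

Lemma shiftE V (A : 'End(V)) a x : shift_lfun A a x = A x + a *: x.
Proof. by rewrite add_lfunE scale_lfunE id_lfunE. Qed.

Lemma shift0 V (A : 'End(V)) : shift_lfun A 0 = A.
Proof. by apply/lfunP => x; rewrite shiftE scale0r addr0. Qed.

Lemma vcvg_shift V (A : 'End(V)) (a : R) x :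
  vcvg (0 : R)^' (fun t => shift_lfun A (a * t) x) (A x).
Proof.
rewrite (_ : (fun t => _) = (fun t => A x + (a * t) *: x)); last first.
  by apply/funext => t; rewrite shiftE.
have a0 : a * t @[t --> (0 : R)^'] --> a * 0.
  by apply: cvgMl_tmp; exact: cvg_id0.
rewrite mulr0 in a0; have := vcvgD (vcvg_cst (A x)) (vcvgZ a0 (vcvg_cst x)).
by rewrite scale0r addr0; apply.
Qed.

Lemma vcvg_phi_shift V m (A : 'End(V)) a x :
  vcvg (0 : R)^' (fun t => phi m (shift_lfun A (a * t)) x) (phi m A x).
Proof. by apply: phi_vcvg => v; exact: vcvg_shift. Qed.

Lemma vcvg_phi_shiftN V m (A : 'End(V)) a x :
  vcvg (0 : R)^' (fun t => phi m (- shift_lfun A (a * t)) x) (phi m (- A) x).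
Proof.
apply: phi_vcvg => v; rewrite opp_lfunE (_ : (fun t => _) =
  (fun t => - shift_lfun A (a * t) v)).
  by apply: vcvgN; exact: vcvg_shift.
by apply/funext => t; rewrite opp_lfunE.
Qed.

Lemma shift_near_injective V (A : 'End(V)) a : a != 0 ->
  \forall t \near (0 : R)^', injective (shift_lfun A (a * t)).
Proof.
move=> a0; apply: filterS (shift_injective A a0) => t tA x y /eqP.
rewrite -subr_eq0 -linearB /= shiftE => /eqP/tA/eqP.
by rewrite subr_eq0 => /eqP.
Qed.

Lemma lfun_inj_surj V (A : 'End(V)) : injective A -> forall y, exists x, y = A x.
Proof.
by move=> /lker0P A0 y; exists (A^-1%VF y); rewrite lker0_lfunVK.
Qed.

Lemma cvg_near_cst0 (f : R -> R) (l : R) : f t @[t --> (0 : R)^'] --> l ->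
  (\forall t \near (0 : R)^', f t = 0) -> l = 0.
Proof.
move=> fl f0; apply: (cvg_unique _ fl) => //.
apply: (@cvg_trans _ ((fun _ : R => (0 : R)) @ (0 : R)^')).
  by apply: near_eq_cvg; apply: filterS f0 => t ->.
exact: cvg_cst.
Qed.

Lemma phi0E V (A : 'End(V)) x : phi 0 A x = x + A (phi 1 A x).
Proof. by rewrite phi_rec fact0 invr1 scale1r. Qed.

Lemma phi1E V (A : 'End(V)) x : phi 1 A x = x + A (phi 2 A x).
Proof. by rewrite phi_rec (_ : 1`! = 1%N) // invr1 scale1r. Qed.

Lemma phi_self V m (A : 'End(V)) x : phi m A (A x) = A (phi m A x).
Proof. by rewrite -phi_commute. Qed.

Lemma phiNX V m (A : 'End(V)) x : phi m (- A) (A x) = A (phi m (- A) x).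
Proof. by apply/esym/phi_commute => y; rewrite !opp_lfunE linearN. Qed.

(** This says that [1/2 - phi_2 / phi_1] is an odd function. After
    multiplication by [A^2], both sides are expressions in [exp A] and
    [exp (- A)]. *)
Lemma phi_odd_inj V (A : 'End(V)) : injective A ->
  forall x, phi 1 (- A) (phi 1 A x - phi 2 A x) = phi 2 (- A) (phi 1 A x).
Proof.
move=> Ainj x; apply: (Ainj); apply: (Ainj).
have E1 u : A (phi 1 (- A) u) = u - phi 0 (- A) u.
  by rewrite phi0E opp_lfunE opprD opprK addrA subrr add0r.
have E2 u : A (phi 2 (- A) u) = u - phi 1 (- A) u.
  by rewrite (phi1E (- A)) opp_lfunE opprD opprK addrA subrr add0r.
have AN m u : A (phi m (- A) u) = phi m (- A) (A u) by rewrite phiNX.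
have e1 : A (phi 1 A x) = phi 0 A x - x by rewrite phi0E addrAC subrr add0r.
have e2 : A (phi 2 A x) = phi 1 A x - x by rewrite phi1E addrAC subrr add0r.
have e3 : A (phi 1 A x - phi 2 A x) = phi 0 A x - x - (phi 1 A x - x).
  by rewrite linearB /= e1 e2.
rewrite E1 E2 [LHS]lfun_morphB [RHS]lfun_morphB AN e3 E1 e1.
rewrite !lfun_morphB phi0NK.
apply: vec_ext => f fL.
rewrite !(scalar_funB fL, scalar_funD fL, scalar_funN fL, scalar_funZ fL).
ring.
Qed.

Lemma phi_odd V (A : 'End(V)) x :
  phi 1 (- A) (phi 1 A x - phi 2 A x) = phi 2 (- A) (phi 1 A x).
Proof.
apply/eqP; rewrite -subr_eq0; apply/eqP; apply: vec_ext => f fL.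
rewrite (scalar_fun0 fL).
pose B t := shift_lfun A (1 * t).
apply: (@cvg_near_cst0 (fun t => f (phi 1 (- B t) (phi 1 (B t) x - phi 2 (B t) x)
  - phi 2 (- B t) (phi 1 (B t) x)))).
  suff h : vcvg (0 : R)^' (fun t => phi 1 (- B t) (phi 1 (B t) x - phi 2 (B t) x)
      - phi 2 (- B t) (phi 1 (B t) x))
      (phi 1 (- A) (phi 1 A x - phi 2 A x) - phi 2 (- A) (phi 1 A x)).
    exact: h.
  apply: vcvgB.
    apply: (@vcvg_app _ _ _ _ _ _ (fun t => phi 1 (- B t))).
      by move=> v; exact: vcvg_phi_shiftN.
    by apply: vcvgB; exact: vcvg_phi_shift.
  apply: (@vcvg_app _ _ _ _ _ _ (fun t => phi 2 (- B t))).
    by move=> v; exact: vcvg_phi_shiftN.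
  exact: vcvg_phi_shift.
apply: filterS (shift_near_injective A (oner_neq0 R)) => t tA.
by rewrite phi_odd_inj // subrr (scalar_fun0 fL).
Qed.

(** After multiplication by [A] both sides become [x - exp (- A) x]. *)
Lemma phi1N_inj V (A : 'End(V)) : injective A ->
  forall x, phi 1 (- A) x = phi 0 (- A) (phi 1 A x).
Proof.
move=> Ai x; apply: (Ai); rewrite -[RHS]phiNX.
have -> : A (phi 1 A x) = phi 0 A x - x by rewrite phi0E addrAC subrr add0r.
rewrite lfun_morphB phi0NK (phi0E (- A)) opp_lfunE opprD opprK addrA subrr.
by rewrite add0r.
Qed.

Lemma phi1N V (A : 'End(V)) x : phi 1 (- A) x = phi 0 (- A) (phi 1 A x).
Proof.
apply/eqP; rewrite -subr_eq0; apply/eqP; apply: vec_ext => f fL.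
rewrite (scalar_fun0 fL).
pose B t := shift_lfun A (1 * t).
apply: (@cvg_near_cst0 (fun t => f (phi 1 (- B t) x -
  phi 0 (- B t) (phi 1 (B t) x)))).
  suff h : vcvg (0 : R)^' (fun t => phi 1 (- B t) x -
      phi 0 (- B t) (phi 1 (B t) x))
      (phi 1 (- A) x - phi 0 (- A) (phi 1 A x)) by exact: h.
  apply: vcvgB; first exact: vcvg_phi_shiftN.
  apply: (@vcvg_app _ _ _ _ _ _ (fun t => phi 0 (- B t))).
    by move=> v; exact: vcvg_phi_shiftN.
  exact: vcvg_phi_shift.
apply: filterS (shift_near_injective A (oner_neq0 R)) => t tA.
by rewrite phi1N_inj // subrr (scalar_fun0 fL).
Qed.

End Shifts.

(** * Invariant trilinear form and derivations *)

Section QuadraticIdentities.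
Context {R : realType} {V : vectType R}.
Variables (br : V -> V -> V) (b : V -> V -> R) (A : 'End(V)).
Hypothesis brr : forall x, linear (br x).
Hypothesis brl : forall y, linear (br^~ y).
Hypothesis br_alt : forall x, br x x = 0.
Hypothesis b_scalarr : forall x, scalar (b x).
Hypothesis b_scalarl : forall y, scalar (b^~ y).
Hypothesis b_sym : forall x y, b x y = b y x.
Hypothesis b_inv : forall m x y, b (br m x) y = - b x (br m y).
Hypothesis A_der : forall x y, A (br x y) = br (A x) y + br x (A y).
Hypothesis A_skew : forall x y, b (A x) y = - b x (A y).

Local Notation sh := (shift_lfun A).

Lemma brD x y z : br x (y + z) = br x y + br x z.
Proof. by rewrite -[y]scale1r brr !scale1r. Qed.

Lemma brDl x y z : br (x + y) z = br x z + br y z.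
Proof. by rewrite -[x]scale1r brl !scale1r. Qed.

Lemma brZ a x y : br x (a *: y) = a *: br x y.
Proof.
have br0 : br x 0 = 0.
  by have := brr x (-1) 0 0; rewrite scaler0 addr0 scaleN1r addNr.
by rewrite -[a *: y]addr0 brr br0 addr0.
Qed.

Lemma brZl a x y : br (a *: x) y = a *: br x y.
Proof.
have br0 : br 0 y = 0.
  by have := brl y (-1) 0 0; rewrite scaler0 addr0 scaleN1r addNr.
by rewrite -[a *: x]addr0 brl br0 addr0.
Qed.

Lemma brN x y : br x (- y) = - br x y.
Proof. by rewrite -scaleN1r brZ scaleN1r. Qed.

Lemma brNl x y : br (- x) y = - br x y.
Proof. by rewrite -scaleN1r brZl scaleN1r. Qed.

Lemma br_anti x y : br x y = - br y x.
Proof.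
apply/eqP; rewrite -subr_eq0 opprK; apply/eqP.
have := br_alt (x + y); rewrite brD !brDl !br_alt add0r addr0.
by rewrite addrC.
Qed.

Lemma adE m x : ad br m x = br m x.
Proof. exact: linfunE. Qed.

Definition tau x y z := b (br x y) z.

Lemma tau_cyc x y z : tau x y z = tau y z x.
Proof. by rewrite /tau br_anti (scalar_funN (b_scalarl _)) b_inv opprK b_sym. Qed.

Lemma tau_scalar1 y z : scalar (fun x => tau x y z).
Proof. by move=> a u v; rewrite /tau brl b_scalarl. Qed.

Lemma tau_scalar2 x z : scalar (fun y => tau x y z).
Proof. by move=> a u v; rewrite /tau brr b_scalarl. Qed.

Lemma tau_scalar3 x y : scalar (tau x y).
Proof. exact: b_scalarr. Qed.

(** The derivation [A] annihilates the invariant form [tau], and the scalars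
    add up to zero. *)
Lemma tau_shift al be ga x y z : al + be + ga = 0 ->
  tau (sh al x) y z + tau x (sh be y) z + tau x y (sh ga z) = 0.
Proof.
move=> abg; rewrite /tau !shiftE brDl brD brZl brZ.
rewrite !(scalar_funD (b_scalarl _), scalar_funD (b_scalarr _)).
rewrite !(scalar_funZ (b_scalarl _), scalar_funZ (b_scalarr _)).
have := A_skew (br x y) z; rewrite A_der (scalar_funD (b_scalarl _)) => e.
have -> : ga = - al - be by rewrite -[ga]addr0 -{1}oppr0 -abg; ring.
move: e; move: (b _ z) (b _ z) (b _ z) => p q r; move: (b _ (A z)) => s; lra.
Qed.

Lemma phi0_br al be x y :
  phi 0 (sh (al + be)) (br x y) = br (phi 0 (sh al) x) (phi 0 (sh be) y).
Proof.
apply: phi0_derivation => // u v; rewrite !shiftE A_der brDl brD brZl brZ.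
by rewrite scalerDl addrACA.
Qed.

Lemma shift_adj al x y : b (sh al x) y = b x ((- sh (- al)) y).
Proof.
rewrite opp_lfunE !shiftE (scalar_funD (b_scalarl _)) (scalar_funN (b_scalarr _)).
rewrite (scalar_funD (b_scalarr _)) (scalar_funZ (b_scalarl _)).
by rewrite (scalar_funZ (b_scalarr _)) A_skew; ring.
Qed.

Lemma phi_adj m al x y : b (phi m (sh al) x) y = b x (phi m (- sh (- al)) y).
Proof. by apply: phi_adjoint => // u v; exact: shift_adj. Qed.

Lemma tau_exp al be ga x y z : al + be + ga = 0 ->
  tau (phi 0 (sh al) x) (phi 0 (sh be) y) (phi 0 (sh ga) z) = tau x y z.
Proof.
move=> abg; rewrite /tau -phi0_br phi_adj.
have -> : - (al + be) = ga by rewrite -[RHS]addr0 -{1}oppr0 -abg; ring.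
by rewrite phi0NK.
Qed.

(** The derivative of the exponential is [exp(A) ad (phi_1(-A) z)]: both sides
    agree after [z] is replaced by [(A + t) z], where [A + t] is onto for
    almost every [t]. *)
Lemma dphi_exp z x :
  dphi 0 A A (ad br z) x = phi 0 A (br (phi 1 (- A) z) x).
Proof.
apply/eqP; rewrite -subr_eq0; apply/eqP; apply: vec_ext => f fL.
rewrite (scalar_fun0 fL).
pose B t := shift_lfun A (1 * t).
apply: (@cvg_near_cst0 _ (fun t => f (dphi 0 (B t) A (ad br z) x -
   phi 0 (B t) (br (phi 1 (- B t) z) x)))).
  suff h : vcvg (0 : R)^' (fun t => dphi 0 (B t) A (ad br z) x -
       phi 0 (B t) (br (phi 1 (- B t) z) x))
      (dphi 0 A A (ad br z) x - phi 0 A (br (phi 1 (- A) z) x)).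
    exact: h.
  apply: vcvgB.
    by apply: (@dphi_vcvg _ _ _ _ _ _ 0 B (fun=> A) (fun=> ad br z)) => v;
      [exact: vcvg_shift|exact: vcvg_cst|exact: vcvg_cst].
  apply: (@vcvg_app _ _ _ _ _ _ (fun t => phi 0 (B t))).
    by move=> v; exact: vcvg_phi_shift.
  apply: (@vcvg_bilinear _ _ _ _ br (fun t => phi 1 (- B t) z) (fun=> x)) => //.
    exact: vcvg_phi_shiftN.
  exact: vcvg_cst.
apply: filterS (shift_near_injective A (oner_neq0 R)) => t tA.
have [w ->] := lfun_inj_surj tA z.
have -> : dphi 0 (B t) A (ad br (B t w)) x =
    phi 0 (B t) (br w x) - br w (phi 0 A x).
  rewrite (@dphi_commutator _ _ _ _ _ _ (ad br w)) ?adE // => y.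
  rewrite !adE /B !shiftE A_der brDl brZl.
  by rewrite addrAC addrK.
have -> : phi 1 (- B t) (B t w) = w - phi 0 (- B t) w.
  rewrite phiNX phi0E opp_lfunE; set u := B t _.
  by rewrite opprD addrA subrr add0r opprK.
rewrite (_ : br (w - _) x = br w x - br (phi 0 (- B t) w) x); last first.
  by rewrite brDl brNl.
have := phi0_br (1 * t) 0 (phi 0 (- B t) w) x.
rewrite addr0 shift0 phi0N => e; rewrite lfun_morphB e subrr.
exact: scalar_fun0.
Qed.

(** For [f = 1/2 - phi_2 / phi_1] this is [f(A + al)] applied to
    [phi_1(A + al) x]; parametrizing the argument by [x] avoids the inverse of
    [phi_1]. *)
Definition rho al x := 2^-1 *: phi 1 (sh al) x - phi 2 (sh al) x.

(** The part without derivatives of the Yang-Baxter expression of [f(A)],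
    taken at the vectors [phi_1 x], [phi_1 y], [phi_1 z], with one shift of
    [A] for each slot. *)
Definition cdybe_quad al be ga x y z :=
  tau (rho al x) (rho be y) (phi 1 (sh ga) z) +
  tau (phi 1 (sh al) x) (rho be y) (rho ga z) +
  tau (rho al x) (phi 1 (sh be) y) (rho ga z) +
  4^-1 * tau (phi 1 (sh al) x) (phi 1 (sh be) y) (phi 1 (sh ga) z).

(** The derivative of [f] in the direction [z] between the vectors [phi_1 x]
    and [phi_1 y], with the inverses of [phi_1] cleared by means of the
    adjoint of [f]. The left operator is [A - be] because it is minus the
    adjoint of [A + be]. *)
Definition cdybe_diff al be z x y :=
  b (dphi 1 (sh (- be)) (sh al) (ad br z) x)
    (phi 1 (sh be) y - phi 2 (sh be) y) -
  b (dphi 2 (sh (- be)) (sh al) (ad br z) x) (phi 1 (sh be) y).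

Lemma dphi_ad_shift m al be ga z x : al + be + ga = 0 ->
  dphi m (sh (- be)) (sh al) (ad br (sh ga z)) x =
  phi m (sh (- be)) (br z x) - br z (phi m (sh al) x).
Proof.
move=> abg; rewrite (@dphi_commutator _ _ _ _ _ _ (ad br z)) ?adE // => y.
rewrite !adE !shiftE A_der brDl brZl brD brZ.
have -> : ga = - be - al by rewrite -[ga]addr0 -{1}oppr0 -abg; ring.
apply: vec_ext => f fL.
rewrite !(scalar_funB fL, scalar_funD fL, scalar_funZ fL); ring.
Qed.

Lemma phi1_shift al x : phi 1 (sh al) (sh al x) = phi 0 (sh al) x - x.
Proof. by rewrite phi_self (phi0E (sh al)) addrAC subrr add0r. Qed.

Lemma phi2_shift al x : phi 2 (sh al) (sh al x) = phi 1 (sh al) x - x.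
Proof. by rewrite phi_self (phi1E (sh al)) addrAC subrr add0r. Qed.

Lemma cdybe_diff_image al be ga z x y : al + be + ga = 0 ->
  cdybe_diff al be (sh ga z) (sh al x) (sh be y) =
  - tau z (phi 0 (sh al) x) (phi 0 (sh be) y) + tau z x y +
  (tau z (phi 0 (sh al) x) (phi 1 (sh be) y) - tau z x (phi 1 (sh be) y)) +
  (tau z (phi 1 (sh al) x) (phi 0 (sh be) y) - tau z (phi 1 (sh al) x) y).
Proof.
move=> abg; rewrite /cdybe_diff !(dphi_ad_shift _ _ _ abg).
rewrite !(scalar_funB (b_scalarl _)) !phi_adj opprK phi_odd.
rewrite !phi2_shift !phi1_shift -!/(tau _ _ _).
rewrite !(scalar_funB (tau_scalar2 _ _)) !(scalar_funB (tau_scalar3 _ _)).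
ring.
Qed.

Lemma rho_image al x :
  rho al (sh al x) = 2^-1 *: phi 0 (sh al) x + 2^-1 *: x - phi 1 (sh al) x.
Proof.
rewrite /rho phi1_shift phi2_shift; apply: vec_ext => f fL.
rewrite !(scalar_funB fL, scalar_funD fL, scalar_funZ fL); lra.
Qed.

(** After expansion over [x], [exp(A) x] and [phi_1(A) x] in each slot, two
    relations remain: [exp(A)] preserves [tau], and [A] is a derivation of it,
    used on the vectors [phi_1(A) x], for which [A phi_1(A) x = exp(A) x - x].
    The Cayley transform part accounts for the constant 1/4. *)
Lemma cdybe_image al be ga x y z : al + be + ga = 0 ->
  cdybe_quad al be ga (sh al x) (sh be y) (sh ga z) =
  cdybe_diff al be (phi 1 (sh ga) (sh ga z)) (sh al x) (sh be y) +
  cdybe_diff be ga (phi 1 (sh al) (sh al x)) (sh be y) (sh ga z) +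
  cdybe_diff ga al (phi 1 (sh be) (sh be y)) (sh ga z) (sh al x).
Proof.
move=> abg; rewrite !phi_self.
rewrite !cdybe_diff_image; try by rewrite -abg; ring.
have rel0 := tau_exp x y z abg.
have := tau_shift (phi 1 (sh al) x) (phi 1 (sh be) y) (phi 1 (sh ga) z) abg.
rewrite -!phi_self !phi1_shift.
rewrite /cdybe_quad !rho_image !phi1_shift.
set ex := phi 0 (sh al) x; set ey := phi 0 (sh be) y.
set ez := phi 0 (sh ga) z; set px := phi 1 (sh al) x.
set py := phi 1 (sh be) y; set pz := phi 1 (sh ga) z.
rewrite -/ex -/ey -/ez in rel0.
rewrite !(tau_cyc pz) -!(tau_cyc _ py).
rewrite !(scalar_funB (tau_scalar1 _ _), scalar_funD (tau_scalar1 _ _),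
  scalar_funZ (tau_scalar1 _ _), scalar_funB (tau_scalar2 _ _),
  scalar_funD (tau_scalar2 _ _), scalar_funZ (tau_scalar2 _ _),
  scalar_funB (tau_scalar3 _ _), scalar_funD (tau_scalar3 _ _),
  scalar_funZ (tau_scalar3 _ _)).
move=> rel1; lra.
Qed.

Lemma cdybe_shifted al be ga x y z : al + be + ga = 0 ->
  injective (sh al) -> injective (sh be) -> injective (sh ga) ->
  cdybe_quad al be ga x y z =
  cdybe_diff al be (phi 1 (sh ga) z) x y +
  cdybe_diff be ga (phi 1 (sh al) x) y z +
  cdybe_diff ga al (phi 1 (sh be) y) z x.
Proof.
move=> abg /lfun_inj_surj/(_ x)[x' ->] /lfun_inj_surj/(_ y)[y' ->].
by move=> /lfun_inj_surj/(_ z)[z' ->]; exact: cdybe_image.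
Qed.

Lemma vcvg_rho k x : vcvg (0 : R)^' (fun t => rho (k * t) x) (rho 0 x).
Proof.
rewrite /rho shift0; apply: vcvgB; last exact: vcvg_phi_shift.
by apply: vcvgZ; [exact: cvg_cst|exact: vcvg_phi_shift].
Qed.

Lemma cvg_tau (x y z : R -> V) x0 y0 z0 : vcvg (0 : R)^' x x0 ->
  vcvg (0 : R)^' y y0 -> vcvg (0 : R)^' z z0 ->
  tau (x t) (y t) (z t) @[t --> (0 : R)^'] --> tau x0 y0 z0.
Proof.
move=> xx yy zz; apply: cvg_bilinear => //.
exact: vcvg_bilinear.
Qed.

Lemma cvg_cdybe_diff k l (z : R -> V) z0 x y : vcvg (0 : R)^' z z0 ->
  cdybe_diff (k * t) (l * t) (z t) x y @[t --> (0 : R)^'] -->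
  cdybe_diff 0 0 z0 x y.
Proof.
move=> zz.
have phis m v a : vcvg (0 : R)^' (fun t => phi m (sh (a * t)) v) (phi m (sh 0) v).
  by rewrite shift0; exact: vcvg_phi_shift.
have dphis m v : vcvg (0 : R)^' (fun t => dphi m (sh (- (l * t))) (sh (k * t))
    (ad br (z t)) v) (dphi m (sh (- 0)) (sh 0) (ad br z0) v).
  rewrite oppr0 shift0; apply: (@dphi_vcvg _ _ _ _ _ _ m
    (fun t => sh (- (l * t))) (fun t => sh (k * t)) (fun t => ad br (z t))) => w.
  - rewrite (_ : (fun t => _) = (fun t => sh (- l * t) w)).
      exact: vcvg_shift.
    by apply/funext => t; rewrite mulNr.
  - exact: vcvg_shift.
  - rewrite (_ : (fun t => _) = (fun t => br (z t) w)).
      rewrite adE; apply: (@vcvg_bilinear _ _ _ _ br z (fun=> w)) => //.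
      exact: vcvg_cst.
    by apply/funext => t; rewrite adE.
apply: cvgB; apply: cvg_bilinear => //; try exact: dphis; try exact: phis.
by apply: vcvgB; exact: phis.
Qed.

(** The shifts [t], [t], [- 2 t] add up to zero and are nonzero for nonzero
    [t]. *)
Lemma cdybe_unshifted x y z :
  cdybe_quad 0 0 0 x y z =
  cdybe_diff 0 0 (phi 1 A z) x y + cdybe_diff 0 0 (phi 1 A x) y z +
  cdybe_diff 0 0 (phi 1 A y) z x.
Proof.
apply/eqP; rewrite -subr_eq0; apply/eqP.
apply: (@cvg_near_cst0 _ (fun t =>
  cdybe_quad (1 * t) (1 * t) (- 2 * t) x y z -
  (cdybe_diff (1 * t) (1 * t) (phi 1 (sh (- 2 * t)) z) x y +
   cdybe_diff (1 * t) (- 2 * t) (phi 1 (sh (1 * t)) x) y z +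
   cdybe_diff (- 2 * t) (1 * t) (phi 1 (sh (1 * t)) y) z x))).
  apply: cvgB.
    have phis m v a : vcvg (0 : R)^' (fun t => phi m (sh (a * t)) v)
        (phi m (sh 0) v).
      by rewrite shift0; exact: vcvg_phi_shift.
    rewrite /cdybe_quad; apply: cvgD.
      by apply: cvgD; [apply: cvgD|]; apply: cvg_tau;
         try exact: vcvg_rho; exact: phis.
    by apply: cvgMl_tmp; apply: cvg_tau; exact: phis.
  by apply: cvgD; [apply: cvgD|]; apply: cvg_cdybe_diff; exact: vcvg_phi_shift.
have n2 : (- 2 : R) != 0 by rewrite oppr_eq0 pnatr_eq0.
apply: filterS2 (shift_near_injective A (oner_neq0 R))
  (shift_near_injective A n2) => t i1 i2.
by rewrite cdybe_shifted ?subrr //; ring.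
Qed.

End QuadraticIdentities.

(** * The scalar functions [phi_m] on the complex plane *)

Section ComplexPhi.
Context {R : realType}.
Implicit Types (z w : R[i]) (u v : (R^o * R^o)%type).

Local Notation C2 := (R^o * R^o)%type.

Definition to_complex (u : C2) : R[i] := (u.1 +i* u.2)%C.

Definition of_complex (z : R[i]) : C2 := let: (x +i* y)%C := z in (x, y).

Lemma of_complexK : cancel of_complex to_complex.
Proof. by case. Qed.

Lemma to_complexK : cancel to_complex of_complex.
Proof. by case. Qed.

Lemma to_complexD u v : to_complex (u + v) = to_complex u + to_complex v.
Proof. by []. Qed.

Lemma to_complexN u : to_complex (- u) = - to_complex u.
Proof. by []. Qed.

Lemma to_complexZ (a : R) u : to_complex (a *: u) = a%:C%C * to_complex u.
Proof. by case: u => x y; rewrite /to_complex /=; simpc. Qed.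

Definition mulc_fun z u : C2 := of_complex (z * to_complex u).

Fact mulc_fun_linear z : linear (mulc_fun z).
Proof.
move=> a u v; apply: (can_inj to_complexK).
rewrite to_complexD to_complexZ !of_complexK to_complexD to_complexZ.
by rewrite mulrDr mulrCA.
Qed.

Definition mulc_lfun z : 'End(C2) := linfun (mulc_fun z).

Lemma mulc_lfunE z u : to_complex (mulc_lfun z u) = z * to_complex u.
Proof. by rewrite linfunE ?of_complexK //; exact: mulc_fun_linear. Qed.

Lemma mulc_lfunC z w u : mulc_lfun z (mulc_lfun w u) = mulc_lfun w (mulc_lfun z u).
Proof. by apply: (can_inj to_complexK); rewrite !mulc_lfunE mulrCA. Qed.

(** The entire function [phi_m], obtained as [phi_m] of the multiplication by
    [z] on the real plane, so that the estimates for operators apply to it. *)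
Definition cphi m z : R[i] := to_complex (phi m (mulc_lfun z) (1, 0)).

Lemma to_complex_phi m z u :
  to_complex (phi m (mulc_lfun z) u) = cphi m z * to_complex u.
Proof.
have {1}-> : u = mulc_lfun (to_complex u) (1, 0).
  by apply: (can_inj to_complexK); rewrite mulc_lfunE /to_complex /= mulr1.
rewrite -phi_commute => [|v]; last exact: mulc_lfunC.
by rewrite mulc_lfunE mulrC.
Qed.

Lemma cphi_rec m z : cphi m z = (m`!%:R)^-1 + z * cphi m.+1 z.
Proof.
rewrite {1}/cphi phi_rec to_complexD mulc_lfunE -/(cphi _ _) to_complexZ.
congr (_ + _); rewrite /to_complex /= mulr1.
by rewrite (fmorphV (real_complex R)) rmorph_nat.
Qed.

Lemma scalar_C2 (f : C2 -> R) u : scalar f -> f u = u.1 * f (1, 0) + u.2 * f (0, 1).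
Proof.
move=> fL; have -> : u = u.1 *: ((1, 0) : C2) + u.2 *: ((0, 1) : C2).
  case: u => x y; congr (_, _); rewrite /= /GRing.scale /=.
    by rewrite mulr1 mulr0 addr0.
  by rewrite mulr0 mulr1 add0r.
rewrite fL (scalar_funZ fL) /= /GRing.scale /=.
by rewrite !mulr1 !mulr0 addr0 add0r.
Qed.

Lemma is_derive_quotient (g : R -> R) (t d : R) : is_derive t (1 : R) g d ->
  h^-1 * (g (h + t) - g t) @[h --> (0 : R)^'] --> d.
Proof.
case=> dg <-.
rewrite (_ : (fun h => _) =
  (fun h : R => h^-1 *: ((g \o shift t) (h *: (1 : R)) - g t))) //.
by apply/funext => h; rewrite /= /GRing.scale /= mulr1.
Qed.

(** The curve [exp (t x) (cos (t y) + i sin (t y))] solves the flow equation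
    of multiplication by [x + i y]. *)
Lemma cphi0 z : cphi 0 z = cexp z.
Proof.
case: z => x y.
pose u (t : R) : C2 := (expR (t * x) * cos (t * y), expR (t * x) * sin (t * y)).
have ud t : vderive u t (mulc_lfun (x +i* y)%C (u t)).
  have -> : mulc_lfun (x +i* y)%C (u t) =
      (x * (u t).1 - y * (u t).2, x * (u t).2 + y * (u t).1).
    by apply: (can_inj to_complexK); rewrite mulc_lfunE.
  move=> f fL; rewrite scalar_C2 //=.
  rewrite (_ : (fun h => _) = (fun h =>
      (h^-1 * ((u (h + t)).1 - (u t).1)) * f (1, 0) +
      (h^-1 * ((u (h + t)).2 - (u t).2)) * f (0, 1))); last first.
    by apply/funext => h; rewrite scalar_C2.
  apply: cvgD; apply: cvgMr_tmp.
    apply: (@is_derive_quotient (fun t => expR (t * x) * cos (t * y))).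
    by apply: is_derive_eq; rewrite /GRing.scale /=; ring.
  apply: (@is_derive_quotient (fun t => expR (t * x) * sin (t * y))).
  by apply: is_derive_eq; rewrite /GRing.scale /=; ring.
have := flow_unique ud; rewrite /u !mul1r !mul0r expR0 cos0 sin0 mulr1 mulr0.
by rewrite /cphi => <-.
Qed.

Lemma norm_to_complex u : `|to_complex u| <= (`|u.1| + `|u.2|)%:C%C.
Proof.
rewrite normc_def lecR /=.
rewrite -(@ler_pXn2r _ 2) ?nnegrE ?sqrtr_ge0 ?addr_ge0 //.
rewrite sqr_sqrtr ?addr_ge0 ?sqr_ge0 // sqrrD !real_normK ?num_real //.
by rewrite -addrA lerD2l lerDr mulrn_wge0 // mulr_ge0.
Qed.

Lemma norm_to_complex_vnorm : exists2 M : R, 0 <= M &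
  forall u, `|to_complex u| <= (M * vnorm u)%:C%C.
Proof.
have s1 : scalar (fst : C2 -> R) by move=> a [x y] [x' y'].
have s2 : scalar (snd : C2 -> R) by move=> a [x y] [x' y'].
have [M1 M10 b1] := scalar_bounded s1; have [M2 M20 b2] := scalar_bounded s2.
exists (M1 + M2); first exact: addr_ge0.
move=> u; apply: le_trans (norm_to_complex u) _; rewrite lecR mulrDl.
exact: lerD.
Qed.

Lemma opnorm_mulc : exists2 M : R, 0 <= M &
  forall z (rho : R), `|z| <= rho%:C%C -> opnorm (mulc_lfun z) <= M * rho.
Proof.
pose J := mulc_lfun 'i%C; pose I := \1%VF : 'End(C2).
exists (opnorm I + opnorm J); first by rewrite addr_ge0 ?opnorm_ge0.
move=> [x y] rho zr.
have -> : mulc_lfun (x +i* y)%C = x *: I + y *: J.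
  apply/lfunP => u; apply: (can_inj to_complexK).
  rewrite mulc_lfunE add_lfunE !scale_lfunE id_lfunE to_complexD !to_complexZ.
  by rewrite mulc_lfunE mulrA -mulrDl; congr (_ * _); simpc.
have zr' : Num.sqrt (x ^+ 2 + y ^+ 2) <= rho by rewrite normc_def lecR in zr.
have xr : `|x| <= rho.
  apply: le_trans zr'; rewrite -sqrtr_sqr ler_sqrt ?addr_ge0 ?sqr_ge0 //.
  by rewrite lerDl sqr_ge0.
have yr : `|y| <= rho.
  apply: le_trans zr'; rewrite -sqrtr_sqr ler_sqrt ?addr_ge0 ?sqr_ge0 //.
  by rewrite lerDr sqr_ge0.
apply: le_trans (opnormD _ _) _; rewrite !opnormZ mulrDl.
by apply: lerD; rewrite mulrC ler_wpM2l ?opnorm_ge0.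
Qed.

End ComplexPhi.

(** * Polynomial interpolation of [phi_m] *)

Section PolynomialCalculus.
Context {R : realType}.
Implicit Types (p q : {poly R}) (z w : R[i]).

Local Notation C2 := (R^o * R^o)%type.

Section Companion.
Variables (d : nat) (q : {poly R}).

(** Multiplication by ['X] modulo [q] on the polynomials of degree less than
    [d]: subtracting the multiple of [q] that cancels the coefficient of
    ['X^d] is enough when [q] is monic of degree [d]. *)
Definition compan_fun (r : {poly_d R}) : {poly_d R} :=
  npolyp d ((r : {poly R}) * 'X - (r : {poly R})`_d.-1 *: q).

Fact compan_fun_linear : linear compan_fun.
Proof.
move=> a r s; apply/val_inj/polyP => i /=.
rewrite [RHS]coefD coefZ !coef_npolyp; case: ifP => _; last by rewrite mulr0 addr0.
by rewrite !(coefB, coefMX, coefZ, coefD); case: i => [|i] /=;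
   rewrite ?(coefD, coefZ); ring.
Qed.

Definition compan : 'End({poly_d R}) := linfun compan_fun.

Hypothesis q_monic : q \is monic.
Hypothesis q_size : size q = d.+1.
Hypothesis d_gt0 : (0 < d)%N.

Lemma companE (r : {poly_d R}) :
  compan r = (r : {poly R}) * 'X - (r : {poly R})`_d.-1 *: q :> {poly R}.
Proof.
rewrite linfunE; last exact: compan_fun_linear.
rewrite npolypK //; apply/leq_sizeP => j dj.
rewrite coefB coefMX coefZ; case: j dj => [|j] dj.
  by have := leq_trans d_gt0 dj.
rewrite /=; move: dj; rewrite leq_eqVlt => /orP[/eqP dj|dj].
  have qj : q`_j.+1 = 1.
    by have := monicP q_monic; rewrite lead_coefE q_size /= dj.
  have dj' : d.-1 = j by rewrite dj.
  by rewrite qj dj' mulr1 subrr.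
have qj : q`_j.+1 = 0 by rewrite nth_default // q_size.
have rj : (r : {poly R})`_j = 0.
  by rewrite nth_default // (leq_trans (size_npoly r)).
by rewrite qj rj mulr0 subr0.
Qed.

End Companion.

Definition ceval z p : C2 := of_complex (cpoly p).[z].

Lemma to_complex_ceval z p : to_complex (ceval z p) = (cpoly p).[z].
Proof. exact: of_complexK. Qed.

Lemma cpolyZ a p : cpoly (a *: p) = a%:C%C *: cpoly p.
Proof. exact: map_polyZ. Qed.

Lemma cpolyB p q : cpoly (p - q) = cpoly p - cpoly q.
Proof. exact: rmorphB. Qed.

Lemma cpolyD p q : cpoly (p + q) = cpoly p + cpoly q.
Proof. exact: rmorphD. Qed.

Lemma cpolyM p q : cpoly (p * q) = cpoly p * cpoly q.
Proof. exact: rmorphM. Qed.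

Lemma cpolyX : cpoly ('X : {poly R}) = 'X.
Proof. exact: map_polyX. Qed.

Lemma ceval_linear d z : linear (fun r : {poly_d R} => ceval z r).
Proof.
move=> a r s; apply: (can_inj to_complexK).
rewrite to_complexD to_complexZ !to_complex_ceval /=.
by rewrite cpolyD cpolyZ hornerD hornerZ.
Qed.

(** The remainders of the powers ['X^n] modulo [q] are the vectors [Y^n 1] for
    the companion operator [Y] of [q], so [p := phi_m(Y) 1] collects the
    remainders of all terms of the series of [phi_m]. Evaluation at [z]
    intertwines [Y] with multiplication by [z] up to a multiple of [q(z)];
    the defect [phi_m(z) - p(z)] is therefore [q(z)] times a value of [dphi],
    which is locally bounded in [z]. *)
Lemma phi_interpolation m q : q \is monic ->
  exists p, (forall (V : vectType R) (A : 'End(V)), lfun_horner q A = 0 ->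
      lfun_horner p A = phi m A) /\
    forall rho : R, exists2 M : R, 0 <= M & forall z, `|z| <= rho%:C%C ->
      `|cphi m z - (cpoly p).[z]| <= M%:C%C * `|(cpoly q).[z]|.
Proof.
(* The companion operator is that of [q * 'X], whose degree is positive even
   for constant [q]. *)
move=> qm; pose q' := q * 'X.
have q'm : q' \is monic by rewrite monicMr ?monicX.
have sq : size q' = (size q).+1.
  by rewrite size_mulX // monic_neq0.
have d0 : (0 < size q)%N by rewrite size_poly_gt0 monic_neq0.
pose d := size q; pose Y := compan d q'.
have YE := @companE d q' q'm sq d0.
pose one : {poly_d R} := npolyp d 1.
have oneE : one = 1 :> {poly R} by rewrite npolypK // size_polyC oner_eq0.
exists (phi m Y one : {poly R}); split.
  move=> V A qA; apply/lfunP => x.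
  pose T := linfun (fun r : {poly_d R} => lfun_horner r A x).
  have TE r : T r = lfun_horner r A x.
    by rewrite linfunE // => a s t; rewrite /= lfun_hornerD lfun_hornerZ.
  have TY r : T (Y r) = A (T r).
    rewrite !TE YE lfun_hornerB lfun_hornerMX lfun_hornerZ lfun_hornerMX qA.
    by rewrite zero_lfunE linear0 scaler0 subr0.
  have := phi_intertwine m TY one; rewrite !TE oneE => ->.
  by rewrite -polyC1 lfun_hornerC scale1r.
move=> rho.
have [K K0 dK] := dphi_bounded C2 {poly_d R} m.
have [K1 K10 normK] := @norm_to_complex_vnorm R.
have [K2 K20 mulK] := @opnorm_mulc R.
pose B1 : 'Hom({poly_d R}, C2) :=
  linfun (fun r : {poly_d R} => (r : {poly R})`_d.-1 *: ((1, 0) : C2)).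
have B1E r : B1 r = (r : {poly R})`_d.-1 *: ((1, 0) : C2).
  rewrite linfunE // => a s t.
  by rewrite /= coefD coefZ scalerDl scalerA.
pose K3 := K * expR (K * (K2 * rho + opnorm Y + 1)) * opnorm B1 * vnorm one.
exists (`|K1 * K3 * rho|) => // z zr.
pose ev : 'Hom({poly_d R}, C2) := linfun (fun r : {poly_d R} => ceval z r).
have evE r : to_complex (ev r) = (cpoly (r : {poly R})).[z].
  by rewrite linfunE ?to_complex_ceval //; exact: ceval_linear.
pose Mz := mulc_lfun z; pose S := mulc_lfun (cpoly q').[z].
have comm r : (S \o B1)%VF r = Mz (ev r) - ev (Y r).
  apply: (can_inj to_complexK); rewrite to_complexD to_complexN !mulc_lfunE !evE.
  rewrite comp_lfunE mulc_lfunE B1E to_complexZ YE cpolyB cpolyZ cpolyM cpolyX.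
  rewrite !hornerE /to_complex /= mulr1; set a := _.[z]; ring.
have := @dphi_commutator _ _ _ m Mz Y ev (S \o B1)%VF comm one.
have <- : S (dphi m Mz Y B1 one) = dphi m Mz Y (S \o B1)%VF one.
  rewrite (@dphi_intertwine _ _ _ _ _ m Mz Y B1 Mz Y (S \o B1)%VF S \1%VF).
  - by rewrite id_lfunE.
  - by move=> u; exact: mulc_lfunC.
  - by move=> r; rewrite !id_lfunE.
  - by move=> r; rewrite comp_lfunE id_lfunE.
move=> /(congr1 (@to_complex R)).
rewrite to_complexD to_complexN mulc_lfunE to_complex_phi !evE oneE.
rewrite (_ : (cpoly 1).[z] = 1); last by rewrite /cpoly rmorph1 hornerC.
rewrite mulr1 => <-; rewrite normrM cpolyM cpolyX hornerMX normrM.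
have dle : `|to_complex (dphi m Mz Y B1 one)| <= (K1 * K3)%:C%C.
  apply: le_trans (normK _) _; rewrite lecR ler_wpM2l //.
  apply: le_trans (dK _ _ _ _) _; rewrite /K3.
  rewrite !ler_wpM2r ?vnorm_ge0 ?opnorm_ge0 // ler_wpM2l //.
  by rewrite ler_expR ler_wpM2l // !lerD2r mulK.
have K3_0 : 0 <= (K1 * K3)%:C%C by exact: le_trans (normr_ge0 _) dle.
have rho0 : 0 <= rho%:C%C by exact: le_trans (normr_ge0 _) zr.
rewrite -mulrA [X in X <= _]mulrC ler_wpM2r ?normr_ge0 //.
have -> : `|K1 * K3 * rho|%:C%C = (K1 * K3)%:C%C * rho%:C%C.
  by rewrite ger0_norm ?rmorphM // mulr_ge0 // -ler0c.
by rewrite mulrC; apply: ler_pM.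
Qed.

(** * Domination and divisibility of polynomials *)

Lemma poly_lipschitz (P : {poly R[i]}) w : exists2 M : R[i], 0 <= M &
  forall z, `|z - w| < 1 -> `|P.[z] - P.[w]| <= M * `|z - w|.
Proof.
have : root (P - P.[w]%:P) w by rewrite rootE !hornerE subrr.
move=> /factor_theorem[s Ps]; have [M sM] := poly_disk_bound s (`|w| + 1).
exists `|M| => // z zw.
have -> : P.[z] - P.[w] = (P - P.[w]%:P).[z] by rewrite !hornerE.
have zw' : `|z| <= `|w| + 1.
  by rewrite -[z](subrK w) addrC (le_trans (ler_normD _ _)) // lerD2l ltW.
rewrite Ps hornerM hornerXsubC normrM ler_wpM2r //.
by rewrite (le_trans (sM _ zw')) // ger0_norm // (le_trans _ (sM _ zw')).
Qed.

Lemma gt0_complex (d : R[i]) : 0 < d -> d = (complex.Re d)%:C%C /\ 0 < complex.Re d.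
Proof. by case: d => a b; rewrite ltcE /= => /andP[/eqP -> a0]. Qed.

Lemma small_positive (d a K : R[i]) : 0 < d -> 0 < a -> 0 <= K ->
  exists t : R[i], [/\ 0 < t, t < d, t < 1 & t * K < a].
Proof.
move=> /gt0_complex[-> d0] /gt0_complex[-> a0].
rewrite le_eqVlt => /orP[/eqP <-|/gt0_complex[-> K0]].
  exists (Num.min (complex.Re d / 2) (1 / 2))%:C%C.
  rewrite mulr0 !ltcR; split => //.
  - by rewrite lt_min !divr_gt0.
  - by rewrite gt_min; apply/orP; left; lra.
  - by rewrite gt_min; apply/orP; right; lra.
move: (complex.Re d) (complex.Re a) (complex.Re K) d0 a0 K0 => e b k /= e0 b0 k0.
exists (Num.min (Num.min (e / 2) (1 / 2)) (b / (2 * k)))%:C%C.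
rewrite -rmorphM !ltcR; split.
- by rewrite !lt_min !divr_gt0 // mulr_gt0.
- by rewrite !gt_min; apply/orP; left; apply/orP; left; lra.
- by rewrite !gt_min; apply/orP; left; apply/orP; right; lra.
- apply: (@le_lt_trans _ _ (b / (2 * k) * k)).
    by rewrite ler_pM2r // ge_min lexx orbT.
  rewrite invfM mulrA -[_ * k^-1 * k]mulrA mulVf ?gt_eqF // mulr1; lra.
Qed.

Lemma dominated_root (D P : {poly R[i]}) w C d : 0 < d -> root D w ->
  (forall z, z != w -> `|z - w| < d -> `|P.[z]| <= C * `|D.[z]|) ->
  root P w.
Proof.
move=> d0 Dw dom; apply: contrapT => /negP Pw.
have a0 : 0 < `|P.[w]| by rewrite normr_gt0.
have [M1 M10 L1] := poly_lipschitz P w; have [M2 M20 L2] := poly_lipschitz D w.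
have [|t [t0 td t1 ta]] := @small_positive d _ (`|C| * M2 + M1) d0 a0.
  by rewrite addr_ge0 // mulr_ge0.
have zw : `|w + t - w| = t by rewrite addrC addKr ger0_norm // ltW.
have zw0 : w + t != w by rewrite -subr_eq0 addrC addKr gt_eqF.
have := L1 (w + t); have := L2 (w + t); have := dom (w + t) zw0.
rewrite zw => /(_ td) b1 /(_ t1) b2 /(_ t1) b3.
rewrite (eqP Dw) subr0 in b2.
have b1' : `|P.[w + t]| <= `|C| * M2 * t.
  apply: (le_trans b1); rewrite -(@ger0_norm _ (C * _)); last first.
    exact: le_trans (normr_ge0 _) b1.
  by rewrite normrM normr_id -mulrA ler_wpM2l.
have : `|P.[w]| <= `|C| * M2 * t + M1 * t.
  rewrite -[P.[w]](subKr P.[w + t]) (le_trans (ler_normB _ _)) //.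
  exact: lerD.
rewrite -mulrDl mulrC => /le_lt_trans/(_ ta).
by rewrite ltxx.
Qed.

(** Induction on the degree of [D]. A root [w] of [D] is a root of [P]; the
    factor [z - w] can be divided out on both sides, which away from [w] does
    not affect the domination. *)
Lemma dominated_dvdp (D P : {poly R[i]}) : D != 0 ->
  (forall w, root D w -> exists C d : R[i], 0 < d /\
     forall z, z != w -> `|z - w| < d -> `|P.[z]| <= C * `|D.[z]|) ->
  D %| P.
Proof.
move: {2}(size D) (leqnn (size D)) => n; elim: n D P => [|n IH] D P sD D0 dom.
  by move: sD; rewrite leqn0 size_poly_eq0 (negPf D0).
have [sD1|sD1] := eqVneq (size D) 1%N.
  have /size_poly1P[c c0 ->] : size D == 1%N by rewrite sD1.
  by rewrite -[c%:P]mulr1 mul_polyC dvdpZl ?dvd1p.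
have [w Dw] := closed_rootP D sD1.
have [C [d [d0 domw]]] := dom w Dw.
have Pw := dominated_root d0 Dw domw.
have /factor_theorem[D' DE] := Dw; have /factor_theorem[P' PE] := Pw.
have D'0 : D' != 0 by apply: contraNneq D0 => D'0; rewrite DE D'0 mul0r.
rewrite PE DE dvdp_mul2r ?polyXsubC_eq0 //.
apply: IH => // [|w' D'w'].
  by move: sD; rewrite DE size_Mmonic ?monicXsubC // size_XsubC addn2.
have Dw' : root D w' by rewrite DE rootM D'w'.
have [C' [d' [d'0 dom']]] := dom w' Dw'.
have canc z : z != w -> `|P.[z]| <= C' * `|D.[z]| -> `|P'.[z]| <= C' * `|D'.[z]|.
  move=> zw; rewrite PE DE !hornerM !normrM mulrA ler_pM2r //.
  by rewrite normr_gt0 hornerXsubC subr_eq0.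
have [ww'|ww'] := eqVneq w' w.
  exists C', d'; split => // z zw' zd'; apply: canc; first by rewrite -ww'.
  exact: dom'.
have ww'0 : 0 < `|w' - w| by rewrite normr_gt0 subr_eq0.
(* The radius [t] is at most the distance from [w'] to [w], so that [w] is not
   reached. *)
have [t [t0 td' _ tw]] := small_positive d'0 ww'0 ler01.
exists C', t; split => // z zw' zt; apply: canc; last first.
  by apply: dom' => //; exact: lt_trans td'.
apply: contraTneq zt => ->; rewrite -real_leNgt ?num_real ?normr_real ?gtr0_real //.
by rewrite distrC -[t]mulr1 ltW.
Qed.

End PolynomialCalculus.

(** * The functional calculus of [exp] and of [coth(z/2)/2 - 1/z] *)

Section FunctionalCalculus.
Context {R : realType}.
Implicit Types (V : vectType R) (p q : {poly R}) (z w : R[i]).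

Lemma root_cpoly_dvd p q w : p %| q -> root (cpoly p) w -> root (cpoly q) w.
Proof.
move=> /dvdpP[s ->]; rewrite cpolyM rootM => ->; exact: orbT.
Qed.

Lemma lfun_horner_dvd V (A : 'End(V)) p q : p %| q -> lfun_horner p A = 0 ->
  lfun_horner q A = 0.
Proof.
move=> /dvdpP[s ->] pA; apply/lfunP => x.
by rewrite lfun_hornerM pA !zero_lfunE linear0.
Qed.

Lemma lfun_horner_gcd V (A : 'End(V)) p q :
  lfun_horner p A = 0 -> lfun_horner q A = 0 -> lfun_horner (gcdp p q) A = 0.
Proof.
move=> pA qA; have [[u v] /eqpP[[c1 c2] /= /andP[c10 c20] e]] := Bezoutp p q.
apply/lfunP => x; apply: (scalerI c20).
rewrite -lfun_hornerZ -e lfun_hornerZ lfun_hornerD !lfun_hornerM pA qA.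
by rewrite !zero_lfunE !linear0 addr0 !scaler0.
Qed.

Lemma poly_bounded_near (P : {poly R[i]}) w : exists2 M : R[i], 0 <= M &
  forall z, `|z - w| < 1 -> `|P.[z]| <= M.
Proof.
have [M M0 L] := poly_lipschitz P w; exists (M + `|P.[w]|); first exact: addr_ge0.
move=> z zw; rewrite -[P.[z]](subrK P.[w]) (le_trans (ler_normD _ _)) //.
by rewrite lerD2r (le_trans (L z zw)) // ler_piMr // ltW.
Qed.

(** Near each root of the gcd of the two annihilating polynomials, the
    difference of the two interpolating polynomials is dominated by that gcd,
    which therefore divides it and annihilates [A]. *)
Lemma is_fun_of_unique (f : R[i] -> R[i]) V (A T1 T2 : 'End(V)) :
  is_fun_of f A T1 -> is_fun_of f A T2 -> T1 = T2.
Proof.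
move=> [p1 [q1 [q10 q1A -> dom1]]] [p2 [q2 [q20 q2A -> dom2]]].
pose d := gcdp q1 q2.
have d0 : d != 0 by rewrite gcdp_eq0 negb_and q10.
have dA : lfun_horner d A = 0 by exact: lfun_horner_gcd.
suff dp : d %| p1 - p2.
  apply/lfunP => x; apply/eqP; rewrite -subr_eq0 -lfun_hornerB.
  by rewrite (lfun_horner_dvd dp dA) zero_lfunE.
rewrite -(dvdp_map (real_complex R)); apply: dominated_dvdp.
  by rewrite map_poly_eq0.
move=> w dw.
have [C1 [d1 [d10 {}dom1]]] := dom1 w (root_cpoly_dvd (dvdp_gcdl q1 q2) dw).
have [C2 [d2 [d20 {}dom2]]] := dom2 w (root_cpoly_dvd (dvdp_gcdr q1 q2) dw).
have /dvdpP[s1 s1E] := dvdp_gcdl q1 q2; have /dvdpP[s2 s2E] := dvdp_gcdr q1 q2.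
have [M1 M10 b1] := poly_bounded_near (cpoly s1) w.
have [M2 M20 b2] := poly_bounded_near (cpoly s2) w.
have [t [t0 t1 t1' t2]] := small_positive d10 d20 ler01.
exists (`|C1| * M1 + `|C2| * M2), t; split => // z zw zt.
have z1 := lt_trans zt t1'; have zd1 := lt_trans zt t1.
have zd2 : `|z - w| < d2 by rewrite (lt_trans zt) // -[t]mulr1.
have bnd C M s q p : q = s * d -> (`|z - w| < 1 -> `|(cpoly s).[z]| <= M) ->
    `|f z - (cpoly p).[z]| <= C * `|(cpoly q).[z]| ->
    `|f z - (cpoly p).[z]| <= `|C| * M * `|(cpoly d).[z]|.
  move=> -> /(_ z1) sM le; apply: (le_trans le).
  rewrite -(@ger0_norm _ (C * _)); last exact: le_trans (normr_ge0 _) le.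
  rewrite cpolyM hornerM normrM normr_id normrM !mulrA.
  by rewrite ler_wpM2r // ler_wpM2l.
rewrite -/(cpoly _) cpolyB hornerD hornerN.
have := lerD (bnd _ _ _ _ _ s1E (b1 z) (dom1 z zw zd1))
  (bnd _ _ _ _ _ s2E (b2 z) (dom2 z zw zd2)).
rewrite -mulrDl; apply: le_trans.
rewrite -[f z - (cpoly p1).[z] in X in _ <= X]opprB normrN.
by apply: le_trans (ler_normD _ _); rewrite addrA subrK.
Qed.

Lemma fun_ofE (f : R[i] -> R[i]) V (A T : 'End(V)) :
  is_fun_of f A T -> fun_of f A = T.
Proof.
move=> fT; apply: (is_fun_of_unique (f := f) (A := A)) => //.
exact: (xgetPex 0 (ex_intro _ T fT)).
Qed.

Lemma annihilator_monic V (A : 'End(V)) :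
  exists q, q \is monic /\ lfun_horner q A = 0.
Proof.
have [q [q0 qA]] := annihilator_exists A.
exists ((lead_coef q)^-1 *: q); split.
  by rewrite monicE lead_coefZ mulVf // lead_coef_eq0.
by apply/lfunP => x; rewrite lfun_hornerZ qA zero_lfunE scaler0.
Qed.

Lemma norm_complexE z : exists rho : R, `|z| = rho%:C%C.
Proof. by eexists; exact: normc_def. Qed.

Lemma phi_interpolation_near m q : q \is monic ->
  exists p, (forall V (A : 'End(V)), lfun_horner q A = 0 ->
      lfun_horner p A = phi m A) /\
    forall w, exists2 M : R[i], 0 <= M & forall z, `|z - w| < 1 ->
      `|cphi m z - (cpoly p).[z]| <= M * `|(cpoly q).[z]|.
Proof.
move=> qm; have [p [pA pM]] := phi_interpolation m qm.
exists p; split => // w; have [rho wrho] := norm_complexE w.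
have [M M0 b] := pM (rho + 1); exists M%:C%C; first by rewrite ler0c.
move=> z zw; apply: b.
rewrite -[z](subrK w) addrC (le_trans (ler_normD _ _)) //.
by rewrite rmorphD wrho lerD2l ltW.
Qed.

Lemma fun_of_cexp V (A : 'End(V)) : fun_of cexp A = phi 0 A.
Proof.
apply: fun_ofE; have [q [qm qA]] := annihilator_monic A.
have [p [pA pM]] := phi_interpolation_near 0 qm.
exists p, q; split => //; first exact: monic_neq0.
  by rewrite pA.
move=> w _; have [M M0 b] := pM w; exists M, 1; split=> // z _ zw.
by rewrite -cphi0; exact: b.
Qed.

Lemma cexpD z w : cexp (z + w) = cexp z * cexp w.
Proof.
case: z w => [a b] [c d].
have -> : ((a +i* b) + (c +i* d) = (a + c) +i* (b + d))%C by [].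
rewrite /cexp; simpc.
by rewrite expRD cosD sinD; congr (_ +i* _)%C; ring.
Qed.

Lemma cexpN z : cexp z * cexp (- z) = 1.
Proof.
by rewrite -cexpD subrr /cexp /= expR0 cos0 sin0 !mulr0 mulr1.
Qed.

Lemma cexp_neq0 z : cexp z != 0.
Proof. by apply/eqP => z0; have := cexpN z; rewrite z0 mul0r => /esym/eqP; rewrite oner_eq0. Qed.

Lemma cexp_eq1_small z : `|z| < 1 -> cexp z = 1 -> z = 0.
Proof.
case: z => x y z1 []; have zy : `|y| < 1.
  move: z1; rewrite normc_def ltcR /=; apply: le_lt_trans.
  by rewrite -sqrtr_sqr ler_sqrt ?addr_ge0 ?sqr_ge0 // lerDr sqr_ge0.
move=> ec /eqP; rewrite mulf_eq0 gt_eqF ?expR_gt0 //= => /eqP sy.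
have y0 : y = 0.
  apply/eqP/negP => y0.
  have pi1 : 1 < pi :> R by have := @pi_ge2 R; lra.
  have sp t : 0 < t -> t < 1 -> sin t != 0 :> R.
    by move=> t0 t1; rewrite gt_eqF // sin_gt0_pi // t0 (lt_trans t1 pi1).
  have [yp|yn|/esym/eqP//] := ltgtP 0 y.
    by have := sp y yp; rewrite sy eqxx -(gtr0_norm yp) => /(_ zy).
  have yn' : 0 < - y by rewrite oppr_gt0.
  by have := sp _ yn'; rewrite sinN sy oppr0 eqxx -(ltr0_norm yn) => /(_ zy).
have x0 : x = 0.
  by apply/eqP; move: ec; rewrite y0 cos0 mulr1 -{1}expR0 => /expR_inj ->.
by rewrite x0 y0.
Qed.

Lemma cphi0E z : cexp z = 1 + z * cphi 1 z.
Proof. by rewrite -cphi0 cphi_rec fact0 invr1. Qed.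

Lemma cphi1E z : cphi 1 z = 1 + z * cphi 2 z.
Proof. by rewrite cphi_rec (_ : 1`! = 1%N) // invr1. Qed.

(** With [a = exp (z / 2)], both sides are rational expressions in [a] and
    [z]. *)
Lemma f_cdybeE z : z != 0 -> cexp z != 1 ->
  f_cdybe z = 2^-1 - cphi 2 z / cphi 1 z.
Proof.
move=> z0 ez; rewrite /f_cdybe /ccoth.
set a := cexp (z / 2); set b := cexp (- (z / 2)).
have ab : a * b = 1 by exact: cexpN.
have aa : a * a = cexp z.
  by rewrite -cexpD (_ : z / 2 + z / 2 = z) //; field.
have a0 : a != 0 by exact: cexp_neq0.
have bE : b = a^-1 by rewrite -[LHS]mul1r -(mulVf a0) -mulrA ab mulr1.
have psi0 : cphi 1 z != 0.
  by apply: contraNneq ez => p0; rewrite cphi0E p0 mulr0 addr0.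
have aa1 : a * a - 1 != 0 by rewrite aa subr_eq0.
have e1 : cphi 1 z = (a * a - 1) / z.
  by rewrite aa cphi0E addrAC subrr add0r [z * _]mulrC mulfK.
have e2 : cphi 2 z = ((a * a - 1) / z - 1) / z.
  by rewrite -e1 cphi1E addrAC subrr add0r [z * _]mulrC mulfK.
rewrite e2 e1 bE; have aa1' : a ^+ 2 - 1 != 0 by rewrite expr2.
field.
by rewrite z0 a0 -expr2 aa1' ?pnatr_eq0.
Qed.

(** Two solutions of [exp z = 1] in a disc of radius 1/2 coincide. *)
Lemma cexp_neq1_near w : exists2 d : R[i], 0 < d &
  forall z, z != w -> `|z - w| < d -> cexp z != 1.
Proof.
have h0 : (0 : R[i]) < 2^-1 by rewrite invr_gt0 ltr0n.
have [[z1 [z1w z1d e1]]|H] :=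
    pselect (exists z1, [/\ z1 != w, `|z1 - w| < 2^-1 & cexp z1 = 1]).
  have z1w0 : 0 < `|z1 - w| by rewrite normr_gt0 subr_eq0.
  have [t [t0 th _ tz]] := small_positive h0 z1w0 ler01.
  exists t => // z zw zt; apply/eqP => ez.
  have zz1 : z - z1 = 0.
    apply: cexp_eq1_small.
      have -> : z - z1 = (z - w) - (z1 - w) by ring.
      rewrite (le_lt_trans (ler_normB _ _)) //.
      have -> : (1 : R[i]) = 2^-1 + 2^-1 by field.
      by apply: ltrD => //; exact: lt_trans th.
    by rewrite cexpD -[cexp z]mulr1 ez -e1 mulrAC cexpN mul1r.
  move: zt; rewrite (subr0_eq zz1) => /lt_trans/(_ _).
  by rewrite mulr1 in tz; move=> /(_ _ tz); rewrite ltxx.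
exists 2^-1 => // z zw zd; apply/eqP => ez; apply: H; exists z; split => //.
Qed.

End FunctionalCalculus.

(** * Where [coth(A/2)/2 - 1/A] exists *)

Section CdybeFunction.
Context {R : realType}.
Implicit Types (V : vectType R) (p q : {poly R}) (z w : R[i]).

Lemma annihilator_minimal V (A : 'End(V)) : exists q, [/\ q \is monic,
  lfun_horner q A = 0 &
  forall p, p != 0 -> lfun_horner p A = 0 -> (size q <= size p)%N].
Proof.
pose P n := `[< exists q, [/\ q \is monic, lfun_horner q A = 0 & size q = n] >].
have exP : exists n, P n.
  have [q [qm qA]] := annihilator_monic A.
  by exists (size q); apply/asboolP; exists q.
have [n /asboolP[q [qm qA qn]] nmin] := ex_minnP exP.
exists q; split => // p p0 pA; rewrite qn; apply: nmin; apply/asboolP.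
exists ((lead_coef p)^-1 *: p); split.
- by rewrite monicE lead_coefZ mulVf // lead_coef_eq0.
- by apply/lfunP => x; rewrite lfun_hornerZ pA zero_lfunE scaler0.
- by rewrite size_scale // invr_eq0 lead_coef_eq0.
Qed.

(** A common factor [h] of [p] and [q = r h] would give [p(A) r(A) = 0], hence
    [r(A) = 0], against the minimality of [q]. *)
Lemma coprime_minimal V (A : 'End(V)) p q : q \is monic ->
  lfun_horner q A = 0 ->
  (forall s, s != 0 -> lfun_horner s A = 0 -> (size q <= size s)%N) ->
  injective (lfun_horner p A) -> coprimep p q.
Proof.
move=> qm qA qmin pinj; rewrite /coprimep.
pose h := gcdp p q.
have q0 := monic_neq0 qm.
have h0 : h != 0 by rewrite gcdp_eq0 negb_and q0 orbT.
have /dvdpP[s sE] := dvdp_gcdl p q; have /dvdpP[r rE] := dvdp_gcdr p q.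
have rA : lfun_horner r A = 0.
  apply/lfunP => x; rewrite zero_lfunE; apply: pinj; rewrite linear0.
  have hr : h * r = q by rewrite mulrC -rE.
  have -> : lfun_horner p A = (lfun_horner s A \o lfun_horner h A)%VF.
    by apply/lfunP => y; rewrite comp_lfunE -lfun_hornerM -sE.
  by rewrite comp_lfunE -[lfun_horner h A _]lfun_hornerM hr qA zero_lfunE linear0.
have r0 : r != 0 by apply: contraNneq q0 => r0; rewrite rE r0 mul0r.
have := qmin r r0 rA; have -> : size q = (size r + size h).-1.
  by rewrite rE -/h size_mul.
have : (0 < size h)%N by rewrite size_poly_gt0.
case: (size h) => // -[|m] // _; rewrite addnS /= addnS.
by rewrite -ltn_subRL subnn.
Qed.

Lemma cexp_regular_near w : exists2 d : R[i], 0 < d &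
  forall z, z != w -> `|z - w| < d -> z != 0 /\ cexp z != 1.
Proof.
have [d1 d10 D1] := cexp_neq1_near w.
exists d1 => // z zw zd; have ez := D1 z zw zd; split => //.
by apply: contraNneq ez => ->; rewrite /cexp /= expR0 cos0 sin0 mulr1 mulr0.
Qed.

Lemma cphi1_neq0 z : cexp z != 1 -> cphi 1 z != 0.
Proof. by apply: contraNneq => p0; rewrite cphi0E p0 mulr0 addr0. Qed.

Lemma cpoly_half : cpoly ((2^-1)%:P : {poly R}) = (2^-1)%:P.
Proof.
have h : (2^-1 : R)%:C%C = 2^-1 :> R[i].
  by rewrite (fmorphV (real_complex R)) rmorph_nat.
by rewrite /cpoly map_polyC /= h.
Qed.

Lemma inv_lfunK V (A : 'End(V)) : injective A -> forall x, (A^-1)%VF (A x) = x.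
Proof. by move=> /lker0P A0 x; rewrite lker0_lfunK. Qed.

Lemma inv_lfunVK V (A : 'End(V)) : injective A -> forall x, A ((A^-1)%VF x) = x.
Proof. by move=> /lker0P A0 x; rewrite lker0_lfunVK. Qed.

(** Let [p_1], [p_2] interpolate [phi_1], [phi_2] modulo the minimal
    polynomial [q], and [u p_1 + v q = 1]. Then [1/2 - p_2 u] interpolates
    [1/2 - phi_2 / phi_1]: near a root of [q] the product [u phi_1] is close
    to 1, so that [1 / phi_1] stays bounded. *)
Lemma is_fun_of_f_cdybe V (A : 'End(V)) : injective (phi 1 A) ->
  is_fun_of f_cdybe A (2^-1 *: \1 - (phi 2 A \o (phi 1 A)^-1))%VF.
Proof.
move=> inj1; have [q [qm qA qmin]] := annihilator_minimal A.
have [p1 [p1A b1]] := phi_interpolation_near 1 qm.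
have [p2 [p2A b2]] := phi_interpolation_near 2 qm.
have p1inj : injective (lfun_horner p1 A) by rewrite p1A.
have /Bezout_eq1_coprimepP[[u v] /= uv] := coprime_minimal qm qA qmin p1inj.
exists ((2^-1)%:P - p2 * u), q; split=> //; first exact: monic_neq0.
  apply/lfunP => x; rewrite lfun_hornerB lfun_hornerC lfun_hornerM p2A //.
  rewrite add_lfunE scale_lfunE id_lfunE opp_lfunE comp_lfunE.
  congr (_ - phi 2 A _). apply: (inj1); rewrite (inv_lfunVK inj1).
  rewrite -p1A // -lfun_hornerM mulrC; have := congr1 (fun s => lfun_horner s A x) uv.
  rewrite /= lfun_hornerD [lfun_horner (v * q) A x]lfun_hornerM qA zero_lfunE.
  by rewrite linear0 addr0 => ->; rewrite -polyC1 lfun_hornerC scale1r.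
move=> w qw.
have [M1 M10 {}b1] := b1 w; have [M2 M20 {}b2] := b2 w.
have [U U0 bu] := poly_bounded_near (cpoly u) w.
have [W W0 bv] := poly_bounded_near (cpoly v) w.
have [P P0 bp] := poly_bounded_near (cpoly p2) w.
have [L L0 lq] := poly_lipschitz (cpoly q) w.
have [d1 d10 D1] := cexp_regular_near w.
pose K := M1 * U + W.
have K0 : 0 <= K by rewrite addr_ge0 // mulr_ge0.
have h0 : (0 : R[i]) < 2^-1 by rewrite invr_gt0 ltr0n.
have [t [t0 td t1 tK]] := small_positive d10 h0 (mulr_ge0 K0 L0).
exists ((P * K + M2) * (2 * U)), t; split => // z zw zt.
have z1 := lt_trans zt t1.
have [z0 ez] := D1 z zw (lt_trans zt td).
rewrite f_cdybeE //; set psi := cphi 1 z; set chi := cphi 2 z.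
have psi0 : psi != 0 by exact: cphi1_neq0.
have {}b1 := b1 z z1; have {}b2 := b2 z z1; have {}bu := bu z z1.
have {}bv := bv z z1; have {}bp := bp z z1; have {}lq := lq z z1.
rewrite (eqP qw) subr0 in lq.
have uv1 : (cpoly u).[z] * (cpoly p1).[z] + (cpoly v).[z] * (cpoly q).[z] = 1.
  by rewrite -!hornerM -hornerD -!cpolyM -cpolyD uv /cpoly rmorph1 hornerC.
rewrite -/psi -/chi in b1 b2.
have cE : (cpoly ((2^-1)%:P - p2 * u)).[z] = 2^-1 - (cpoly p2).[z] * (cpoly u).[z].
  by rewrite cpolyB cpolyM cpoly_half !hornerE.
rewrite cE; move: b1 b2 bu bv bp lq uv1.
move: (cpoly p1).[z] (cpoly p2).[z] (cpoly u).[z] (cpoly v).[z] (cpoly q).[z].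
move=> a1 a2 uz vz qz b1 b2 bu bv bp lq uv1.
have near1 : `|psi * uz - 1| <= K * `|qz|.
  have -> : psi * uz - 1 = (psi - a1) * uz - vz * qz by rewrite -uv1; ring.
  rewrite (le_trans (ler_normB _ _)) // !normrM mulrDl lerD //.
    by rewrite mulrAC; apply: ler_pM => //; rewrite mulr_ge0.
  by rewrite ler_wpM2r.
have big : 2^-1 <= `|psi| * U.
  have l1 : `|psi * uz - 1| <= 2^-1.
    rewrite (le_trans near1) //; apply: (@le_trans _ _ (K * (L * `|z - w|))).
      by rewrite ler_wpM2l.
    by rewrite mulrA mulrC (le_trans _ (ltW tK)) // ler_wpM2r ?mulr_ge0 // ltW.
  have : 1 - `|psi * uz| <= 2^-1.
    by have := lerB_dist 1 (psi * uz); rewrite normr1 distrC => /le_trans; apply.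
  rewrite lerBlDr -lerBlDl (_ : 1 - 2^-1 = 2^-1 :> R[i]); last by field.
  by move=> /le_trans; apply; rewrite normrM ler_wpM2l.
have inv_psi : `|psi|^-1 <= 2 * U.
  have n0 : 0 < `|psi| by rewrite normr_gt0.
  rewrite -[X in X <= _]mul1r ler_pdivrMr //.
  rewrite -[X in X <= _](_ : 2 * 2^-1 = 1); last by field.
  by rewrite -mulrA ler_pM2l ?ltr0n // mulrC.
have -> : 2^-1 - chi / psi - (2^-1 - a2 * uz) =
   (a2 * (psi * uz - 1) - (chi - a2)) / psi by field.
rewrite normrM normfV [X in _ <= X]mulrAC; apply: ler_pM => //.
rewrite mulrDl (le_trans (ler_normB _ _)) // lerD //.
by rewrite normrM -mulrA; apply: ler_pM.
Qed.

(** If [p] interpolates [f], then [p_1 (1/2 - p) = p_2] modulo an annihilating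
    polynomial. So [phi_1(A) v = 0] forces [phi_2(A) v = 0], and
    [v = phi_1(A) v - A phi_2(A) v = 0]. *)
Lemma fun_of_f_cdybe_defined V (A : 'End(V)) :
  fun_of_defined f_cdybe A <-> injective (phi 1 A).
Proof.
split=> [[T [p [q [q0 qA _ dom]]]]|inj1]; last first.
  by eexists; exact: is_fun_of_f_cdybe.
pose qm := (lead_coef q)^-1 *: q.
have lq0 : (lead_coef q)^-1 != 0 by rewrite invr_eq0 lead_coef_eq0.
have qmm : qm \is monic by rewrite monicE lead_coefZ mulVf // lead_coef_eq0.
have qmA : lfun_horner qm A = 0.
  by apply/lfunP => x; rewrite lfun_hornerZ qA zero_lfunE scaler0.
have [p1 [p1A b1]] := phi_interpolation_near 1 qmm.
have [p2 [p2A b2]] := phi_interpolation_near 2 qmm.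
have dv : qm %| p1 * ((2^-1)%:P - p) - p2.
  rewrite -(dvdp_map (real_complex R)); apply: dominated_dvdp.
    by rewrite map_poly_eq0 monic_neq0.
  move=> w qmw; have qw : root (cpoly q) w.
    by move: qmw; rewrite -/(cpoly qm) cpolyZ rootZ ?fmorph_eq0.
  have {dom}[C [d [d0 dom]]] := dom w qw.
  have [M1 M10 {}b1] := b1 w; have [M2 M20 {}b2] := b2 w.
  have [P P0 bp] := poly_bounded_near (cpoly p1) w.
  have [U U0 bu] := poly_bounded_near (cpoly ((2^-1)%:P - p)) w.
  have [d1 d10 D1] := cexp_regular_near w.
  have [t [t0 td t1 td1]] := small_positive d0 d10 ler01; rewrite mulr1 in td1.
  have [B B0 bq] := poly_bounded_near (cpoly qm) w.
  have lE z : `|(cpoly q).[z]| = `|(lead_coef q)%:C%C| * `|(cpoly qm).[z]|.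
    rewrite -normrM -hornerZ -cpolyZ scalerA mulfV ?scale1r //.
    by rewrite lead_coef_eq0.
  pose K := `|C| * `|(lead_coef q)%:C%C|.
  have K0 : 0 <= K by rewrite mulr_ge0.
  exists (M1 * U + (P + M1 * B) * K + M2), t; split => // z zw zt.
  have z1 := lt_trans zt t1; have [z0 ez] := D1 z zw (lt_trans zt td1).
  have {b1} := b1 z z1; have {b2} := b2 z z1; have {bp} := bp z z1.
  have {bq} := bq z z1; have {bu} := bu z z1.
  have fp : `|f_cdybe z - (cpoly p).[z]| <= K * `|(cpoly qm).[z]|.
    have le := dom z zw (lt_trans zt td); apply: (le_trans le).
    rewrite -(@ger0_norm _ (C * _)); last exact: le_trans (normr_ge0 _) le.
    by rewrite normrM normr_id lE mulrA.
  rewrite -/(cpoly (_ - p2)) -/(cpoly qm).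
  have -> : cpoly (p1 * ((2^-1)%:P - p) - p2) =
      cpoly p1 * cpoly ((2^-1)%:P - p) - cpoly p2 by rewrite cpolyB cpolyM.
  rewrite hornerD hornerM hornerN cpolyB cpoly_half hornerD hornerN hornerC.
  move: fp; rewrite f_cdybeE //; have := cphi1_neq0 ez.
  move: (cphi 1 z) (cphi 2 z) (cpoly p1).[z] (cpoly p2).[z] (cpoly p).[z].
  move: (cpoly qm).[z] => Q psi chi a1 a2 a psi0 fp bu bq bp b2 b1.
  have -> : a1 * (2^-1 - a) - a2 =
    - ((psi - a1) * (2^-1 - a)) + psi * (2^-1 - chi / psi - a) + (chi - a2).
    by field.
  rewrite (le_trans (ler_normD _ _)) // [X in _ <= X]mulrDl lerD //.
  rewrite (le_trans (ler_normD _ _)) // [X in _ <= X]mulrDl normrN !normrM lerD //.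
    by rewrite mulrAC; apply: ler_pM.
  rewrite -mulrA; apply: ler_pM => //.
  rewrite -[psi](subrK a1) addrC (le_trans (ler_normD _ _)) // lerD //.
  by rewrite (le_trans b1) // ler_wpM2l.
(* Divisibility by [qm] becomes equality at [A]. *)
have eA x : lfun_horner p1 A (lfun_horner ((2^-1)%:P - p) A x) = lfun_horner p2 A x.
  apply/eqP; rewrite -subr_eq0 -lfun_hornerM -lfun_hornerB.
  by rewrite (lfun_horner_dvd dv qmA) zero_lfunE.
move=> x y /eqP; rewrite -subr_eq0 -lfun_morphB => /eqP xy.
apply/eqP; rewrite -subr_eq0; apply/eqP; move: xy; set v := x - y => v0.
have v2 : phi 2 A v = 0.
  rewrite -p2A // -eA -lfun_hornerM mulrC lfun_hornerM p1A // v0.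
  exact: linear0.
by have := phi1E A v; rewrite v0 v2 linear0 addr0.
Qed.

Lemma fun_of_f_cdybe V (A : 'End(V)) : injective (phi 1 A) ->
  fun_of f_cdybe A = (2^-1 *: \1 - (phi 2 A \o (phi 1 A)^-1))%VF.
Proof. by move=> inj1; apply: fun_ofE; exact: is_fun_of_f_cdybe. Qed.

Lemma lfun_horner_scale V (A : 'End(V)) p (a : R) x :
  lfun_horner (p \Po (a *: 'X)) A x = lfun_horner p (a *: A) x.
Proof.
elim/poly_ind: p x => [|p c IH] x.
  by rewrite comp_poly0 -polyC0 !lfun_hornerC.
rewrite comp_polyD comp_polyM comp_polyX comp_polyC !lfun_hornerD !lfun_hornerC.
congr (_ + _); rewrite lfun_hornerMX scale_lfunE -IH -scalerAr.
by rewrite lfun_hornerZ lfun_hornerMX.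
Qed.

(** If [phi_1(t A)] is singular, its interpolating polynomial has a complex
    root in common with the annihilating polynomial of [t A]; at that root the
    interpolating polynomial takes the value of [phi_1]. *)
Lemma phi1_singular_root V (A : 'End(V)) q (t : R) : q \is monic ->
  lfun_horner q A = 0 -> t != 0 -> ~ injective (phi 1 (t *: A)) ->
  exists w, root (cpoly q) w /\ cphi 1 (t%:C%C * w) = 0.
Proof.
move=> qm qA t0 ninj; pose q1 := q \Po (t^-1 *: 'X).
have q10 : q1 != 0.
  rewrite -size_poly_eq0 size_comp_poly2 ?size_poly_eq0 ?monic_neq0 //.
  by rewrite size_scale ?invr_eq0 // size_polyX.
have q1A : lfun_horner q1 (t *: A) = 0.
  apply/lfunP => x; rewrite lfun_horner_scale scalerA mulVf // scale1r.
  by rewrite qA.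
pose qt := (lead_coef q1)^-1 *: q1.
have lq0 : (lead_coef q1)^-1 != 0 by rewrite invr_eq0 lead_coef_eq0.
have qtm : qt \is monic by rewrite monicE lead_coefZ mulVf // lead_coef_eq0.
have qtA : lfun_horner qt (t *: A) = 0.
  by apply/lfunP => x; rewrite lfun_hornerZ q1A zero_lfunE scaler0.
have [p [pA b]] := phi_interpolation_near 1 qtm.
have ncop : ~~ coprimep p qt.
  apply/negP => /Bezout_eq1_coprimepP[[u v] /= uv]; apply: ninj => x y /eqP.
  rewrite -subr_eq0 -lfun_morphB => /eqP xy.
  apply/eqP; rewrite -subr_eq0; apply/eqP; move: xy; set s := x - y => s0.
  have := congr1 (fun r => lfun_horner r (t *: A) s) uv.
  rewrite /= lfun_hornerD !lfun_hornerM qtA zero_lfunE linear0 addr0.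
  by rewrite pA // s0 linear0 -polyC1 lfun_hornerC scale1r.
have : size (cpoly (gcdp p qt)) != 1%N by rewrite size_map_poly.
move=> /closed_rootP[w gw].
have pw := root_cpoly_dvd (dvdp_gcdl p qt) gw.
have qw := root_cpoly_dvd (dvdp_gcdr p qt) gw.
have tC0 : t%:C%C != 0 :> R[i] by rewrite fmorph_eq0.
exists (t^-1%:C%C * w); split.
  move: qw; rewrite cpolyZ rootZ ?fmorph_eq0 // /q1 /cpoly map_comp_poly.
  by rewrite map_polyZ map_polyX !rootE horner_comp hornerZ hornerX.
rewrite mulrA -rmorphM mulfV // rmorph1 mul1r.
have [M M0 {}b] := b w; have := b w; rewrite subrr normr0 ltr01 => /(_ isT).
by rewrite (eqP pw) (eqP qw) normr0 mulr0 subr0 normr_le0 => /eqP.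
Qed.

(** Two solutions [t] of [exp ((1 + t) w) = 1] are at distance at least
    [1 / |w|]. *)
Lemma cexp_real_line w : w != 0 ->
  \forall t \near (0 : R)^', cexp ((1 + t)%:C%C * w) != 1.
Proof.
move=> w0; have [rho wrho] := norm_complexE w.
have rho0 : 0 < rho by rewrite -ltcR -wrho normr_gt0.
have inj s t : `|s - t| < rho^-1 -> cexp ((1 + s)%:C%C * w) = 1 ->
    cexp ((1 + t)%:C%C * w) = 1 -> s = t.
  move=> st es et.
  have dw : (s - t)%:C%C * w = 0.
    apply: cexp_eq1_small.
      rewrite normrM wrho normc_def /= expr0n /= addr0 sqrtr_sqr.
      by rewrite -rmorphM ltcR -ltr_pdivlMr // mul1r.
    have -> : (s - t)%:C%C * w = (1 + s)%:C%C * w + - ((1 + t)%:C%C * w).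
      by rewrite -mulrBl -rmorphB; congr (_%:C%C * _); ring.
    by rewrite cexpD es -et cexpN.
  move/eqP: dw; rewrite mulf_eq0 (negPf w0) orbF fmorph_eq0 subr_eq0.
  by move/eqP.
have r2 : 0 < rho^-1 / 2 by rewrite divr_gt0 ?invr_gt0.
have n2 : \forall t \near (0 : R)^', `|t| < rho^-1 / 2 by exact: dnbhs0_lt.
have n0 : \forall t \near (0 : R)^', t != 0 by exact: nbhs_dnbhs_neq.
have [[t1 [t10 t1r e1]]|H] := pselect (exists t1 : R, [/\ t1 != 0,
    `|t1| < rho^-1 / 2 & cexp ((1 + t1)%:C%C * w) = 1]).
  have n1 : \forall t \near (0 : R)^', `|t| < `|t1|.
    by apply: dnbhs0_lt; rewrite normr_gt0.
  apply: filterS2 n2 n1 => t tr tt1; apply/eqP => et.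
  have tt : t = t1.
    apply: inj => //; rewrite (le_lt_trans (ler_normB _ _)) //.
    by rewrite [rho^-1]splitr ltrD.
  by rewrite tt ltxx in tt1.
by apply: filterS2 n2 n0 => t tr t0; apply/eqP => et; apply: H; exists t.
Qed.

(** If [phi_1((1 + t) A)] is singular, then [exp ((1 + t) w) = 1] for one of
    the finitely many roots [w] of an annihilating polynomial, and [w] is
    nonzero because [phi_1(0) = 1]. *)
Lemma phi1_injective_near V (A : 'End(V)) :
  \forall t \near (0 : R)^', injective (phi 1 ((1 + t) *: A)).
Proof.
have [q [qm qA]] := annihilator_monic A.
have [rs rsE] := closed_field_poly_normal (cpoly q).
have : \forall t \near (0 : R)^', forall w, w \in rs -> w != 0 ->
    cexp ((1 + t)%:C%C * w) != 1.
  elim: (rs) => [|w s IH]; first by apply: nearW.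
  have [->|w0] := eqVneq w 0.
    apply: filterS IH => t IH w'; rewrite inE => /orP[/eqP->|/IH//].
    by rewrite eqxx.
  apply: filterS2 IH (cexp_real_line w0) => t IH wt w'.
  by rewrite inE => /orP[/eqP->|/IH].
have tn1 : \forall t \near (0 : R)^', `|t| < 1 by exact: dnbhs0_lt.
apply: filterS2 tn1 => t t1 H; apply: contrapT => ninj.
have t0 : 1 + t != 0.
  by apply/eqP => t0; move: t1; rewrite ltr_norml => /andP[]; lra.
have [w [qw e]] := phi1_singular_root qm qA t0 ninj.
have wrs : w \in rs.
  move: qw; rewrite rsE rootZ ?root_prod_XsubC //.
  by rewrite lead_coef_eq0 map_poly_eq0 monic_neq0.
have w0 : w != 0.
  apply/eqP => w0; move: e; rewrite w0 mulr0 cphi1E mul0r addr0 => /eqP.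
  by rewrite oner_eq0.
by have := H w wrs w0; rewrite cphi0E e mulr0 addr0 eqxx.
Qed.

End CdybeFunction.

(** * Open and dense sets of a finite-dimensional space *)

Section OpenDense.
Context {R : realType}.
Implicit Types V W : vectType R.

Definition vnbhs0 V : set_system V :=
  [set S | exists2 d : R, 0 < d & forall v, vnorm v < d -> S v].

Arguments vnbhs0 V : clear implicits.

Global Instance vnbhs0_filter V : Filter (vnbhs0 V).
Proof.
split.
- by exists 1.
- move=> P Q [d d0 dP] [e e0 eQ]; exists (Num.min d e); first by rewrite lt_min d0.
  by move=> v; rewrite lt_min => /andP[vd ve]; split; [exact: dP|exact: eQ].
- by move=> P Q PQ [d d0 dP]; exists d => // v /dP; exact: PQ.
Qed.

Lemma vcvg_vnbhs0 V : vcvg (vnbhs0 V) id 0.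
Proof.
move=> f fL; have [M M0 fM] := scalar_bounded fL.
rewrite (scalar_fun0 fL); apply/cvgrPdist_lt => e e0.
exists (e / (M + 1)); first by rewrite divr_gt0 // ltr_wpDl.
move=> v; rewrite ltr_pdivlMr ?ltr_wpDl // => ve.
rewrite sub0r normrN (le_lt_trans (fM v)) // (le_lt_trans _ ve) //.
by rewrite mulrC ler_wpM2l ?vnorm_ge0 // lerDl.
Qed.

Lemma vopen_vnbhs0 V (D : set V) :
  (forall x, D x -> \forall v \near vnbhs0 V, D (x + v)) -> vopen D.
Proof.
move=> Dn; rewrite /vopen openE => x /= Dx; apply/nbhs_ballP.
have [d d0 dD] := Dn _ Dx; pose n := \dim {:V}.
exists (d / (n.+1)%:R); first by rewrite /= divr_gt0.
move=> y xy /=; rewrite -[of_coords y](subrK (of_coords x)) addrC.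
apply: dD.
have -> : of_coords y - of_coords x = \sum_i (y 0 i - x 0 i) *: (vbasis {:V})`_i.
  by rewrite /of_coords -sumrB; apply: eq_bigr => i _; rewrite scalerBl.
apply: (@le_lt_trans _ _ (\sum_(i < n) d / (n.+1)%:R)).
  apply: le_trans (vnorm_sum _ _) _; apply: ler_sum => i _; rewrite vnormZ.
  apply: (@le_trans _ _ `|y 0 i - x 0 i|).
    by rewrite ler_piMr // vnorm_vbasis.
  by rewrite distrC ltW //; case: xy => _; exact.
rewrite sumr_const card_ord -[X in X < _]mulr_natr mulrAC ltr_pdivrMr ?ltr0n //.
by rewrite ltr_pM2l // ltr_nat.
Qed.

Lemma of_coordsZ V (a : R) (x : 'rV[R]_(\dim {:V})) :
  of_coords (a *: x) = a *: of_coords x :> V.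
Proof.
rewrite /of_coords scaler_sumr; apply: eq_bigr => i _.
by rewrite scalerA mxE.
Qed.

(** From any point of a nonempty open set, a small radial displacement leads
    into [G] without leaving the open set; the dense set [U] then meets the
    intersection of the two. *)
Lemma vdense_radial V (G U D : set V) : vopen G -> vdense U ->
  (forall x, \forall t \near (0 : R)^', G ((1 + t) *: x)) ->
  (forall x, G x -> U x -> D x) -> vdense D.
Proof.
move=> Go Ud Gr GUD O O0 Oo; have [x Ox] := O0.
have tO : \forall t \near (0 : R)^', O ((1 + t) *: x).
  have c : (1 + t) *: x @[t --> (0 : R)^'] --> x.
    have one : 1 + t @[t --> (0 : R)^'] --> (1 + 0 : R).
      by apply: cvgD; [exact: cvg_cst|exact: cvg_id0].
    have := cvgZr_tmp (a := x) one; rewrite addr0 scale1r; apply.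
  by apply: c; exact: open_nbhs_nbhs.
have [t [Ot Gt]] : exists t : R, O ((1 + t) *: x) /\ G ((1 + t) *: of_coords x).
  have : \forall t \near (0 : R)^', O ((1 + t) *: x) /\ G ((1 + t) *: of_coords x).
    by apply: filterS2 tO (Gr (of_coords x)).
  by move=> /filter_ex.
have [|y [[Oy Gy] Uy]] := Ud (O `&` (of_coords @^-1` G)) _ (openI Oo Go).
  by exists ((1 + t) *: x); split => //=; rewrite of_coordsZ.
by exists y; split => //=; exact: GUD.
Qed.

(** * Inverses of operators close to an injective one *)

(** Write [x = L^-1 (T x - (T - L) x)] and absorb the second term. *)
Lemma vnorm_inv V (L T : 'End(V)) x : injective L ->
  opnorm (L^-1)%VF * opnorm (T - L) <= 2^-1 ->
  vnorm x <= 2 * opnorm (L^-1)%VF * vnorm (T x).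
Proof.
move=> Li TL; set K := opnorm _ in TL *.
have K0 : 0 <= K by exact: opnorm_ge0.
have : vnorm x <= K * (vnorm (T x) + opnorm (T - L) * vnorm x).
  rewrite -{1}[x](inv_lfunK Li) (le_trans (opnormP _ _)) // ler_wpM2l //.
  have -> : L x = T x - (T - L) x by rewrite add_lfunE opp_lfunE subKr.
  by rewrite (le_trans (vnormB _ _)) // lerD2l opnormP.
rewrite mulrDr mulrA => h.
have := ler_wpM2r (vnorm_ge0 x) TL; move: h.
move: (vnorm x) (vnorm (T x)) (K * opnorm _) => a b c h1 h2.
have : a <= K * b + 2^-1 * a by rewrite (le_trans h1) // lerD2l.
by rewrite -mulrA; move: (K * b) => s; lra.
Qed.

Section Limits.
Context {T : Type} {F : set_system T} {FF : Filter F}.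

Lemma opnorm_inv_near V (A : T -> 'End(V)) (L : 'End(V)) :
  (forall v, vcvg F (fun t => A t v) (L v)) ->
  \forall t \near F, opnorm (L^-1)%VF * opnorm (A t - L) <= 2^-1.
Proof.
move=> AL.
have A0 : opnorm (A t - L) @[t --> F] --> 0 by exact: opnorm_cvg.
have K0 : 0 < opnorm (L^-1)%VF + 1 by rewrite ltr_wpDl ?opnorm_ge0.
have e0 : 0 < (2 * (opnorm (L^-1)%VF + 1))^-1 by rewrite invr_gt0 mulr_gt0.
have A1 : \forall t \near F, opnorm (A t - L) < (2 * (opnorm (L^-1)%VF + 1))^-1.
  exact: cvgr_lt A0 _ e0.
apply: filterS A1 => t /ltW At.
have [K1 K2] := (opnorm_ge0 (L^-1)%VF, opnorm_ge0 (A t - L)).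
apply: (@le_trans _ _ ((opnorm (L^-1)%VF + 1) * (2 * (opnorm (L^-1)%VF + 1))^-1)).
  by apply: ler_pM => //; rewrite lerDl.
by rewrite invfM mulrCA mulfV ?mulr1 // gt_eqF.
Qed.

Lemma injective_near V (A : T -> 'End(V)) (L : 'End(V)) : injective L ->
  (forall v, vcvg F (fun t => A t v) (L v)) ->
  \forall t \near F, injective (A t).
Proof.
move=> Li AL; apply: filterS (opnorm_inv_near AL) => t At x y /eqP.
rewrite -subr_eq0 -lfun_morphB => /eqP xy.
apply/eqP; rewrite -subr_eq0; apply/eqP; apply: vnorm_eq0; apply/eqP.
rewrite eq_le vnorm_ge0 andbT (le_trans (vnorm_inv _ Li At)) //.
by rewrite xy vnorm0 mulr0.
Qed.

Lemma vcvg_inv V (A : T -> 'End(V)) (L : 'End(V)) : injective L ->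
  (forall v, vcvg F (fun t => A t v) (L v)) ->
  forall y, vcvg F (fun t => (A t)^-1%VF y) (L^-1%VF y).
Proof.
move=> Li AL y; set x := L^-1%VF y.
apply: (@vcvg_squeeze _ _ _ _ _ _ _
  (fun t => 2 * opnorm (L^-1)%VF * vnorm (A t x - L x))).
  apply: filterS2 (opnorm_inv_near AL) (injective_near Li AL) => t At Ai.
  apply: le_trans (vnorm_inv _ Li At) _.
  by rewrite lfun_morphB inv_lfunVK // -[y](inv_lfunVK Li) -/x -vnormN opprB.
have d0 : vcvg F (fun t => A t x - L x) (L x - L x).
  by apply: vcvgB; [exact: AL|exact: vcvg_cst].
have := cvgMl_tmp (a := 2 * opnorm (L^-1)%VF) (vcvg_vnorm d0).
by rewrite subrr vnorm0 mulr0; apply.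
Qed.

End Limits.

(** The difference of two inverses is
    [A(h)^-1 - A^-1 = - A(h)^-1 (A(h) - A) A^-1]. *)
Lemma vderive_inv V (A : R -> 'End(V)) (A' : 'End(V)) t : injective (A t) ->
  (forall x, vderive (fun s => A s x) t (A' x)) ->
  forall y, vderive (fun s => (A s)^-1%VF y) t
    (- ((A t)^-1%VF (A' ((A t)^-1%VF y)))).
Proof.
move=> Ai AA' y; set x := (A t)^-1%VF y.
have Ac v : vcvg (0 : R)^' (fun h => A (h + t) v) (A t v).
  exact: vderive_cvg (AA' v).
have c1 : vcvg (0 : R)^' (fun h => ((A (h + t))^-1)%VF
    (h^-1 *: (A (h + t) x - A t x))) ((A t)^-1%VF (A' x)).
  apply: (@vcvg_app _ _ _ _ _ _ (fun h => (A (h + t))^-1%VF)).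
    by move=> v; apply: vcvg_inv.
  exact: AA'.
apply: vcvg_ext (vcvgN c1).
apply: filterS (injective_near Ai Ac) => h hi.
rewrite lfun_morphZ lfun_morphB inv_lfunK // /x inv_lfunVK //.
by rewrite -scalerN opprB.
Qed.

End OpenDense.
Arguments vnbhs0 {R} V _.

(** * Operators as tensors *)

Section Tensors.
Context {R : realType} {g : vectType R}.
Variables (br : g -> g -> g) (Q : g -> R).
Hypothesis HQ : is_quadratic_form Q.

Local Notation b := (polar Q).

Lemma polar_sym x y : b x y = b y x.
Proof. by rewrite /polar [x + y]addrC addrAC. Qed.

Lemma polar_scalarr x : scalar (b x).
Proof. exact: quad_polar_linearr. Qed.

Lemma polar_scalarl y : scalar (b^~ y).
Proof. exact: quad_polar_linearl. Qed.

Section DualBases.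
Variables (S : {vspace g}) (d : nat) (s s' : d.-tuple g).
Hypothesis ss' : dual_bases Q S s s'.
Hypothesis S_nondeg : nondegenerate_on Q S.

Lemma dual_expand y : y \in S -> y = \sum_(i < d) b y s'`_i *: s`_i.
Proof.
case: ss' => sb s'S ds yS; have yE := coord_basis sb yS.
rewrite {1}yE; apply: eq_bigr => j _; congr (_ *: _).
rewrite {2}yE (scalar_sum _ _ _ (polar_scalarl _)) (bigD1 j) //= ds eqxx mulr1.
by rewrite big1 ?addr0 // => i ij; rewrite ds (negPf ij) mulr0.
Qed.

Lemma dual_mem (i : 'I_d) : s`_i \in S.
Proof.
case: ss' => sb _ _; apply: (basis_mem sb); apply: mem_nth.
by rewrite size_tuple.
Qed.

Lemma dual_expand' y : y \in S -> y = \sum_(i < d) b y s`_i *: s'`_i.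
Proof.
case: ss' => sb s'S ds yS; apply/eqP; rewrite -subr_eq0; apply/eqP.
have zS : \sum_(i < d) b y s`_i *: s'`_i \in S.
  by apply: rpred_sum => i _; apply: rpredZ.
apply: S_nondeg; first exact: rpredB.
move=> w wS; rewrite (scalar_funB (polar_scalarl _)).
rewrite (scalar_sum _ _ _ (polar_scalarl _)) [in X in X - _](dual_expand wS).
rewrite (scalar_sum _ _ _ (polar_scalarr _)) -sumrB big1 // => i _.
by rewrite mulrC [b s'`_i w]polar_sym subrr.
Qed.

(** The orthogonal projection onto [S]. *)
Definition dual_proj x : g := \sum_(i < d) b x s`_i *: s'`_i.

Lemma dual_proj_mem x : dual_proj x \in S.
Proof. by case: ss' => _ s'S _; apply: rpred_sum => i _; apply: rpredZ. Qed.

Lemma dual_projE x y : y \in S -> b (dual_proj x) y = b x y.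
Proof.
move=> yS; rewrite (scalar_sum _ _ _ (polar_scalarl _)).
rewrite [in RHS](dual_expand yS) (scalar_sum _ _ _ (polar_scalarr _)).
by apply: eq_bigr => i _; rewrite mulrC polar_sym.
Qed.

Lemma dual_proj_id x : x \in S -> dual_proj x = x.
Proof. by move=> xS; rewrite /dual_proj -dual_expand'. Qed.

(** The sum in [lambda] evaluates to [b x (A y) - b y (A x)], and skewness of
    [A] turns the two terms into equal ones. *)
Lemma lambda_polar (A : 'End(subvs_of S)) (al be : dual g) x y
    (xS yS : subvs_of S) :
  (forall v, al v = b x v) -> (forall v, be v = b y v) ->
  (forall v, v \in S -> b x v = b (vsval xS) v) ->
  (forall v, v \in S -> b y v = b (vsval yS) v) ->
  (forall v w, b (vsval (A v)) (vsval w) = - b (vsval v) (vsval (A w))) ->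
  lambda s s' A al be = - b (vsval (A xS)) (vsval yS).
Proof.
move=> alE beE xE yE Askew; rewrite /lambda /wedge.
have [_ s'S _] := ss'.
pose Ah (v : g) : g := vsval (A (vsproj S v)).
have AhS v : Ah v \in S by exact: subvsP.
have key z w (zS wS : subvs_of S) : (forall v, v \in S -> b z v = b (vsval zS) v) ->
    (forall v, v \in S -> b w v = b (vsval wS) v) ->
    \sum_(i < d) b z (Ah s`_i) * b w s'`_i = b (vsval zS) (vsval (A wS)).
  move=> zE wE; have wexp := dual_expand (subvsP wS).
  have -> : A wS = \sum_(i < d) b (vsval wS) s'`_i *: A (vsproj S s`_i).
    rewrite -[in LHS](vsvalK wS) [in X in vsproj S X]wexp linear_sum linear_sum.
    by apply: eq_bigr => i _; rewrite !linearZ.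
  rewrite [X in b _ X](_ : _ = \sum_(i < d) b (vsval wS) s'`_i *: Ah s`_i); last first.
    by rewrite linear_sum; apply: eq_bigr => i _; rewrite linearZ.
  rewrite (scalar_sum _ _ _ (polar_scalarr _)); apply: eq_bigr => i _.
  by rewrite zE // wE // mulrC.
rewrite (eq_bigr (fun i : 'I_d => b x (Ah s`_i) * b y s'`_i -
  b y (Ah s`_i) * b x s'`_i)); last first.
  by move=> i _; rewrite !alE !beE [b x s'`_i * _]mulrC.
rewrite sumrB (key _ _ _ _ xE yE) (key _ _ _ _ yE xE).
have -> : b (vsval xS) (vsval (A yS)) = - b (vsval (A xS)) (vsval yS).
  by rewrite Askew opprK.
rewrite [b (vsval yS) _]polar_sym; lra.
Qed.

End DualBases.

Section FullBases.
Variables (n : nat) (E E' : n.-tuple g).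
Hypothesis EE' : dual_bases Q {:g} E E'.
Hypothesis nondeg : nondegenerate_on Q {:g}.
Hypothesis Hbr : is_lie_bracket br.
Hypothesis Hinv : forall m x y, b (br m x) y = - b x (br m y).

Lemma form_polar (al : dual g) : exists x, forall v, al v = b x v.
Proof.
exists (\sum_(i < n) al E`_i *: E'`_i) => v.
rewrite (scalar_sum _ _ _ (polar_scalarl _)).
rewrite {1}(dual_expand EE' (memvf v)) linear_sum; apply: eq_bigr => i _.
by rewrite linearZ /= mulrC polar_sym.
Qed.

Lemma full_coord (i : 'I_n) v : coord E i v = b v E'`_i.
Proof.
rewrite [in LHS](dual_expand EE' (memvf v)).
by have [Eb _ _] := EE'; rewrite coord_sum_free // (basis_free Eb).
Qed.

Lemma dual_basisE (i : 'I_n) v : dual_basis E i v = b v E'`_i.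
Proof.
by rewrite -full_coord /dual_basis linfunE // => a u w; rewrite linearP.
Qed.

(** Contracting a trilinear expression in the entries of [E] with
    [wedge3 E E E] antisymmetrizes it. *)
Lemma wedge3_sum (F : 'I_n -> 'I_n -> 'I_n -> R) (G : g -> g -> g -> R)
    (al be ga : dual g) x y z :
  (forall v, al v = b x v) -> (forall v, be v = b y v) ->
  (forall v, ga v = b z v) ->
  (forall u v w, G u v w = \sum_(i < n) \sum_(j < n) \sum_(l < n)
     F i j l * (b u E`_i * b v E`_j * b w E`_l)) ->
  \sum_(i < n) \sum_(j < n) \sum_(l < n) F i j l *
     wedge3 E`_i E`_j E`_l al be ga =
  G x y z - G y x z + G y z x - G z y x + G z x y - G x z y.
Proof.
move=> alE beE gaE GE; rewrite !GE.
rewrite -!sumrN -!big_split /=; apply: eq_bigr => i _.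
rewrite -!sumrN -!big_split /=; apply: eq_bigr => j _.
rewrite -!sumrN -!big_split /=; apply: eq_bigr => l _.
rewrite /wedge3 /wedge21 /wedge !alE !beE !gaE; ring.
Qed.

(** The six terms of the antisymmetrization are equal. *)
Lemma ThetaE (al be ga : dual g) x y z :
  (forall v, al v = b x v) -> (forall v, be v = b y v) ->
  (forall v, ga v = b z v) ->
  Theta br Q E E' al be ga = - b (br x y) z.
Proof.
move=> alE beE gaE; rewrite /Theta.
have brr u := lie_linearr Hbr u; have brl u := lie_linearl Hbr u.
have brsum I (r : seq I) (a : I -> R) (v : I -> g) u :
    br u (\sum_(i <- r) a i *: v i) = \sum_(i <- r) a i *: br u (v i).
  by apply: vec_ext => f fL; rewrite (scalar_sum _ _ _ fL)
    (scalar_sum (f := fun w => f (br u w))) // => ? ? ?; rewrite brr fL.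
have brsuml I (r : seq I) (a : I -> R) (v : I -> g) u :
    br (\sum_(i <- r) a i *: v i) u = \sum_(i <- r) a i *: br (v i) u.
  by apply: vec_ext => f fL; rewrite (scalar_sum _ _ _ fL)
    (scalar_sum (f := fun w => f (br w u))) // => ? ? ?; rewrite brl fL.
rewrite (@wedge3_sum _ (fun u v w => b u (br v w)) _ _ _ _ _ _ alE beE gaE).
  have anti u v : br u v = - br v u.
    by apply: br_anti => //; exact: lie_alternating.
  have cyc u v w : b (br u v) w = b (br v w) u.
    exact: (tau_cyc (b := b) brr brl (lie_alternating Hbr) polar_scalarl
      polar_sym Hinv).
  have e u v w : b (br u v) w = - b (br v u) w.
    by rewrite anti (scalar_funN (polar_scalarl _)).
  rewrite ![b _ (br _ _)]polar_sym (e x z y) (e y x z) (e z y x).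
  by rewrite -(cyc y z x) -(cyc x y z); field.
move=> u v w; rewrite [in LHS](dual_expand' EE' nondeg (memvf u)).
rewrite (scalar_sum _ _ _ (polar_scalarl _)); apply: eq_bigr => i _.
rewrite [in LHS](dual_expand' EE' nondeg (memvf v)).
rewrite [in LHS](dual_expand' EE' nondeg (memvf w)) brsuml.
rewrite (scalar_sum _ _ _ (polar_scalarr _)) mulr_sumr; apply: eq_bigr => j _.
rewrite brsum (scalar_sum _ _ _ (polar_scalarr _)) !mulr_sumr.
by apply: eq_bigr => l _; ring.
Qed.

(** Against [wedge3], the sums contract the form [b ([r t, r u], v)]. Its
    antisymmetrization over [x], [y], [z] has six terms, equal in pairs,
    whence the factor 2. *)
Lemma schouten_sqE (w : bivector g) (r : g -> g) (al be ga : dual g) x y z :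
  linear r -> (forall u v, b (r u) v = - b u (r v)) ->
  (forall (a a' : dual g) u v, (forall t, a t = b u t) ->
     (forall t, a' t = b v t) -> w a a' = - b (r u) v) ->
  (forall v, al v = b x v) -> (forall v, be v = b y v) ->
  (forall v, ga v = b z v) ->
  schouten_sq br E w al be ga =
  2 * (b (br (r x) (r y)) z + b (br (r y) (r z)) x + b (br (r z) (r x)) y).
Proof.
move=> rL rskew wE alE beE gaE; rewrite /schouten_sq.
have brr u := lie_linearr Hbr u; have brl u := lie_linearl Hbr u.
have anti u v : br u v = - br v u.
  by apply: br_anti => //; exact: lie_alternating.
pose F (i j l : 'I_n) := \sum_(k < n) \sum_(m < n) bicoord E w i k *
  structure_constant br E k m j * bicoord E w m l.
have wEE (i j : 'I_n) : bicoord E w i j = - b (r E'`_i) E'`_j.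
  by apply: wE => t; rewrite dual_basisE polar_sym.
transitivity (\sum_(i < n) \sum_(j < n) \sum_(l < n) F i j l *
     wedge3 E`_i E`_j E`_l al be ga).
  apply: eq_bigr => i _; apply: eq_bigr => j _; apply: eq_bigr => l _.
  by rewrite /F mulr_suml; apply: eq_bigr => k _; rewrite mulr_suml.
pose G u v t := b (br (r t) (r u)) v.
rewrite (@wedge3_sum _ G _ _ _ _ _ _ alE beE gaE).
  have e u v t : G u v t = - G t v u.
    by rewrite /G anti (scalar_funN (polar_scalarl _)).
  rewrite (e y x z) (e z y x) (e x z y) /G; ring.
have rexp u : r u = \sum_(k < n) b (r u) E'`_k *: E`_k.
  exact: (dual_expand EE' (memvf _)).
have uexp u (f : g -> R) : scalar f -> f u = \sum_(i < n) b u E`_i * f E'`_i.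
  by move=> fL; rewrite {1}(dual_expand' EE' nondeg (memvf u)) scalar_sum.
have rs v : scalar (fun u => b (r u) v).
  by move=> a u t; rewrite rL polar_scalarl.
move=> u v t.
transitivity (\sum_(i < n) \sum_(j < n) \sum_(l < n) \sum_(k < n) \sum_(m < n)
   (b u E`_i * b (r E'`_i) E'`_k) * (b (br E`_m E`_k) E'`_j * b v E`_j) *
   (b t E`_l * b (r E'`_l) E'`_m)).
  rewrite /G (uexp u (fun u => b (br (r t) (r u)) v)); last first.
    by move=> a u1 u2; rewrite rL brr polar_scalarl.
  apply: eq_bigr => i _.
  rewrite (uexp v (fun v => b (br (r t) (r E'`_i)) v)); last exact: polar_scalarr.
  rewrite mulr_sumr; apply: eq_bigr => j _.
  rewrite (uexp t (fun t => b (br (r t) (r E'`_i)) E'`_j)); last first.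
    by move=> a u1 u2; rewrite rL brl polar_scalarl.
  rewrite !mulr_sumr; apply: eq_bigr => l _.
  rewrite [in LHS](rexp E'`_i).
  rewrite (scalar_sum (f := fun s => b (br (r E'`_l) s) E'`_j)); last first.
    by move=> a u1 u2; rewrite brr polar_scalarl.
  rewrite !mulr_sumr; apply: eq_bigr => k _.
  rewrite [in LHS](rexp E'`_l).
  rewrite (scalar_sum (f := fun s => b (br s E`_k) E'`_j)); last first.
    by move=> a u1 u2; rewrite brl polar_scalarl.
  rewrite !mulr_sumr; apply: eq_bigr => m _. ring.
apply: eq_bigr => i _; apply: eq_bigr => j _; apply: eq_bigr => l _.
rewrite /F mulr_suml; apply: eq_bigr => k _; rewrite mulr_suml.
apply: eq_bigr => m _; rewrite !wEE /structure_constant full_coord.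
rewrite (anti E`_k) (scalar_funN (polar_scalarl _)).
rewrite (rskew E'`_m) [b E'`_m _]polar_sym; ring.
Qed.

End FullBases.

End Tensors.

(** * Modified Yang-Baxter equation of a Cayley transform *)

Section Cayley.
Context {R : realType} {g : vectType R}.
Variables (br : g -> g -> g) (b : g -> g -> R).
Hypothesis brr : forall x, linear (br x).
Hypothesis brl : forall y, linear (br^~ y).
Hypothesis br_alt : forall x, br x x = 0.
Hypothesis b_scalarr : forall x, scalar (b x).
Hypothesis b_scalarl : forall y, scalar (b^~ y).
Hypothesis b_sym : forall x y, b x y = b y x.
Hypothesis b_inv : forall m x y, b (br m x) y = - b x (br m y).

Local Notation t := (tau br b).

(** The Yang-Baxter expression with coupling 1/4 of a skew operator, without
    the derivative term. *)
Definition cybe4 (r : g -> g) x y z :=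
  t (r x) (r y) z + t (r y) (r z) x + t (r z) (r x) y + 4^-1 * t x y z.

Let t_cyc x y z : t x y z = t y z x.
Proof. exact: tau_cyc. Qed.

Let t1 y z := tau_scalar1 brl b_scalarl y z.
Let t2 x z := tau_scalar2 brr b_scalarl x z.
Let t3 x y : scalar (t x y) := b_scalarr _.

Lemma cybe4_cyc (r : g -> g) x y z : cybe4 r x y z = cybe4 r y z x.
Proof. by rewrite /cybe4 (t_cyc x y z); ring. Qed.

Lemma cybe4E (r : g -> g) x y z : cybe4 r x y z =
  t (r x) (r y) z + t x (r y) (r z) + t (r x) y (r z) + 4^-1 * t x y z.
Proof. by rewrite /cybe4 -(t_cyc x (r y)) (t_cyc (r z)). Qed.

Variable C : 'End(g).
Hypothesis C_br : forall x y, C (br x y) = br (C x) (C y).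
Hypothesis C_b : forall x y, b (C x) (C y) = b x y.

Lemma tau_auto x y z : t (C x) (C y) (C z) = t x y z.
Proof. by rewrite /tau -C_br C_b. Qed.

(** After expansion all terms cancel except multiples of
    [t (C x) (C y) (C z) - t x y z], which is zero for an isometric
    automorphism. *)
Lemma cybe4_cayley (r : g -> g) x y z :
  r (C x - x) = 2^-1 *: (C x + x) -> r (C y - y) = 2^-1 *: (C y + y) ->
  r (C z - z) = 2^-1 *: (C z + z) ->
  cybe4 r (C x - x) (C y - y) (C z - z) = 0.
Proof.
move=> rx ry rz; have rel := tau_auto x y z.
rewrite cybe4E rx ry rz.
rewrite !(scalar_funB (t1 _ _), scalar_funD (t1 _ _), scalar_funZ (t1 _ _),
  scalar_funB (t2 _ _), scalar_funD (t2 _ _), scalar_funZ (t2 _ _),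
  scalar_funB (t3 _ _), scalar_funD (t3 _ _), scalar_funZ (t3 _ _)).
lra.
Qed.

Variable A : 'End(g).

(** The identity [(exp(-A) + 1)/2 + (exp(-A) - 1) f(A) = phi_1(-A)] of
    functions of [A], applied to [phi_1(A) z], for
    [f = 1/2 - phi_2 / phi_1]. *)
Lemma cayley_phi z :
  2^-1 *: phi 0 (- A) (phi 1 A z) + 2^-1 *: phi 1 A z +
  phi 0 (- A) (2^-1 *: phi 1 A z - phi 2 A z) - (2^-1 *: phi 1 A z - phi 2 A z)
  = phi 1 (- A) (phi 1 A z).
Proof.
have -> : phi 1 (- A) (phi 1 A z) =
    phi 0 (- A) (phi 1 A z) + (phi 2 A z - phi 0 (- A) (phi 2 A z)).
  rewrite [in LHS](phi1E A z) lfun_morphD phi1N phiNX; congr (_ + _).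
  by rewrite (phi0E (- A)) opp_lfunE opprD opprK addrA subrr add0r.
rewrite lfun_morphB lfun_morphZ; apply: vec_ext => f fL.
rewrite !(scalar_funB fL, scalar_funD fL, scalar_funZ fL); lra.
Qed.

(** Mixed components: [z] lies in the subspace on which [r] is
    [coth(A/2)/2 - 1/A] and [C] is [exp A], while the other two vectors are in
    the domain of the Cayley transform. *)
Lemma cybe4_mixed (r : g -> g) x y z z' :
  r (C x - x) = 2^-1 *: (C x + x) -> r (C y - y) = 2^-1 *: (C y + y) ->
  z = phi 1 A z' -> r z = 2^-1 *: phi 1 A z' - phi 2 A z' ->
  C (phi 0 (- A) z) = z -> C (phi 0 (- A) (r z)) = r z ->
  cybe4 r (C x - x) (C y - y) z = t x y (phi 1 (- A) z).
Proof.
move=> rx ry zE rz Cz Crz.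
have e1 : t (C x) (C y) z = t x y (phi 0 (- A) z) by rewrite -[RHS]tau_auto Cz.
have e2 : t (C x) (C y) (r z) = t x y (phi 0 (- A) (r z)).
  by rewrite -[RHS]tau_auto Crz.
have := congr1 (t x y) (cayley_phi z'); rewrite -rz -zE.
rewrite cybe4E rx ry.
rewrite !(scalar_funB (t1 _ _), scalar_funD (t1 _ _), scalar_funZ (t1 _ _),
  scalar_funB (t2 _ _), scalar_funD (t2 _ _), scalar_funZ (t2 _ _),
  scalar_funB (t3 _ _), scalar_funD (t3 _ _), scalar_funZ (t3 _ _)).
move=> <-; rewrite -e1 -e2; lra.
Qed.

(** The derivative of the Cayley transform, [- (C - 1)^-1 dC (C - 1)^-1] up to
    a factor, has matrix elements in which the inverses cancel. *)
Lemma cayley_derivative s x y z :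
  C s - s = C (br z x) -> b s (C y - y) = - t x y z.
Proof.
move=> sE; rewrite (scalar_funB (b_scalarr _)) -(C_b s y).
rewrite -opprB -(scalar_funB (b_scalarl _)) sE C_b.
by rewrite -/(t z x y) t_cyc.
Qed.

End Cayley.

(** * The splitting of [g] into [k] and [p] *)

Section DynamicalYangBaxter.
Context {R : realType} {g : vectType R}.
Variables (br : g -> g -> g) (Q : g -> R) (c : 'End(g)) (k p : {vspace g}).
Variables (dk dp : nat) (e e' : dk.-tuple g) (u u' : dp.-tuple g).
Hypothesis Hg : is_quadratic_lie br Q.
Hypothesis Hc : is_orthogonal_automorphism br Q c.
Hypothesis Hk : is_quadratic_subalgebra br Q k.
Hypothesis Hkc : (k <= fixedSpace c)%VS.
Hypothesis Hp : is_orthogonal_complement Q k p.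
Hypothesis He : dual_bases Q k e e'.
Hypothesis Hu : dual_bases Q p u u'.

Local Notation b := (polar Q).
Let Hbr := qlie_bracket Hg.
Let HQ := qlie_form Hg.
Let b_r := polar_scalarr HQ.
Let b_l := polar_scalarl HQ.
Let b_inv := qlie_invariant Hg.
Let brr := lie_linearr Hbr.
Let brl := lie_linearl Hbr.
Let br_alt := lie_alternating Hbr.
Let br_an := br_anti brr brl br_alt.
Let knd := subalg_nondegenerate Hk.

Lemma restrE (S : {vspace g}) (A : 'End(g)) v :
  restr S A v = vsproj S (A (vsval v)).
Proof. by rewrite linfunE // => a x y; rewrite !linearP. Qed.

Lemma restr_val (S : {vspace g}) (A : 'End(g)) v :
  (forall x, x \in S -> A x \in S) -> vsval (restr S A v) = A (vsval v).
Proof. by move=> AS; rewrite restrE vsprojK // AS // subvsP. Qed.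

Lemma ad_val m x : ad br m x = br m x.
Proof. exact: adE. Qed.

Lemma ad_der m x y : ad br m (br x y) = br (ad br m x) y + br x (ad br m y).
Proof.
rewrite !ad_val; have := lie_jacobi Hbr m x y.
rewrite (br_an y (br m x)) (br_an y m) (brN brr) -addrA -opprD => /eqP.
by rewrite subr_eq0 => /eqP ->; rewrite addrC.
Qed.

Lemma ad_skew m x y : b (ad br m x) y = - b x (ad br m y).
Proof. by rewrite !ad_val b_inv. Qed.

Lemma kp_orth x y : x \in k -> y \in p -> b x y = 0.
Proof. by move=> xk /Hp yp; rewrite polar_sym yp. Qed.

Lemma br_k x y : x \in k -> y \in k -> br x y \in k.
Proof. exact: (subalg_bracket Hk). Qed.

Lemma br_p x y : x \in k -> y \in p -> br x y \in p.
Proof.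
move=> xk yp; apply/Hp => w wk.
by rewrite b_inv polar_sym kp_orth ?oppr0 // br_k.
Qed.

Lemma proj_p x : x - dual_proj Q e e' x \in p.
Proof.
by apply/Hp => y yk; rewrite (scalar_funB (b_l y)) (dual_projE HQ He) ?subrr.
Qed.

Lemma proj_k x : dual_proj Q e e' x \in k.
Proof. exact: (dual_proj_mem He). Qed.

Lemma c_k x : x \in k -> c x = x.
Proof. by have /fixedSpacesP := Hkc; apply. Qed.

Lemma c_b x y : b (c x) (c y) = b x y.
Proof. by rewrite /polar -linearD !(orth_form Hc). Qed.

Lemma c_p x : x \in p -> c x \in p.
Proof. by move=> xp; apply/Hp => y yk; rewrite -(c_k yk) c_b polar_sym kp_orth. Qed.

Implicit Types mu : subvs_of k.

Definition kpart (x : g) : subvs_of k := vsproj k (dual_proj Q e e' x).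
Definition ppart (x : g) : subvs_of p := vsproj p (x - dual_proj Q e e' x).

Lemma kpart_val x : vsval (kpart x) = dual_proj Q e e' x.
Proof. by rewrite vsprojK // proj_k. Qed.

Lemma ppart_val x : vsval (ppart x) = x - dual_proj Q e e' x.
Proof. by rewrite vsprojK // proj_p. Qed.

Lemma kp_sum x : x = vsval (kpart x) + vsval (ppart x).
Proof. by rewrite kpart_val ppart_val addrC subrK. Qed.

Lemma kpart_b x y : y \in k -> b x y = b (vsval (kpart x)) y.
Proof.
move=> yk; rewrite {1}[x]kp_sum (scalar_funD (b_l y)).
by rewrite [b (vsval (ppart x)) y]polar_sym (kp_orth yk (subvsP _)) addr0.
Qed.

Lemma ppart_b x y : y \in p -> b x y = b (vsval (ppart x)) y.
Proof.
move=> yp; rewrite {1}[x]kp_sum (scalar_funD (b_l y)).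
by rewrite (kp_orth (subvsP _) yp) add0r.
Qed.

Lemma kpart_id (x : subvs_of k) : kpart (vsval x) = x.
Proof. by rewrite /kpart (dual_proj_id HQ He knd) ?subvsP // vsvalK. Qed.

Lemma ppart_id (x : subvs_of p) : ppart (vsval x) = x.
Proof.
rewrite /ppart; have -> : dual_proj Q e e' (vsval x) = 0.
  rewrite /dual_proj big1 // => i _; rewrite polar_sym kp_orth ?scale0r ?subvsP //.
  exact: (dual_mem He).
by rewrite subr0 vsvalK.
Qed.

Lemma ppart_k0 (x : subvs_of k) : ppart (vsval x) = 0.
Proof.
rewrite /ppart (dual_proj_id HQ He knd) ?subvsP //.
by rewrite subrr linear0.
Qed.

Lemma kpart_p0 (x : subvs_of p) : kpart (vsval x) = 0.
Proof.
have := kp_sum (vsval x); rewrite ppart_id => xE.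
by apply: subvs_inj; rewrite linear0; apply: (addIr (vsval x)); rewrite add0r -xE.
Qed.

Lemma kpart_linear : linear kpart.
Proof.
move=> a x y; rewrite /kpart -linearP; congr (vsproj k _).
rewrite /dual_proj scaler_sumr -big_split; apply: eq_bigr => i _.
by rewrite /= b_l scalerDl scalerA.
Qed.

Lemma ppart_linear : linear ppart.
Proof.
move=> a x y; apply: subvs_inj.
have -> : vsval (a *: ppart x + ppart y) = a *: vsval (ppart x) + vsval (ppart y).
  exact: linearP.
rewrite !ppart_val -!kpart_val kpart_linear.
have -> : vsval (a *: kpart x + kpart y) = a *: vsval (kpart x) + vsval (kpart y).
  exact: linearP.
by rewrite scalerBr opprD addrACA.
Qed.

(** * Operators attached to a point of [k] *)

Lemma ad_k_val mu x : vsval (ad_k br mu x) = br (vsval mu) (vsval x).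
Proof.
rewrite /ad_k restr_val => [|y yk]; first by rewrite ad_val.
by rewrite ad_val br_k // subvsP.
Qed.

Lemma phi_k_val m mu x :
  vsval (phi m (ad_k br mu) x) = phi m (ad br (vsval mu)) (vsval x).
Proof.
pose T := linfun (vsval : subvs_of k -> g).
have TE y : T y = vsval y by rewrite lfunE.
rewrite -!TE; apply: phi_intertwine => y.
by rewrite !TE ad_k_val ad_val.
Qed.

Lemma phi_p_mem m mu x : x \in p -> phi m (ad br (vsval mu)) x \in p.
Proof.
move=> xp; pose T := linfun (vsval : subvs_of p -> g).
have TE y : T y = vsval y by rewrite lfunE.
have := @phi_intertwine _ _ _ m T (restr p (ad br (vsval mu))) (ad br (vsval mu)).
move=> /(_ _ (vsproj p x)); rewrite !TE vsprojK // => <-; first exact: subvsP.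
by move=> y; rewrite !TE restr_val // => w wp; rewrite ad_val br_p // subvsP.
Qed.

(** The automorphism [c exp(ad mu)] on the whole of [g]; it preserves [p],
    where its restriction is [c_exp_p], and agrees with [exp(ad mu)] on
    [k]. *)
Definition gexp mu : 'End(g) := (c \o phi 0 (ad br (vsval mu)))%VF.

Lemma gexpE mu x : gexp mu x = c (phi 0 (ad br (vsval mu)) x).
Proof. exact: comp_lfunE. Qed.

Lemma gexp_p mu x : x \in p -> gexp mu x \in p.
Proof. by move=> xp; rewrite gexpE c_p // phi_p_mem. Qed.

Lemma c_exp_p_val mu x : vsval (c_exp_p br c p mu x) = gexp mu (vsval x).
Proof. by rewrite /c_exp_p fun_of_cexp restr_val // => y; exact: gexp_p. Qed.

Lemma gexp_br mu x y : gexp mu (br x y) = br (gexp mu x) (gexp mu y).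
Proof.
have := phi0_br brr brl (ad_der (vsval mu)) 0 0 x y.
by rewrite addr0 shift0 !gexpE => ->; rewrite (auto_bracket Hc).
Qed.

Lemma gexp_b mu x y : b (gexp mu x) (gexp mu y) = b x y.
Proof.
rewrite !gexpE c_b; have := phi_adj b_r b_l (ad_skew (vsval mu)) 0 0.
by rewrite oppr0 shift0 => ->; rewrite phi0NK.
Qed.

Lemma gexp_phiN mu (w : subvs_of k) :
  gexp mu (phi 0 (- ad br (vsval mu)) (vsval w)) = vsval w.
Proof. by rewrite gexpE phi0N c_k // subvsP. Qed.

Definition brk (x y : subvs_of k) : subvs_of k := vsproj k (br (vsval x) (vsval y)).
Definition bk (x y : subvs_of k) : R := b (vsval x) (vsval y).

Lemma brk_val x y : vsval (brk x y) = br (vsval x) (vsval y).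
Proof. by rewrite vsprojK // br_k // subvsP. Qed.

Lemma brk_r x : linear (brk x).
Proof. by move=> a y z; rewrite /brk linearP /= brr linearP. Qed.

Lemma brk_l y : linear (brk^~ y).
Proof. by move=> a x z; rewrite /brk linearP /= brl linearP. Qed.

Lemma brk_alt x : brk x x = 0.
Proof. by rewrite /brk br_alt linear0. Qed.

Lemma bk_r x : scalar (bk x).
Proof. by move=> a y z; rewrite /bk linearP /= b_r. Qed.

Lemma bk_l y : scalar (bk^~ y).
Proof. by move=> a x z; rewrite /bk linearP /= b_l. Qed.

Lemma bkB x y z : bk x (y - z) = bk x y - bk x z.
Proof. exact: scalar_funB (bk_r x) y z. Qed.

Lemma bkBl x y z : bk (x - y) z = bk x z - bk y z.
Proof. exact: scalar_funB (bk_l z) x y. Qed.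

Lemma bkZ a x y : bk x (a *: y) = a * bk x y.
Proof. exact: scalar_funZ (bk_r x) a y. Qed.

Lemma bkZl a x y : bk (a *: x) y = a * bk x y.
Proof. exact: scalar_funZ (bk_l y) a x. Qed.

Lemma bk_sym x y : bk x y = bk y x.
Proof. exact: polar_sym. Qed.

Lemma bk_inv m x y : bk (brk m x) y = - bk x (brk m y).
Proof. by rewrite /bk !brk_val b_inv. Qed.

Lemma adk_E mu : ad_k br mu = ad brk mu.
Proof.
apply/lfunP => x; apply: subvs_inj; rewrite ad_k_val linfunE ?brk_val //.
exact: brk_r.
Qed.

Lemma adk_der mu x y :
  ad_k br mu (brk x y) = brk (ad_k br mu x) y + brk x (ad_k br mu y).
Proof.
apply: subvs_inj; rewrite linearD /= ad_k_val !brk_val !ad_k_val.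
by have := ad_der (vsval mu) (vsval x) (vsval y); rewrite !ad_val.
Qed.

Lemma adk_skew mu x y : bk (ad_k br mu x) y = - bk x (ad_k br mu y).
Proof. by rewrite /bk !ad_k_val b_inv. Qed.

Definition regular mu : Prop :=
  injective (phi 1 (ad_k br mu)) /\ injective (c_exp_p br c p mu - \1)%VF.

Lemma regularP mu : regular_set br c p mu <-> regular mu.
Proof.
split=> [[/fun_of_f_cdybe_defined h1 /bij_inj h2]|[h1 h2]] //.
split; first exact/fun_of_f_cdybe_defined.
by exists (c_exp_p br c p mu - \1)^-1%VF; [exact: inv_lfunK|exact: inv_lfunVK].
Qed.

Definition rk mu : 'End(subvs_of k) := fun_of f_cdybe (ad_k br mu).
Definition rp mu : 'End(subvs_of p) :=
  ((c_exp_p br c p mu + \1) \o (c_exp_p br c p mu - \1)^-1)%VF.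

Lemma rk_psi mu x : regular mu ->
  rk mu (phi 1 (ad_k br mu) x) =
  2^-1 *: phi 1 (ad_k br mu) x - phi 2 (ad_k br mu) x.
Proof.
case=> h1 _; rewrite /rk fun_of_f_cdybe // add_lfunE opp_lfunE scale_lfunE.
by rewrite id_lfunE comp_lfunE inv_lfunK.
Qed.

Lemma psi_surj mu x : regular mu -> exists y, x = phi 1 (ad_k br mu) y.
Proof. by case=> h1 _; exact: lfun_inj_surj. Qed.

(** The operator [ad mu] is skew and [f] is odd. *)
Lemma rk_skew mu x y : regular mu -> bk (rk mu x) y = - bk x (rk mu y).
Proof.
move=> rmu; have [x' ->] := psi_surj x rmu; have [y' ->] := psi_surj y rmu.
rewrite !rk_psi //; set A := ad_k br mu.
have adj m v w : bk (phi m A v) w = bk v (phi m (- A) w).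
  have := phi_adj bk_r bk_l (adk_skew mu) m 0 v w.
  by rewrite oppr0 shift0.
rewrite bkBl bkZl !adj.
have := phi_odd A y'; rewrite lfun_morphB => odd.
rewrite lfun_morphB lfun_morphZ -odd.
rewrite !bkB !bkZ.
move: (bk x' _) (bk x' _) => s t; lra.
Qed.

Lemma cp_surj mu x : regular mu ->
  exists y, x = c_exp_p br c p mu y - y.
Proof.
case=> _ h2; have [y ->] := lfun_inj_surj h2 x; exists y.
by rewrite add_lfunE opp_lfunE id_lfunE.
Qed.

Lemma rp_cayley mu y : regular mu ->
  rp mu (c_exp_p br c p mu y - y) = c_exp_p br c p mu y + y.
Proof.
case=> _ h2; rewrite comp_lfunE.
have -> : c_exp_p br c p mu y - y = (c_exp_p br c p mu - \1)%VF y.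
  by rewrite add_lfunE opp_lfunE id_lfunE.
by rewrite inv_lfunK // add_lfunE id_lfunE.
Qed.

Definition bp (x y : subvs_of p) : R := b (vsval x) (vsval y).

(** Cayley transforms of isometries are skew. *)
Lemma rp_skew mu x y : regular mu -> bp (rp mu x) y = - bp x (rp mu y).
Proof.
move=> rmu; have [x' ->] := cp_surj x rmu; have [y' ->] := cp_surj y rmu.
rewrite !rp_cayley // /bp !linearD !linearN /= !c_exp_p_val.
rewrite !(scalar_funD (b_l _), scalar_funN (b_l _), scalar_funD (b_r _),
  scalar_funN (b_r _)) gexp_b; ring.
Qed.

(** The r-matrix as a skew operator on [g], up to the sign of [rmatE]. *)
Definition rg mu (x : g) : g :=
  vsval (rk mu (kpart x)) + 2^-1 *: vsval (rp mu (ppart x)).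

Lemma rg_linear mu : linear (rg mu).
Proof.
move=> a x y; rewrite /rg kpart_linear ppart_linear !linearP /=.
by rewrite !scalerDr !scalerA [a * _]mulrC addrACA.
Qed.

Lemma rg_k mu (x : subvs_of k) : rg mu (vsval x) = vsval (rk mu x).
Proof. by rewrite /rg kpart_id ppart_k0 !linear0 addr0. Qed.

Lemma rg_p mu (x : subvs_of p) : rg mu (vsval x) = 2^-1 *: vsval (rp mu x).
Proof. by rewrite /rg kpart_p0 ppart_id !linear0 add0r. Qed.

Lemma rg_b mu x y : b (rg mu x) y =
  bk (rk mu (kpart x)) (kpart y) + 2^-1 * bp (rp mu (ppart x)) (ppart y).
Proof.
rewrite /rg (scalar_funD (b_l _)) (scalar_funZ (b_l _)) /bk /bp; congr (_ + _ * _).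
  by rewrite polar_sym kpart_b ?subvsP // polar_sym.
by rewrite polar_sym ppart_b ?subvsP // polar_sym.
Qed.

Lemma rg_skew mu x y : regular mu -> b (rg mu x) y = - b x (rg mu y).
Proof.
move=> rmu; rewrite [b x _]polar_sym !rg_b rk_skew // rp_skew //.
by rewrite bk_sym /bp [b (vsval (ppart x)) _]polar_sym; ring.
Qed.

Definition rmat mu : bivector g := fun al be =>
  r_k br e e' mu al be + r_p br c p u u' mu al be.

Lemma rmatE mu (al be : dual g) x y : regular mu ->
  (forall v, al v = b x v) -> (forall v, be v = b y v) ->
  rmat mu al be = - b (rg mu x) y.
Proof.
move=> rmu alE beE; rewrite /rmat /r_k /r_p -/(rk mu) -/(rp mu).
have -> : lambda e e' (rk mu) al be = - bk (rk mu (kpart x)) (kpart y).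
  by apply: (lambda_polar HQ He alE beE) => [v|v|v w];
    [exact: kpart_b|exact: kpart_b|exact: rk_skew].
have -> : lambda u u' (rp mu) al be = - bp (rp mu (ppart x)) (ppart y).
  by apply: (lambda_polar HQ Hu alE beE) => [v|v|v w];
    [exact: ppart_b|exact: ppart_b|exact: rp_skew].
by rewrite rg_b opprD mulrN.
Qed.

(** * Openness and density of the regular set *)

Section Near.
Context {T : Type} {F : set_system T} {FF : Filter F}.

Lemma adk_cvg (w : T -> subvs_of k) mu : vcvg F w mu ->
  forall x, vcvg F (fun t => ad_k br (w t) x) (ad_k br mu x).
Proof.
move=> wmu x f fL; rewrite adk_E (adE brk_r).
rewrite (_ : (fun t => _) = (fun t => f (brk (w t) x))).
  by apply: (wmu (fun v => f (brk v x))) => a v v'; rewrite brk_l fL.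
by apply/funext => t; rewrite adk_E (adE brk_r).
Qed.

Lemma c_exp_pE mu y : c_exp_p br c p mu y = vsproj p (gexp mu (vsval y)).
Proof. by rewrite /c_exp_p fun_of_cexp restrE. Qed.

Lemma phi_ad_cvg m (w : T -> subvs_of k) mu : vcvg F w mu ->
  forall x, vcvg F (fun t => phi m (ad br (vsval (w t))) x)
    (phi m (ad br (vsval mu)) x).
Proof.
move=> wmu x; apply: phi_vcvg => y f fL; rewrite ad_val.
rewrite (_ : (fun t => _) = (fun t => f (br (vsval (w t)) y))).
  by apply: (wmu (fun v => f (br (vsval v) y))) => a v v'; rewrite linearP /= brl fL.
by apply/funext => t; rewrite ad_val.
Qed.

Lemma c_exp_p_cvg (w : T -> subvs_of k) mu : vcvg F w mu ->
  forall y, vcvg F (fun t => c_exp_p br c p (w t) y) (c_exp_p br c p mu y).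
Proof.
move=> wmu y f fL; rewrite c_exp_pE gexpE.
rewrite (_ : (fun t => _) = (fun t =>
  f (vsproj p (c (phi 0 (ad br (vsval (w t))) (vsval y)))))).
  have h : vcvg F (fun t => phi 0 (ad br (vsval (w t))) (vsval y))
      (phi 0 (ad br (vsval mu)) (vsval y)) by exact: phi_ad_cvg.
  apply: (h (fun v => f (vsproj p (c v)))) => a v v'.
  by rewrite !linearP /= fL.
by apply/funext => t; rewrite c_exp_pE gexpE.
Qed.

Lemma sub1_cvg (w : T -> subvs_of k) mu : vcvg F w mu ->
  forall y, vcvg F (fun t => (c_exp_p br c p (w t) - \1)%VF y)
    ((c_exp_p br c p mu - \1)%VF y).
Proof.
move=> wmu y; rewrite add_lfunE opp_lfunE id_lfunE.
rewrite (_ : (fun t => _) = (fun t => c_exp_p br c p (w t) y - y)).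
  by apply: vcvgB; [exact: c_exp_p_cvg|exact: vcvg_cst].
by apply/funext => t; rewrite add_lfunE opp_lfunE id_lfunE.
Qed.

Lemma psi_near (w : T -> subvs_of k) mu : vcvg F w mu ->
  injective (phi 1 (ad_k br mu)) ->
  \forall t \near F, injective (phi 1 (ad_k br (w t))).
Proof.
move=> wmu inj; apply: (injective_near inj) => v.
by apply: phi_vcvg => x; exact: adk_cvg.
Qed.

Lemma regular_near (w : T -> subvs_of k) mu : vcvg F w mu -> regular mu ->
  \forall t \near F, regular (w t).
Proof.
move=> wmu [h1 h2].
have n2 : \forall t \near F, injective (c_exp_p br c p (w t) - \1)%VF.
  by apply: (injective_near h2); exact: sub1_cvg.
by apply: filterS2 (psi_near wmu h1) n2 => t w1 w2; split.
Qed.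

End Near.

Lemma vcvg_translate mu : vcvg (vnbhs0 (subvs_of k)) (fun v => mu + v) mu.
Proof.
have h0 : vcvg (vnbhs0 (subvs_of k)) (fun v => mu + v) (mu + 0).
  by apply: vcvgD; [exact: vcvg_cst|exact: vcvg_vnbhs0].
by rewrite addr0 in h0.
Qed.

Arguments vcvg_translate mu [f].

(** Both conditions state that an operator depending continuously on the point
    is injective. *)
Lemma regular_open : vopen (regular_set br c p : set (subvs_of k)).
Proof.
apply: vopen_vnbhs0 => mu /regularP rmu.
apply: filterS (regular_near (vcvg_translate mu) rmu) => v.
by move/regularP.
Qed.

Lemma regular_dense (U : set (subvs_of k)) : vdense U ->
  (forall mu, U mu -> c_exp_sub1_invertible br c p mu) ->
  vdense (regular_set br c p : set (subvs_of k)).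
Proof.
move=> Ud UI.
apply: (@vdense_radial _ _ [set mu | injective (phi 1 (ad_k br mu))] U) => //.
- apply: vopen_vnbhs0 => mu h.
  exact: psi_near (vcvg_translate mu) h.
- move=> mu; apply: filterS (phi1_injective_near (ad_k br mu)) => t /=.
  have -> : ad_k br ((1 + t) *: mu) = (1 + t) *: ad_k br mu => //.
  apply/lfunP => x; rewrite scale_lfunE !adk_E !(adE brk_r).
  exact: (brZl brk_l).
- by move=> mu /fun_of_f_cdybe_defined h /UI.
Qed.

(** * Directional derivatives of the r-matrix *)

Section DerivativeAt.
Variable mu : subvs_of k.
Hypothesis rmu : regular mu.

Local Notation A := (ad_k br mu).
Local Notation C := (c_exp_p br c p mu).

Lemma vcvg_line v : vcvg (0 : R)^' (fun s => mu + s *: v) mu.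
Proof.
have h0 : vcvg (0 : R)^' (fun s => mu + s *: v) (mu + 0 *: v).
  by apply: vcvgD; [exact: vcvg_cst|apply: vcvgZ; [exact: cvg_id0|exact: vcvg_cst]].
by rewrite scale0r addr0 in h0.
Qed.

Arguments vcvg_line v [f].

Lemma adk_line v s : ad_k br (mu + s *: v) = A + s *: ad_k br v.
Proof.
apply/lfunP => x; rewrite add_lfunE scale_lfunE !adk_E !(adE brk_r).
by rewrite (brDl brk_l) (brZl brk_l).
Qed.

Definition dpsi m v : 'End(subvs_of k) := dphi m A A (ad_k br v).

Lemma phi_line_derive m v x :
  vderive (fun s => phi m (ad_k br (mu + s *: v)) x) 0 (dpsi m v x).
Proof.
have := @phi_difference_quotient _ _ m (fun s => ad_k br (mu + s *: v))
  (fun=> ad_k br v) A (ad_k br v) _ _ _ x.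
move=> /(_ (nearW _ (adk_line v)) (adk_cvg (vcvg_line v))).
move=> /(_ (fun y => vcvg_cst (ad_k br v y))) h.
have {}h : vcvg (0 : R)^' (fun t => t^-1 *:
  (phi m (ad_k br (mu + t *: v)) x - phi m A x)) (dpsi m v x) by exact: h.
apply: vcvg_ext h; apply: nearW => t.
by rewrite scale0r !addr0.
Qed.

Arguments phi_line_derive m v x [f].

Definition drk_comb (x1 x2 : subvs_of k) : subvs_of k :=
  2^-1 *: x1 - rk mu x1 - x2.

(** The derivative of [f(A) = 1/2 - phi_2 phi_1^-1] in the direction [v]:
    minus the derivative of [phi_2 phi_1^-1] is
    [phi_2 phi_1^-1 dphi_1 phi_1^-1 - dphi_2 phi_1^-1], where
    [phi_2 phi_1^-1 = 1/2 - f(A)]. *)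
Definition drk v (x : subvs_of k) : subvs_of k :=
  drk_comb (dpsi 1 v ((phi 1 A)^-1%VF x)) (dpsi 2 v ((phi 1 A)^-1%VF x)).

Lemma rk_line_derive v x : vderive (fun s => 2^-1 *: x -
    phi 2 (ad_k br (mu + s *: v)) ((phi 1 (ad_k br (mu + s *: v)))^-1%VF x)) 0
  (drk v x).
Proof.
have [h1 _] := rmu; set x' := ((phi 1 A)^-1)%VF x.
have d1 := @vderive_inv _ _ (fun s => phi 1 (ad_k br (mu + s *: v))) (dpsi 1 v) 0.
rewrite scale0r addr0 in d1; have {}d1 := d1 h1 (phi_line_derive 1 v) x.
have := vderive_app (phi_line_derive 2 v) d1.
rewrite scale0r addr0 -/x' linearN /= => d2.
have -> : drk v x = - (- phi 2 A ((phi 1 A)^-1%VF (dpsi 1 v x')) + dpsi 2 v x').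
  rewrite /drk /drk_comb -/x' /rk fun_of_f_cdybe // add_lfunE scale_lfunE opp_lfunE.
  by rewrite id_lfunE comp_lfunE [in LHS]opprD !addrA subrr add0r opprK opprD opprK.
apply: vcvg_ext (vcvgN d2); apply: nearW => h.
rewrite -scalerN; congr (_ *: _).
by rewrite opprB [in RHS]opprB [RHS]addrC addrA subrK.
Qed.

(** The derivative of [c exp(ad mu)] in the direction [v], in the form given
    by [dphi_exp]. *)
Definition dcp (v : subvs_of k) : 'End(subvs_of p) :=
  restr p (gexp mu \o ad br (phi 1 (- ad br (vsval mu)) (vsval v)))%VF.

Lemma dcpE v a : dcp v a =
  vsproj p (gexp mu (br (phi 1 (- ad br (vsval mu)) (vsval v)) (vsval a))).
Proof. by rewrite /dcp restrE comp_lfunE ad_val. Qed.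

Lemma ad_line (v : subvs_of k) s : ad br (vsval (mu + s *: v)) =
  ad br (vsval mu) + s *: ad br (vsval v).
Proof.
apply/lfunP => x; rewrite add_lfunE scale_lfunE !ad_val linearD linearZ /=.
by rewrite (brDl brl) (brZl brl).
Qed.

Lemma c_exp_p_line_derive v a :
  vderive (fun s => (c_exp_p br c p (mu + s *: v) - \1)%VF a) 0 (dcp v a).
Proof.
have := @phi_difference_quotient _ _ 0 (fun s => ad br (vsval (mu + s *: v)))
  (fun=> ad br (vsval v)) (ad br (vsval mu)) (ad br (vsval v)) _ _ _ (vsval a).
move=> /(_ (nearW _ (ad_line v))).
move=> /(_ _ (fun y => vcvg_cst (ad br (vsval v) y))) h f fL.
have {}h : vcvg (0 : R)^' (fun t => t^-1 *:
    (phi 0 (ad br (vsval (mu + t *: v))) (vsval a) -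
     phi 0 (ad br (vsval mu)) (vsval a)))
   (dphi 0 (ad br (vsval mu)) (ad br (vsval mu)) (ad br (vsval v)) (vsval a)).
  apply: h => y f' fL'; rewrite ad_val.
  rewrite (_ : (fun t => _) = (fun t => f' (br (vsval (mu + t *: v)) y))).
    apply: (vcvg_line v (f := fun w => f' (br (vsval w) y))) => b1 w w'.
    by rewrite linearP /= brl fL'.
  by apply/funext => t; rewrite ad_val.
rewrite (dphi_exp brr brl (ad_der (vsval mu))) in h.
rewrite dcpE gexpE (_ : (fun t => _) = (fun t => f (vsproj p (c (t^-1 *:
    (phi 0 (ad br (vsval (mu + t *: v))) (vsval a) -
     phi 0 (ad br (vsval mu)) (vsval a))))))).
  apply: (h (fun w => f (vsproj p (c w)))) => b1 w w'.
  by rewrite !linearP /= fL.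
apply/funext => t; rewrite scale0r !addr0.
rewrite !add_lfunE !opp_lfunE !id_lfunE opprB addrA subrK !c_exp_pE !gexpE.
by rewrite !linearZ /= !linearB.
Qed.

Arguments c_exp_p_line_derive v a [f].

(** The derivative of the Cayley transform [1 + 2 (C - 1)^-1] in the direction
    [v]. *)
Definition drp (v : subvs_of k) (y : subvs_of p) : subvs_of p :=
  - 2 *: ((C - \1)^-1)%VF (dcp v (((C - \1)^-1)%VF y)).

Lemma rp_E w y : regular w ->
  rp w y = y + 2 *: ((c_exp_p br c p w - \1)^-1)%VF y.
Proof.
move=> [_ h2]; rewrite /rp comp_lfunE; set a := ((_ - _)^-1)%VF y.
have -> : y = (c_exp_p br c p w - \1)%VF a by rewrite inv_lfunVK.
rewrite !add_lfunE opp_lfunE id_lfunE; apply: vec_ext => f fL.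
rewrite !(scalar_funB fL, scalar_funD fL, scalar_funZ fL); ring.
Qed.

Lemma scale_sub_affine (V : lmodType R) (y a1 a2 : V) (h l : R) :
  l *: (h *: (a1 - a2)) = h *: ((y + l *: a1) - (y + l *: a2)).
Proof.
rewrite scalerA mulrC -scalerA; congr (_ *: _).
by rewrite scalerBr [in RHS]opprD addrACA subrr add0r.
Qed.

Lemma rp_line_derive v y : vderive
    (fun s => y + 2 *: ((c_exp_p br c p (mu + s *: v) - \1)^-1)%VF y) 0 (drp v y).
Proof.
have [_ h2] := rmu.
have d1 := @vderive_inv _ _ (fun s => (c_exp_p br c p (mu + s *: v) - \1)%VF)
  (dcp v) 0.
rewrite scale0r addr0 in d1; have {}d1 := d1 h2 (c_exp_p_line_derive v) y.
have {}d1 : vcvg (0 : R)^' (fun h => 2 *: (h^-1 *: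
    (((c_exp_p br c p (mu + (h + 0) *: v) - \1)^-1)%VF y -
     ((c_exp_p br c p (mu + 0 *: v) - \1)^-1)%VF y))) (drp v y).
  by rewrite /drp scaleNr -scalerN; apply: vcvgZ; [exact: cvg_cst|exact: d1].
apply: vcvg_ext d1; apply: nearW => h.
exact: (scale_sub_affine y).
Qed.

Lemma rk_E w x : regular w -> rk w x =
  2^-1 *: x - phi 2 (ad_k br w) ((phi 1 (ad_k br w))^-1%VF x).
Proof.
case=> h1 _; rewrite /rk fun_of_f_cdybe // add_lfunE opp_lfunE scale_lfunE.
by rewrite id_lfunE comp_lfunE.
Qed.

Definition kp_form (x1 : subvs_of k) (x2 : subvs_of p) y : R :=
  - (bk x1 (kpart y) + 2^-1 * bp x2 (ppart y)).

Definition drm v x y : R := kp_form (drk v (kpart x)) (drp v (ppart x)) y.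

Lemma bp_l y : scalar (bp^~ y).
Proof. by move=> a x z; rewrite /bp linearP /= b_l. Qed.

Lemma quotient_combine (h s1 s2 s3 s4 : R) :
  - (h * (s1 - s2) + 2^-1 * (h * (s3 - s4))) =
  h * (- (s1 + 2^-1 * s3) - - (s2 + 2^-1 * s4)).
Proof. ring. Qed.

(** The regular set is open, so that near the base point the r-matrix may be
    replaced by the expressions whose derivatives are known. *)
Lemma rmat_line_derive v (al be : dual g) x y :
  (forall w, al w = b x w) -> (forall w, be w = b y w) ->
  is_derive (0 : R) (1 : R) (along rmat mu v al be) (drm v x y).
Proof.
move=> alE beE.
pose u1 s := 2^-1 *: kpart x - phi 2 (ad_k br (mu + s *: v))
  ((phi 1 (ad_k br (mu + s *: v)))^-1%VF (kpart x)).
pose u2 s := ppart x +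
  2 *: ((c_exp_p br c p (mu + s *: v) - \1)^-1)%VF (ppart x).
have alongE s : regular (mu + s *: v) -> along rmat mu v al be s =
    - (bk (u1 s) (kpart y) + 2^-1 * bp (u2 s) (ppart y)).
  by move=> rs; rewrite /along (rmatE rs alE beE) rg_b rk_E // rp_E.
have along0 : along rmat mu v al be 0 =
    - (bk (u1 0) (kpart y) + 2^-1 * bp (u2 0) (ppart y)).
  by apply: alongE; rewrite scale0r addr0.
have d1 : bk (h^-1 *: (u1 (h + 0) - u1 0)) (kpart y) @[h --> (0 : R)^'] -->
    bk (drk v (kpart x)) (kpart y).
  have h := @rk_line_derive v (kpart x) (fun w => bk w (kpart y)) (bk_l _).
  exact: h.
have d2 : bp (h^-1 *: (u2 (h + 0) - u2 0)) (ppart y) @[h --> (0 : R)^'] -->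
    bp (drp v (ppart x)) (ppart y).
  have h := @rp_line_derive v (ppart x) (fun w => bp w (ppart y)) (bp_l _).
  exact: h.
have cF : - (bk (h^-1 *: (u1 (h + 0) - u1 0)) (kpart y) +
      2^-1 * bp (h^-1 *: (u2 (h + 0) - u2 0)) (ppart y)) @[h --> (0 : R)^'] -->
    drm v x y.
  by apply: cvgN; apply: cvgD; [exact: d1|apply: cvgMl_tmp; exact: d2].
have dF : h^-1 *: ((along rmat mu v al be \o shift 0) (h *: (1 : R)) -
    along rmat mu v al be 0) @[h --> (0 : R)^'] --> drm v x y.
  apply: cvg_trans cF; apply: near_eq_cvg.
  apply: filterS (regular_near (vcvg_line v) rmu) => h rh.
  have {}rh : regular (mu + (h + 0) *: v) by rewrite addr0.
  rewrite along0 /= [_ *: 1]mulr1 alongE //.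
  rewrite (scalar_funZ (bk_l _)) (scalar_funB (bk_l _)).
  rewrite (scalar_funZ (bp_l _)) (scalar_funB (bp_l _)).
  exact: quotient_combine.
apply: DeriveDef; first by apply/cvg_ex; exists (drm v x y).
exact: cvg_lim dF.
Qed.

Lemma dpsi_linear m a v w x :
  dpsi m (a *: v + w) x = a *: dpsi m v x + dpsi m w x.
Proof.
rewrite /dpsi -dphiZ -dphiD; congr (dphi _ _ _ _ x).
apply/lfunP => y; rewrite add_lfunE scale_lfunE !adk_E !(adE brk_r).
by rewrite (brDl brk_l) (brZl brk_l).
Qed.

Lemma scale_comb (V : lmodType R) (h a : R) (x1 y1 x2 y2 x3 y3 : V) :
  h *: (a *: x1 + y1) - (a *: x2 + y2) - (a *: x3 + y3) =
  a *: (h *: x1 - x2 - x3) + (h *: y1 - y2 - y3).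
Proof.
rewrite scalerDr !opprD [X in X + _]addrACA [LHS]addrACA scalerA mulrC -scalerA.
by rewrite !scalerBr.
Qed.

Lemma drk_comb_linear a x1 y1 x2 y2 :
  drk_comb (a *: x1 + y1) (a *: x2 + y2) =
  a *: drk_comb x1 x2 + drk_comb y1 y2.
Proof.
rewrite /drk_comb.
have -> : rk mu (a *: x1 + y1) = a *: rk mu x1 + rk mu y1 by exact: linearP.
exact: scale_comb.
Qed.

Lemma drk_linearl x : linear (fun v => drk v x).
Proof.
move=> a v w; pose y := (phi 1 A)^-1%VF x.
exact: (etrans (congr2 drk_comb (dpsi_linear 1 a v w y) (dpsi_linear 2 a v w y))
  (drk_comb_linear _ _ _ _ _)).
Qed.

Lemma drk_linear v : linear (drk v).
Proof.
move=> a x y; have lin m : dpsi m v ((phi 1 A)^-1%VF (a *: x + y)) =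
    a *: dpsi m v ((phi 1 A)^-1%VF x) + dpsi m v ((phi 1 A)^-1%VF y).
  by rewrite linearP linearP.
exact: (etrans (congr2 drk_comb (lin 1) (lin 2)) (drk_comb_linear _ _ _ _ _)).
Qed.

Lemma dcp_linear a0 : linear (fun v => dcp v a0).
Proof.
move=> a v w; rewrite !dcpE -linearP; congr (vsproj p _); rewrite -linearP /=.
by rewrite -brl linearP -linearP.
Qed.

Lemma drp_linearl y : linear (fun v => drp v y).
Proof.
move=> a v w; rewrite /drp dcp_linear linearP.
by rewrite scalerDr !scalerA [a * _]mulrC.
Qed.

Lemma drp_linear v : linear (drp v).
Proof.
by move=> a x y; rewrite /drp !linearP.
Qed.

Lemma kp_form_linear a x1 x1' x2 x2' y :
  kp_form (a *: x1 + x1') (a *: x2 + x2') y =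
  a * kp_form x1 x2 y + kp_form x1' x2' y.
Proof.
rewrite /kp_form.
have -> : bk (a *: x1 + x1') (kpart y) = _ := bk_l (kpart y) a x1 x1'.
have -> : bp (a *: x2 + x2') (ppart y) = _ := bp_l (ppart y) a x2 x2'.
ring.
Qed.

Lemma drm_scalar_dir x y : scalar (fun v => drm v x y).
Proof.
move=> a v w.
exact: (etrans (congr2 (fun x1 x2 => kp_form x1 x2 y)
  (drk_linearl (kpart x) a v w) (drp_linearl (ppart x) a v w))
  (kp_form_linear _ _ _ _ _ _)).
Qed.

Lemma drm_scalar_arg1 v y : scalar (fun x => drm v x y).
Proof.
move=> a x x'; rewrite /drm kpart_linear ppart_linear.
exact: (etrans (congr2 (fun x1 x2 => kp_form x1 x2 y)
  (drk_linear v a (kpart x) (kpart x')) (drp_linear v a (ppart x) (ppart x')))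
  (kp_form_linear _ _ _ _ _ _)).
Qed.

Lemma bp_r x : scalar (bp x).
Proof. by move=> a y z; rewrite /bp linearP /= b_r. Qed.

Lemma kp_form_scalar x1 x2 : scalar (kp_form x1 x2).
Proof.
move=> a y y'; rewrite /kp_form kpart_linear ppart_linear bk_r bp_r; ring.
Qed.

(** Summation over the basis [e], [e'] reconstructs the [k]-component of [z]
    as the direction of differentiation. *)
Lemma kpart_scalar (f : subvs_of k -> R) z : scalar f ->
  f (kpart z) = \sum_(i < dk) b z e`_i * f (vsproj k e'`_i).
Proof.
move=> fL; rewrite /kpart /dual_proj linear_sum /=.
rewrite (eq_bigr (fun i : 'I_dk => b z e`_i *: vsproj k e'`_i)).
  exact: scalar_sum.
by move=> i _; rewrite linearZ.
Qed.

Lemma dir_deriveE v (al be : dual g) x y :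
  (forall w, al w = b x w) -> (forall w, be w = b y w) ->
  dir_derive rmat mu v al be = drm v x y.
Proof.
move=> alE beE; rewrite /dir_derive derive1E.
have h := rmat_line_derive v alE beE.
exact: derive_val.
Qed.

Lemma wedge_differentialE (al be ga : dual g) x y z :
  (forall v, al v = b x v) -> (forall v, be v = b y v) ->
  (forall v, ga v = b z v) ->
  wedge_differential e e' rmat mu al be ga =
  drm (kpart z) x y + drm (kpart x) y z + drm (kpart y) z x.
Proof.
move=> alE beE gaE; rewrite /wedge_differential.
rewrite !(kpart_scalar _ (drm_scalar_dir _ _)) -!big_split; apply: eq_bigr => i _.
rewrite /wedge21 (dir_deriveE _ alE beE) (dir_deriveE _ beE gaE).
rewrite (dir_deriveE _ gaE alE) alE beE gaE /=.
by congr (_ + _ + _); exact: mulrC.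
Qed.

Local Notation t := (tau br b).
Let t1 y z := tau_scalar1 brl b_l y z.
Let t2 x z := tau_scalar2 brr b_l x z.

(** The difference of the two sides of the dynamical Yang-Baxter equation, in
    terms of vectors. *)
Definition cdybe_sum x y z : R :=
  drm (kpart z) x y + drm (kpart x) y z + drm (kpart y) z x +
  cybe4 br b (rg mu) x y z.

Lemma cdybe_sum_cyc x y z : cdybe_sum x y z = cdybe_sum y z x.
Proof.
rewrite /cdybe_sum (cybe4_cyc brr brl br_alt b_l (@polar_sym _ _ Q) b_inv).
by congr (_ + _); rewrite -addrA addrC.
Qed.

Lemma scalar_add (f h : g -> R) : scalar f -> scalar h ->
  scalar (fun x => f x + h x).
Proof. by move=> fL hL a x y; rewrite fL hL mulrDr addrACA. Qed.

Lemma scalar_mul l (f : g -> R) : scalar f -> scalar (fun x => l * f x).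
Proof. by move=> fL a x y; rewrite fL mulrDr mulrCA. Qed.

Lemma scalar_comp_linear (V W : lmodType R) (f : W -> R) (L : V -> W) :
  scalar f -> linear L -> scalar (fun x => f (L x)).
Proof. by move=> fL LL a x y; rewrite LL fL. Qed.

Lemma cdybe_sum_scalar y z : scalar (fun x => cdybe_sum x y z).
Proof.
apply: (@scalar_add (fun x => drm (kpart z) x y + drm (kpart x) y z +
  drm (kpart y) z x) (fun x => cybe4 br b (rg mu) x y z)).
  apply: (@scalar_add (fun x => drm (kpart z) x y + drm (kpart x) y z)
    (drm (kpart y) z)); last exact: kp_form_scalar.
  apply: (@scalar_add (fun x => drm (kpart z) x y) (fun x => drm (kpart x) y z)).
    exact: drm_scalar_arg1.
  exact: (scalar_comp_linear (drm_scalar_dir y z) kpart_linear).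
apply: (@scalar_add (fun x => t (rg mu x) (rg mu y) z +
  t (rg mu y) (rg mu z) x + t (rg mu z) (rg mu x) y) (fun x => 4^-1 * t x y z)).
  apply: (@scalar_add (fun x => t (rg mu x) (rg mu y) z + t (rg mu y) (rg mu z) x)
    (fun x => t (rg mu z) (rg mu x) y)).
    apply: (@scalar_add (fun x => t (rg mu x) (rg mu y) z)
      (t (rg mu y) (rg mu z))); last exact: b_r.
    exact: (scalar_comp_linear (t1 (rg mu y) z) (rg_linear mu)).
  exact: (scalar_comp_linear (t2 (rg mu z) y) (rg_linear mu)).
exact: (scalar_mul _ (t1 y z)).
Qed.

Lemma cyclic_trilinear_eq0 (F : g -> g -> g -> R) :
  (forall x y z, F x y z = F y z x) ->
  (forall y z, scalar (fun x => F x y z)) ->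
  (forall x y z : subvs_of k, F (vsval x) (vsval y) (vsval z) = 0) ->
  (forall (x y : subvs_of k) (z : subvs_of p),
     F (vsval x) (vsval y) (vsval z) = 0) ->
  (forall (x y : subvs_of p) (z : subvs_of k),
     F (vsval x) (vsval y) (vsval z) = 0) ->
  (forall x y z : subvs_of p, F (vsval x) (vsval y) (vsval z) = 0) ->
  forall x y z, F x y z = 0.
Proof.
move=> cyc lin Fkkk Fkkp Fppk Fppp.
have D x x' y z : F (x + x') y z = F x y z + F x' y z.
  exact: (scalar_funD (lin y z)).
have split y z : (forall x : subvs_of k, F (vsval x) y z = 0) ->
    (forall x : subvs_of p, F (vsval x) y z = 0) -> forall x, F x y z = 0.
  by move=> Fk Fp x; rewrite (kp_sum x) D Fk Fp addr0.
move=> x y z.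
apply: (split y z) => x1; rewrite cyc; apply: (split z) => y1;
  rewrite cyc; apply: split => z1.
- exact: Fkkk.
- by rewrite cyc; exact: Fkkp.
- exact: Fkkp.
- by rewrite cyc cyc; exact: Fppk.
- by rewrite cyc cyc; exact: Fkkp.
- exact: Fppk.
- by rewrite cyc; exact: Fppk.
- exact: Fppp.
Qed.

Lemma drk0 v : drk v 0 = 0.
Proof.
by have := drk_linear v (-1) 0 0; rewrite scaler0 addr0 scaleN1r addNr.
Qed.

Lemma drm_kk v (x y : subvs_of k) :
  drm v (vsval x) (vsval y) = - bk (drk v x) y.
Proof.
rewrite /drm /kp_form !kpart_id !ppart_k0.
by rewrite (scalar_fun0 (bp_r _)) mulr0 addr0.
Qed.

Lemma drm_pp v (x y : subvs_of p) :
  drm v (vsval x) (vsval y) = - (2^-1 * bp (drp v x) y).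
Proof.
rewrite /drm /kp_form !kpart_p0 !ppart_id.
by rewrite (scalar_fun0 (bk_r _)) add0r.
Qed.

Lemma drp0 v : drp v 0 = 0.
Proof. by rewrite /drp !linear0. Qed.

Lemma drm_kp v (x : subvs_of k) (y : subvs_of p) : drm v (vsval x) (vsval y) = 0.
Proof.
rewrite /drm /kp_form kpart_p0 ppart_k0 (scalar_fun0 (bk_r _)) add0r.
by rewrite drp0 (scalar_fun0 (bp_l _)) mulr0 oppr0.
Qed.

Lemma drm0 x y : drm 0 x y = 0.
Proof. exact: (scalar_fun0 (drm_scalar_dir x y)). Qed.

Lemma drm_pk v (x : subvs_of p) (y : subvs_of k) : drm v (vsval x) (vsval y) = 0.
Proof.
rewrite /drm /kp_form kpart_p0 ppart_k0 drk0 (scalar_fun0 (bk_l _)) add0r.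
by rewrite (scalar_fun0 (bp_r _)) mulr0 oppr0.
Qed.

Lemma rg_cayley (a : subvs_of p) : rg mu (gexp mu (vsval a) - vsval a) =
  2^-1 *: (gexp mu (vsval a) + vsval a).
Proof.
have -> : gexp mu (vsval a) - vsval a = vsval (C a - a).
  by rewrite linearB /= c_exp_p_val.
rewrite rg_p rp_cayley //; congr (_ *: _).
by rewrite linearD /= c_exp_p_val.
Qed.

Lemma adN m : ad br (- m) = - ad br m.
Proof.
by apply/lfunP => x; rewrite opp_lfunE !ad_val (brNl brl).
Qed.

Lemma cdybe_ppp (x y z : subvs_of p) : cdybe_sum (vsval x) (vsval y) (vsval z) = 0.
Proof.
rewrite /cdybe_sum !kpart_p0 !drm0 !add0r.
have [x' ->] := cp_surj x rmu; have [y' ->] := cp_surj y rmu.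
have [z' ->] := cp_surj z rmu.
rewrite !linearB /= !c_exp_p_val.
apply: (cybe4_cayley brr brl br_alt b_r b_l (@polar_sym _ _ Q) b_inv
  (gexp_br mu) (gexp_b mu)); exact: rg_cayley.
Qed.

(** The r-matrix preserves the splitting, [k] acts on [p], and the two
    subspaces are orthogonal. *)
Lemma cdybe_kkp (x y : subvs_of k) (z : subvs_of p) :
  cdybe_sum (vsval x) (vsval y) (vsval z) = 0.
Proof.
rewrite /cdybe_sum kpart_p0 drm0 !drm_kp drm_pk !add0r.
have kkp s w q : s \in k -> w \in k -> q \in p -> t s w q = 0.
  by move=> sk wk qp; rewrite /tau kp_orth // br_k.
have kpk s q w : s \in k -> q \in p -> w \in k -> t s q w = 0.
  by move=> sk qp wk; rewrite /tau polar_sym kp_orth // br_p.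
have rzp : rg mu (vsval z) \in p by rewrite rg_p rpredZ ?subvsP.
have rxk (v : subvs_of k) : rg mu (vsval v) \in k by rewrite rg_k subvsP.
rewrite /cybe4 (kkp _ _ _ (rxk x) (rxk y) (subvsP z)).
rewrite (kpk _ _ _ (rxk y) rzp (subvsP x)).
rewrite (tau_cyc brr brl br_alt b_l (@polar_sym _ _ Q) b_inv (rg mu (vsval z))).
rewrite (kkp _ _ _ (rxk x) (subvsP y) rzp).
by rewrite (kkp _ _ _ (subvsP x) (subvsP y) (subvsP z)) mulr0 !addr0.
Qed.

(** With [x = (C - 1) a] and [y = (C - 1) a'], the derivative contributes
    [- tau a a' w] and the quadratic terms [tau a a' w], where
    [w = phi_1(-A) z]. *)
Lemma cdybe_ppk (x y : subvs_of p) (z : subvs_of k) :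
  cdybe_sum (vsval x) (vsval y) (vsval z) = 0.
Proof.
rewrite /cdybe_sum !kpart_p0 !drm0 !addr0 kpart_id drm_pp.
have [a ->] := cp_surj x rmu; have [a' ->] := cp_surj y rmu.
have [z' zE] := psi_surj z rmu.
pose w := phi 1 (- ad br (vsval mu)) (vsval z).
have -> : cybe4 br b (rg mu) (vsval (C a - a)) (vsval (C a' - a')) (vsval z) =
    t (vsval a) (vsval a') w.
  rewrite !linearB /= !c_exp_p_val.
  apply: (cybe4_mixed brr brl br_alt b_r b_l (@polar_sym _ _ Q) b_inv
    (gexp_br mu) (gexp_b mu) (z' := vsval z')); try exact: rg_cayley.
  - by rewrite zE phi_k_val.
  - by rewrite rg_k zE rk_psi // linearB linearZ /= !phi_k_val.
  - exact: gexp_phiN.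
  - by rewrite rg_k; exact: gexp_phiN.
have [_ h2] := rmu.
pose s := (C - \1)^-1%VF (dcp z a).
have -> : drp z (C a - a) = - 2 *: s.
  rewrite /drp; congr (_ *: _); rewrite /s; congr (_ (dcp z _)).
  by rewrite -[RHS](inv_lfunK h2) add_lfunE opp_lfunE id_lfunE.
(* The resolvent [s] solves [(C - 1) s = dC a]. *)
have sE : gexp mu (vsval s) - vsval s = gexp mu (br w (vsval a)).
  have wk : w \in k.
    by have := subvsP (phi 1 (ad_k br (- mu)) z); rewrite phi_k_val linearN adN.
  have := congr1 vsval (inv_lfunVK h2 (dcp z a)).
  rewrite -/s add_lfunE opp_lfunE id_lfunE linearB /= c_exp_p_val => ->.
  by rewrite dcpE vsprojK // gexp_p // br_p // subvsP.
rewrite (scalar_funZ (bp_l _)) /bp [vsval (C a' - a')]linearB /= c_exp_p_val.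
rewrite (cayley_derivative brr brl br_alt b_r b_l (@polar_sym _ _ Q) b_inv
  (gexp_b mu) _ sE).
move: (t _ _ _) => r; lra.
Qed.

Lemma half_cancel (r1 r2 r3 : R) :
  2^-1 * r1 - - (2^-1 * r1 - r2) - r3 = r1 - r2 - r3.
Proof. lra. Qed.

Lemma drk_comb_bk x1 x2 y y2 : rk mu y = 2^-1 *: y - y2 ->
  bk (drk_comb x1 x2) y = bk x1 (y - y2) - bk x2 y.
Proof.
move=> yE; rewrite /drk_comb bkBl bkBl bkZl (rk_skew _ _ rmu) yE !bkB bkZ.
exact: half_cancel.
Qed.

(** With the arguments written as [phi_1(A) x'], the derivative and the
    quadratic terms are [cdybe_diff] and [cdybe_quad] at zero shifts, for the
    bracket and the form of [k]. *)
Lemma cdybe_kkk (x y z : subvs_of k) :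
  cdybe_sum (vsval x) (vsval y) (vsval z) = 0.
Proof.
(* The inverses of [phi_1] in [drk] cancel, and [f(A)] is moved to the other
   factor by skewness. *)
have drk_diff v (x' y' : subvs_of k) :
    bk (drk v (phi 1 A x')) (phi 1 A y') = cdybe_diff brk bk A 0 0 v x' y'.
  have [h1 _] := rmu.
  rewrite /cdybe_diff oppr0 shift0 -adk_E /drk (inv_lfunK h1).
  exact: (drk_comb_bk _ _ (rk_psi y' rmu)).
rewrite /cdybe_sum !kpart_id !drm_kk.
have -> : cybe4 br b (rg mu) (vsval x) (vsval y) (vsval z) =
    cybe4 brk bk (rk mu) x y z.
  by rewrite /cybe4 !rg_k /tau /bk !brk_val.
have [x' ->] := psi_surj x rmu; have [y' ->] := psi_surj y rmu.
have [z' ->] := psi_surj z rmu.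
rewrite !drk_diff (cybe4E brk_r brk_l brk_alt bk_l bk_sym bk_inv) !rk_psi //.
have := cdybe_unshifted brk_r brk_l brk_alt bk_r bk_l bk_sym bk_inv
  (adk_der mu) (adk_skew mu) x' y' z'.
rewrite /cdybe_quad /rho !shift0 => ->.
move: (cdybe_diff _ _ _ _ _ _ _ _) (cdybe_diff _ _ _ _ _ _ _ _).
by move: (cdybe_diff _ _ _ _ _ _ _ _) => r1 r2 r3; ring.
Qed.

Lemma cdybe_sum_eq0 x y z : cdybe_sum x y z = 0.
Proof.
apply: cyclic_trilinear_eq0; [exact: cdybe_sum_cyc|exact: cdybe_sum_scalar|
  exact: cdybe_kkk|exact: cdybe_kkp|exact: cdybe_ppk|exact: cdybe_ppp].
Qed.

End DerivativeAt.

End DynamicalYangBaxter.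

Theorem theorem4p4 (R : realType) (g : vectType R)
    (br : g -> g -> g) (Q : g -> R) (c : 'End(g)) (k p : {vspace g})
    (dk dp n : nat) (e e' : dk.-tuple g) (u u' : dp.-tuple g)
    (E E' : n.-tuple g) :
  is_quadratic_lie br Q ->
  is_orthogonal_automorphism br Q c ->
  is_quadratic_subalgebra br Q k ->
  (k <= fixedSpace c)%VS ->
  is_orthogonal_complement Q k p ->
  (exists U : set (subvs_of k),
     [/\ vopen U, vdense U &
         forall mu, U mu -> c_exp_sub1_invertible br c p mu]) ->
  dual_bases Q k e e' ->
  dual_bases Q p u u' ->
  dual_bases Q {:g} E E' ->
  let r : subvs_of k -> bivector g := fun mu a b =>
    r_k br e e' mu a b + r_p br c p u u' mu a b in
  let D : set (subvs_of k) := regular_set br c p in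
  [/\ vopen D, vdense D &
      forall mu, D mu ->
        (forall v, dir_derivable r mu v) /\
        (forall x y z : dual g,
           wedge_differential e e' r mu x y z
             + 2^-1 * schouten_sq br E (r mu) x y z
           = 4^-1 * Theta br Q E E' x y z)].
Proof.
move=> Hg Hc Hk Hkc Hp [U [_ Ud UI]] He Hu HE r D.
have HQ := qlie_form Hg.
split.
- exact: (regular_open Hg Hk).
- exact: (regular_dense Hg Hk Ud UI).
move=> mu /regularP rmu; split=> [v al be|al be ga].
  have [x alE] := form_polar HQ HE al; have [y beE] := form_polar HQ HE be.
  by have [dv _] := rmat_line_derive Hg Hc Hk Hkc Hp He Hu rmu v alE beE.
have [x alE] := form_polar HQ HE al; have [y beE] := form_polar HQ HE be.
have [z gaE] := form_polar HQ HE ga.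
have := cdybe_sum_eq0 Hg Hc Hk Hkc Hp He rmu x y z.
rewrite /cdybe_sum /cybe4 -(wedge_differentialE Hg Hc Hk Hkc Hp He Hu rmu alE beE gaE).
rewrite (ThetaE HQ HE (qlie_nondegenerate Hg) (qlie_bracket Hg)
  (qlie_invariant Hg) alE beE gaE).
rewrite (schouten_sqE (r := rg br Q c p e e' mu) HQ HE (qlie_nondegenerate Hg)
  (qlie_bracket Hg) _ _ _ alE beE gaE) //.
- rewrite mulKf ?pnatr_eq0 // mulrN => /eqP.
  by rewrite addrA addr_eq0 => /eqP.
- exact: (rg_linear c Hg Hp He mu).
- by move=> s t; exact: (rg_skew Hg Hc Hk Hkc Hp He s t rmu).
by move=> a a' s t; exact: (rmatE Hg Hc Hk Hkc Hp He Hu rmu).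
Qed.
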